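(* Let $n\ge2$ and let $M$ be a compact non-isoparametric minimal hypersurface of $S^{n+1}$ belonging to the family of rotational examples $\phi$ described in the context (with $H=0$). Then the stability index of $M$, i.e. the number of negative eigenvalues (counted with multiplicity) of the operator $$J(f)=-\Delta f-nf-\|A\|^2 f$$ acting on smooth functions on $M$, is greater than $2n+5$.
   Context: $S^{n+1}$ is the unit sphere in $\mathbb{R}^{n+2}$; $\Delta$ is the Laplacian of the induced metric on $M$ and $\|A\|^2$ is the square of the norm of the shape operator of $M$. Isoparametric means having constant principal curvatures. The family of examples ($H=0$): let $C>0$ and let $g:\mathbb{R}\to\mathbb{R}$ be a smooth positive non-constant $T$-periodic solution ($T$ the least period, $g(0)=\min g$) of $(g')^2+g^{2-2n}+g^2=C$. Put $r=\frac{g}{\sqrt C}$, $\lambda=g^{-n}$, $\theta(u)=\int_0^u\frac{r(s)\lambda(s)}{1-r^2(s)}ds$, and $$\phi(y,u)=\Big(r(u)\,y,\ \sqrt{1-r(u)^2}\cos\theta(u),\ \sqrt{1-r(u)^2}\sin\theta(u)\Big),\qquad (y,u)\in S^{n-1}\times\mathbb{R}.$$ This is a minimal immersion into $S^{n+1}$ with two principal curvatures everywhere, $\lambda$ (multiplicity $n-1$) and $-(n-1)\lambda$. When $\theta(T)=\frac{2k\pi}{m}$ with $k,m$ relatively prime positive integers, $\phi$ descends to an immersion of the compact manifold $S^{n-1}\times(\mathbb{R}/mT\mathbb{Z})$; the compact examples $M$ are these compact immersed hypersurfaces. *)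

(* Defs.v *)
From HB Require Import structures.
From mathcomp Require Import all_boot all_order all_algebra.
From mathcomp Require Import ring.
From mathcomp Require Import all_classical all_reals all_analysis.

Set Implicit Arguments.
Unset Strict Implicit.
Unset Printing Implicit Defensive.

Import Order.TTheory GRing.Theory Num.Theory.
Import numFieldNormedType.Exports.

Local Open Scope classical_set_scope.
Local Open Scope ring_scope.

Section Calculus.
Context {R : realType}.

Definition dot (n : nat) (v w : 'rV[R]_n) : R := \sum_i v 0 i * w 0 i.

Definition pderiv (n : nat) (V : normedModType R) (i : 'I_n)
    (f : 'rV[R]_n -> V) (x : 'rV[R]_n) : V :=
  'D_(delta_mx 0 i) f x.

Fixpoint is_Ck (n k : nat) (f : 'rV[R]_n -> R) : Prop :=
  if k is k'.+1 then
    forall i : 'I_n,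
      (forall x, derivable f x (delta_mx 0 i)) /\ is_Ck k' (pderiv i f)
  else continuous f.

Definition is_smooth (n : nat) (f : 'rV[R]_n -> R) : Prop :=
  forall k, is_Ck k f.

Definition tangents (n d : nat) (X : 'rV[R]_n -> 'rV[R]_d) (x : 'rV[R]_n)
    : 'M[R]_(n, d) :=
  \matrix_(i < n, j < d) (pderiv i X x) 0 j.

Definition metric (n d : nat) (X : 'rV[R]_n -> 'rV[R]_d) (x : 'rV[R]_n)
    : 'M[R]_n :=
  \matrix_(i, j) dot (row i (tangents X x)) (row j (tangents X x)).

(* Laplace-Beltrami operator of the induced metric, in coordinates:
   |G|^(-1/2) sum_i d_i (|G|^(1/2) sum_j G^ij d_j f). *)
Definition laplacian (n d : nat) (X : 'rV[R]_n -> 'rV[R]_d)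
    (f : 'rV[R]_n -> R) (x : 'rV[R]_n) : R :=
  (Num.sqrt (\det (metric X x)))^-1 *
  \sum_(i < n) pderiv i (fun z => Num.sqrt (\det (metric X z)) *
      \sum_(j < n) invmx (metric X z) i j * pderiv j f z) x.

(* Generalized cross product of X and its n coordinate tangent vectors in
   R^(n+2): orthogonal to all of them, hence normal to X inside the sphere. *)
Definition cross (n : nat) (X : 'rV[R]_n -> 'rV[R]_n.+2) (x : 'rV[R]_n)
    : 'rV[R]_n.+2 :=
  \row_(k < n.+2)
    \det (col_mx (delta_mx 0 k : 'rV_n.+2) (col_mx (X x) (tangents X x))).

Definition unit_normal (n : nat) (X : 'rV[R]_n -> 'rV[R]_n.+2)
    (x : 'rV[R]_n) : 'rV[R]_n.+2 :=
  (Num.sqrt (dot (cross X x) (cross X x)))^-1 *: cross X x.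

(* Matrix A of the shape operator v |-> - D_v N in the coordinate basis, acting
   on row vectors: A *m tangents X x = - tangents N x. *)
Definition shape_op (n : nat) (X : 'rV[R]_n -> 'rV[R]_n.+2) (x : 'rV[R]_n)
    : 'M[R]_n :=
  - (tangents (unit_normal X) x *m (tangents X x)^T *m invmx (metric X x)).

(* Hilbert-Schmidt norm tr (A A* ), the adjoint A* being taken with respect to
   the induced metric. *)
Definition shape_sqnorm (n : nat) (X : 'rV[R]_n -> 'rV[R]_n.+2)
    (x : 'rV[R]_n) : R :=
  \tr (shape_op X x *m (metric X x *m (shape_op X x)^T *m invmx (metric X x))).

End Calculus.

Definition sphere (R : realType) (n : nat) : Type :=
  {y : 'rV[R]_n | dot y y == 1}.

Section Atlas.
Context {R : realType} {n : nat}.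

Definition pole (a : 'I_n * bool) : 'rV[R]_n := (-1) ^+ a.2 *: delta_mx 0 a.1.

(* Orthogonal projection on the equatorial hyperplane x_i = 0. *)
Definition equator (a : 'I_n * bool) (x : 'rV[R]_n) : 'rV[R]_n :=
  x - x 0 a.1 *: delta_mx 0 a.1.

Definition stereo_vec (a : 'I_n * bool) (x : 'rV[R]_n) : 'rV[R]_n :=
  let z := equator a x in
  (dot z z + 1)^-1 *: (2 *: z + (dot z z - 1) *: pole a).

Lemma stereo_subproof (a : 'I_n * bool) (x : 'rV[R]_n) :
  dot (stereo_vec a x) (stereo_vec a x) == 1.
Proof.
rewrite /stereo_vec; set z := equator a x; set q := dot z z.
have dotE (c s t : R) (v w : 'rV[R]_n) :
    dot (c *: (s *: v + t *: w)) (c *: (s *: v + t *: w)) =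
    c ^+ 2 * (s ^+ 2 * dot v v + 2 * s * t * dot v w + t ^+ 2 * dot w w).
  rewrite /dot !mulr_sumr -!big_split /= mulr_sumr.
  by apply: eq_bigr => i _; rewrite !mxE; ring.
have dz (t : R) (v : 'rV[R]_n) : dot v (t *: delta_mx 0 a.1) = t * v 0 a.1.
  rewrite /dot (bigD1 a.1) //= !mxE !eqxx mulr1 big1 ?addr0 1?mulrC // => i ia.
  by rewrite !mxE eqxx (negbTE ia) !mulr0.
have q0 : 0 <= q by apply: sumr_ge0 => i _; rewrite -expr2 sqr_ge0.
have zp : dot z (pole a) = 0 by rewrite dz !mxE !eqxx mulr1 subrr mulr0.
have pp : dot (pole a) (pole a) = 1.
  by rewrite dz !mxE !eqxx mulr1 -expr2 sqrr_sign.
rewrite dotE zp pp -/q mulr0 addr0 mulr1 exprVn.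
have q1 : q + 1 != 0 by rewrite gt_eqF // ltr_wpDl.
have -> : 2 ^+ 2 * q + (q - 1) ^+ 2 = (q + 1) ^+ 2 by ring.
by rewrite mulVf // expf_neq0.
Qed.

(* Parametrizations of S^(n-1) x R by R^n: for each pole +-e_i, the coordinate
   x_i is used for the R factor, and the n-1 remaining ones for the inverse
   stereographic projection from that pole. Their images cover S^(n-1) x R. *)
Definition chart (a : 'I_n * bool) (x : 'rV[R]_n) : sphere R n * R :=
  (exist _ (stereo_vec a x) (stereo_subproof a x), x 0 a.1).

End Atlas.

Section Family.
Context {R : realType}.

Record profile (n : nat) (C T : R) (g : R -> R) : Prop := Profile {
  prof_C0 : 0 < C;
  prof_smooth : forall j u, derivable (derive1n j g) u 1;
  prof_gt0 : forall u, 0 < g u;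
  prof_nonconst : exists u v, g u != g v;
  prof_T0 : 0 < T;
  prof_period : forall u, g (u + T) = g u;
  prof_least : forall T', 0 < T' -> (forall u, g (u + T') = g u) -> T <= T';
  prof_min : forall u, g 0 <= g u;
  prof_ode : forall u,
    derive1 g u ^+ 2 + g u ^ (2 - 2 * n%:Z) + g u ^+ 2 = C
}.

Definition prof_r (C : R) (g : R -> R) (u : R) : R := g u / Num.sqrt C.

Definition prof_lambda (n : nat) (g : R -> R) (u : R) : R := g u ^- n.

Definition oriented_int (F : R -> R) (a b : R) : R :=
  if a <= b then (\int[lebesgue_measure]_(s in `[a, b]) F s)%R
  else - (\int[lebesgue_measure]_(s in `[b, a]) F s)%R.

Definition theta (n : nat) (C : R) (g : R -> R) (u : R) : R :=
  oriented_int (fun s => prof_r C g s * prof_lambda n g s /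
                         (1 - prof_r C g s ^+ 2)) 0 u.

Definition phi (n : nat) (C : R) (g : R -> R) (q : sphere R n * R)
    : 'rV[R]_n.+2 :=
  let u := q.2 in
  let h := Num.sqrt (1 - prof_r C g u ^+ 2) in
  castmx (erefl, addn2 n)
    (row_mx (prof_r C g u *: sval q.1)
       (\row_(j < 2) (if j == 0 then h * cos (theta n C g u)
                      else h * sin (theta n C g u)))).

Definition phi_chart (n : nat) (C : R) (g : R -> R) (a : 'I_n * bool)
    : 'rV[R]_n -> 'rV[R]_n.+2 :=
  @phi n C g \o chart a.

(* The images of the charts are connected and cover the source, and the normals
   of two charts agree up to sign, so this is constancy of the principal
   curvatures on the whole hypersurface. *)
Definition isoparametric (n : nat) (C : R) (g : R -> R) : Prop :=
  forall (a : 'I_n * bool) (x y : 'rV[R]_n) (kappa : R),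
    eigenvalue (shape_op (@phi_chart n C g a) x) kappa =
    eigenvalue (shape_op (@phi_chart n C g a) y) kappa.

(* Smooth functions on S^(n-1) x (R / L Z), seen as L-periodic functions. *)
Definition smooth_on (n : nat) (L : R) (f : sphere R n * R -> R) : Prop :=
  (forall y u, f (y, u + L) = f (y, u)) /\
  (forall a : 'I_n * bool, is_smooth (f \o chart a)).

(* The value of J f at the point chart a x. *)
Definition jacobi_op (n : nat) (C : R) (g : R -> R) (a : 'I_n * bool)
    (f : sphere R n * R -> R) (x : 'rV[R]_n) : R :=
  - laplacian (@phi_chart n C g a) (f \o chart a) x
  - n%:R * f (chart a x)
  - shape_sqnorm (@phi_chart n C g a) x * f (chart a x).

Definition eigenspace_J (n : nat) (C L : R) (g : R -> R) (c : R)
    : set (sphere R n * R -> R) :=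
  [set f | smooth_on L f /\
    forall (a : 'I_n * bool) x, jacobi_op C g a f x = c * f (chart a x)].

Definition lin_indep (M : Type) (k : nat) (f : 'I_k -> M -> R) : Prop :=
  forall c : 'I_k -> R,
    (forall q, \sum_(i < k) c i * f i q = 0) -> forall i, c i = 0.

Definition dimension (M : Type) (E : set (M -> R)) : \bar R :=
  ereal_sup [set k%:R%:E | k in [set k : nat |
    exists f : 'I_k -> M -> R, (forall i, E (f i)) /\ lin_indep f]].

(* Number of negative eigenvalues of J on S^(n-1) x (R / L Z), counted with
   multiplicity: the sum over c < 0 of the dimensions of the c-eigenspaces
   (which are 0 when c is not an eigenvalue). *)
Definition stability_index (n : nat) (C L : R) (g : R -> R) : \bar R :=
  \esum_(c in [set c : R | c < 0]) dimension (@eigenspace_J n C L g c).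

End Family.

(* Main.v *)
(* By rotational symmetry a function h(u) Y(y), with Y a spherical harmonic of
degree 0 or 1 on the first factor, is an eigenfunction of J exactly when h is
an mT-periodic eigenfunction of a Sturm-Liouville operator on the profile curve.
Since r is even and periodic, odd solutions vanishing at mT/2 and even solutions
with critical point at mT/2 are mT-periodic, and the intermediate value theorem
for the Pruefer angle at mT/2, as a function of the spectral parameter, turns
zeros of a solution at energy 0 into negative eigenvalues.  The energy 0
solutions are normal components of infinitesimal rotations of the sphere: r' for
the rotation of the last plane (degree 0), and a combination of r' cos(theta)
and lambda sin(theta) for the rotations mixing the two factors (degree 1).
Their zeros are controlled by m and by theta(T), and pi < theta(T) < 2 pi: the
lower bound is a convexity estimate in the variable r^2 / (1 - r^2), the upper
bound a Sturm comparison of r' with a coordinate of the unit normal.  Hence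
m >= 3, degree 0 contributes at least 4 eigenvalues and degree 1 at least 3
eigenvalues of multiplicity n, and 3n + 4 > 2n + 5 for n >= 2. *)
Require Import Defs.
From HB Require Import structures.
From mathcomp Require Import all_boot all_order all_algebra.
From mathcomp Require Import zify ring lra perm.
From mathcomp Require Import all_classical all_reals all_analysis.
Import Order.TTheory GRing.Theory Num.Theory.
Import numFieldNormedType.Exports.

Set Implicit Arguments.
Unset Strict Implicit.
Unset Printing Implicit Defensive.

Local Open Scope classical_set_scope.
Local Open Scope ring_scope.

(** * Differentiation *)

(** The index is bounded below by exhibiting eigenfunctions. Periodicity alone is a condition on a 2
    x 2 monodromy matrix; fixing the parity of the solution turns it into one boundary condition at
    [l = m T / 2], hence into one equation for one continuous function of the energy. Energy 0
    itself must not be hit, so the angle at energy 0 has to exceed each target value strictly. This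
    is why degree 0, whose second zero lies before [l], gives two odd eigenfunctions, while degree
    1, whose second zero is [l] itself, gives only one; the even angle starts ahead of the odd one
    and gives two in both cases. Even and odd eigenvalues, or eigenvalues of different degrees, may
    coincide, so linear independence is proved for the whole family, which is then counted
    eigenvalue by eigenvalue. For n = 2 the count is 10 against 9. From the profile curve on, [N] is
    n - 1. *)

Section DerivativeRules.
Context {R : realType} {V : normedModType R}.
Implicit Types (f g : V -> R) (h : R -> R) (x v : V) (a b c : R).

Lemma der_eq f x v a b : is_derive x v f a -> a = b -> is_derive x v f b.
Proof. by move=> + <-. Qed.

Lemma der_ext f g x v a : f =1 g -> is_derive x v f a -> is_derive x v g a.
Proof. by move=> /funext ->. Qed.

Lemma der_cst c x v : is_derive x v (fun=> c) 0.
Proof. exact: is_derive_cst. Qed.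

Lemma der_add f g x v a b : is_derive x v f a -> is_derive x v g b ->
  is_derive x v (fun z => f z + g z) (a + b).
Proof. exact: is_deriveD. Qed.

Lemma der_opp f x v a : is_derive x v f a -> is_derive x v (fun z => - f z) (- a).
Proof. exact: is_deriveN. Qed.

Lemma der_sub f g x v a b : is_derive x v f a -> is_derive x v g b ->
  is_derive x v (fun z => f z - g z) (a - b).
Proof. by move=> fa gb; apply: der_add => //; exact: der_opp. Qed.

Lemma der_mul f g x v a b : is_derive x v f a -> is_derive x v g b ->
  is_derive x v (fun z => f z * g z) (a * g x + f x * b).
Proof.
move=> fa gb; apply: (der_eq (is_deriveM fa gb)).
by rewrite addrC /GRing.scale/= mulrC.
Qed.

Lemma der_mulc f x v a c : is_derive x v f a ->
  is_derive x v (fun z => c * f z) (c * a).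
Proof.
move=> fa; apply: (der_eq (der_mul (der_cst c x v) fa)).
by rewrite mul0r add0r.
Qed.

Lemma der_exp f x v a n : is_derive x v f a ->
  is_derive x v (fun z => f z ^+ n) (n%:R * f x ^+ n.-1 * a).
Proof.
move=> fa; have := is_deriveX n fa; apply: der_ext => z.
by rewrite exprfctE.
Qed.

Lemma der_sum n (F : 'I_n -> V -> R) (dF : 'I_n -> R) x v :
  (forall i, is_derive x v (F i) (dF i)) ->
  is_derive x v (fun z => \sum_(i < n) F i z) (\sum_(i < n) dF i).
Proof.
elim: n F dF => [|n IH] F dF FdF.
  by rewrite big_ord0; apply: der_ext (der_cst 0 x v) => z; rewrite big_ord0.
rewrite big_ord_recl.
apply: (@der_ext (fun z => F ord0 z + \sum_(i < n) F (lift ord0 i) z)).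
  by move=> z /=; rewrite big_ord_recl.
by apply: der_add => //; exact: (IH (fun i => F (lift ord0 i))).
Qed.

(** Restriction to a line carries the one-variable chain rule over to functions on [V] that are only
    known to have a derivative along [v]. *)
Lemma der_line f x v a :
  is_derive x v f a <-> is_derive (0 : R) 1 (fun t => f (t *: v + x)) a.
Proof.
have E : (fun h : R => h^-1 *: ((f \o shift x) (h *: v) - f x)) =
    (fun h : R => h^-1 *: (((fun t => f (t *: v + x)) \o shift 0) (h *: 1) -
       f (0 *: v + x))).
  by apply/funext => h /=; rewrite scale0r add0r addr0 /GRing.scale/= mulr1.
split=> -[dfx fa]; split.
- by rewrite /derivable -E.
- by rewrite /derive -E.
- by rewrite /derivable E.
- by rewrite /derive E.
Qed.

Lemma der_comp h f x v a c : is_derive (f x) 1 h c -> is_derive x v f a ->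
  is_derive x v (fun z => h (f z)) (c * a).
Proof.
move=> hc /der_line fa; apply/der_line.
have hc' : is_derive (f (0 *: v + x)) 1 h c by rewrite scale0r add0r.
exact: (@is_derive1_comp R h (fun t => f (t *: v + x)) 0 c a hc' fa).
Qed.

End DerivativeRules.

Section RealDerivatives.
Context {R : realType}.
Implicit Types (f g h : R -> R) (x a b c : R).

Lemma der_id x : is_derive x 1 (fun z : R => z) 1.
Proof. exact: is_derive_id. Qed.

Lemma der_inv_at x : x != 0 -> is_derive x 1 (fun z : R => z^-1) (- x ^- 2).
Proof.
move=> x0; apply: (der_eq (is_deriveV x0 (der_id x))).
by rewrite /GRing.scale/= mulr1.
Qed.

Lemma der_sqrt_at x : 0 < x -> is_derive x 1 (@Num.sqrt R) (2 * Num.sqrt x)^-1.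
Proof. by move=> x0; exact: is_derive1_sqrt. Qed.

Lemma der_continuous f x a : is_derive x 1 f a -> {for x, continuous f}.
Proof. by case=> df _; apply/differentiable_continuous/derivable1_diffP. Qed.

Lemma der_continuousT f f' : (forall x, is_derive x 1 f (f' x)) -> continuous f.
Proof. by move=> fd x; exact: der_continuous (fd x). Qed.

Lemma der_unique f x a b : is_derive x 1 f a -> is_derive x 1 f b -> a = b.
Proof. by move=> [_ <-] [_ <-]. Qed.

End RealDerivatives.

Section MeanValue.
Context {R : realType}.
Implicit Types (f g : R -> R) (x a b c : R).

Lemma der_mono f f' a b : a <= b ->
  (forall x, a <= x <= b -> is_derive x 1 f (f' x)) ->
  (forall x, a <= x <= b -> 0 <= f' x) -> f a <= f b.
Proof.
move=> ab fd f0.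
have cf : {within `[a, b], continuous f}.
  apply: continuous_in_subspaceT => x; rewrite inE/= in_itv/= => xab.
  exact: der_continuous (fd x xab).
have fd' x : x \in `]a, b[ -> is_derive x 1 f (f' x).
  by rewrite in_itv/= => /andP[/ltW ax /ltW xb]; apply: fd; rewrite ax xb.
have [c cab E] := MVT_segment ab fd' cf.
by rewrite -subr_ge0 E mulr_ge0 ?subr_ge0 ?f0//; move: cab; rewrite in_itv.
Qed.

Lemma der_smono f f' a b : a < b ->
  (forall x, a <= x <= b -> is_derive x 1 f (f' x)) ->
  (forall x, a < x < b -> 0 < f' x) -> f a < f b.
Proof.
move=> ab fd f0.
have cf : {within `[a, b], continuous f}.
  apply: continuous_in_subspaceT => x; rewrite inE/= in_itv/= => xab.
  exact: der_continuous (fd x xab).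
have fd' x : x \in `]a, b[ -> is_derive x 1 f (f' x).
  by rewrite in_itv/= => /andP[/ltW ax /ltW xb]; apply: fd; rewrite ax xb.
have [c cab E] := MVT ab fd' cf.
by rewrite -subr_gt0 E mulr_gt0 ?subr_gt0 ?f0//; move: cab; rewrite in_itv.
Qed.

Lemma der_cst_eq f a b : (forall x, is_derive x 1 f 0) -> f a = f b.
Proof. by move=> f0; exact: is_derive_0_is_cst. Qed.

Lemma der_le f f' g g' a b : a <= b ->
  (forall x, a <= x <= b -> is_derive x 1 f (f' x)) ->
  (forall x, a <= x <= b -> is_derive x 1 g (g' x)) ->
  (forall x, a <= x <= b -> f' x <= g' x) -> f b - f a <= g b - g a.
Proof.
move=> ab fd gd fg.
have := @der_mono (fun x => g x - f x) (fun x => g' x - f' x) a b ab.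
move=> /(_ _ _)H; suff : g a - f a <= g b - f b by lra.
apply: H => x xab; first exact: der_sub (gd x xab) (fd x xab).
by rewrite subr_ge0 fg.
Qed.

Lemma IVT_cont f a b v : a <= b -> (forall x, a <= x <= b -> {for x, continuous f}) ->
  f a <= v <= f b -> exists2 c, a <= c <= b & f c = v.
Proof.
move=> ab cf /andP[av vb].
have cf' : {within `[a, b], continuous f}.
  by apply: continuous_in_subspaceT => x; rewrite inE/= in_itv/= => /cf.
have [|c cab fc] := IVT ab cf' (v := v).
  by rewrite minEle maxEle (le_trans av vb) av vb.
by exists c => //; move: cab; rewrite in_itv.
Qed.

Lemma der_reflect f a x c : is_derive (c - x) 1 f a ->
  is_derive x 1 (fun z => f (c - z)) (- a).
Proof.
move=> fa; rewrite -mulrN1; apply: (@der_comp _ _ f (fun z => c - z)) => //.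
by rewrite -[X in is_derive _ _ _ X]sub0r; apply: der_sub.
Qed.

End MeanValue.

(** The fundamental theorem of calculus concerns primitives based at the left end of an interval.
    Basing one at [- N], to the left of both 0 and [u], treats both signs of [u]: near [u] the
    oriented integral is [G y - G 0]. *)
Lemma der_oriented_int {R : realType} (f : R -> R) (u : R) : continuous f ->
  is_derive u 1 (oriented_int f 0) (f u).
Proof.
move=> cf; set N := `|u| + 1.
have int a b : (@lebesgue_measure R).-integrable `[a, b] (EFin \o f).
  apply: continuous_compact_integrable; first exact: segment_compact.
  exact: continuous_subspaceT.
pose G y := (\int[lebesgue_measure]_(t in [set` `[- N, y]]) f t)%R.
have [uN Nu] : u < N /\ - N < u.
  by split; [rewrite ltr_pwDr// ler_norm|rewrite ltrNl ltr_pwDr// -normrN ler_norm].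
have N0 : 0 < N by rewrite ltr_wpDl.
have [dG G'] := @continuous_FTC1_closed _ f _ _ _ uN (int (- N) N) Nu (cf u).
have Gu : is_derive u 1 (fun y => G y - G 0) (f u).
  have dGu : is_derive u 1 G (f u) by apply: DeriveDef; [exact: dG|rewrite -derive1E; exact: G'].
  exact: der_eq (der_sub dGu (der_cst (G 0) u 1)) (subr0 _).
apply: near_eq_is_derive Gu.
near=> y.
have yN : - N < y by near: y; exact: lt_nbhsr.
rewrite /oriented_int; case: ifPn => [y0|]; last rewrite -ltNge => y0.
- rewrite -Rintegral_itv_obnd_cbnd; last first.
    by apply: integrableS (int 0 y) => //; exact: subset_itv_oc_cc.
  by rewrite -(@Rintegral_itvB _ f (BLeft (- N)) (BRight y)) ?bnd_simp ?oppr_le0// ltW.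
- rewrite -Rintegral_itv_obnd_cbnd; last first.
    by apply: integrableS (int y 0) => //; exact: subset_itv_oc_cc.
  by rewrite -(@Rintegral_itvB _ f (BLeft (- N)) (BRight 0)) ?bnd_simp ?opprB// ltW.
Unshelve. all: by end_near. Qed.

(** * Ordinary differential equations *)

Section Gronwall.
Context {R : realType}.
Implicit Types (y : R -> R) (a b K M : R).

Lemma der_expRc K (x : R) : is_derive x 1 (fun z => expR (K * z)) (K * expR (K * x)).
Proof.
rewrite mulrC; apply: (@der_comp _ _ expR (fun z => K * z)).
exact: der_eq (der_mulc K (der_id x)) (mulr1 K).
Qed.

(** With [e x = exp (- K (x - a)) <= 1], the function [M x - y x * e x] is nondecreasing. *)
Lemma gronwall y y' K M a b : a <= b -> 0 <= K -> 0 <= M ->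
  (forall x : R, is_derive x 1 y (y' x)) ->
  (forall x, a <= x <= b -> y' x <= K * y x + M) ->
  y b <= (y a + M * (b - a)) * expR (K * (b - a)).
Proof.
move=> ab K0 M0 dy le_y'.
pose e x := expR (K * a) * expR (- K * x).
have de (x : R) : is_derive x 1 e (- K * e x).
  by apply: der_eq (der_mulc _ (der_expRc (- K) x)) _; rewrite /e; ring.
have e1 x : a <= x -> e x <= 1.
  move=> ax; rewrite /e -expRD -expR0 ler_expR; nra.
have := @der_mono _ (fun x => M * x - y x * e x)
  (fun x => M - (y' x - K * y x) * e x) a b ab.
move=> /(_ _ _)H.
have {H} : M * a - y a * e a <= M * b - y b * e b.
  apply: H => x /andP[ax xb].
    apply: der_eq (der_sub (der_mulc M (der_id x)) (der_mul (dy x) (de x))) _.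
    by ring.
  have := e1 x ax; have := le_y' x; rewrite ax xb => /(_ isT).
  have : 0 < e x by rewrite mulr_gt0 ?expR_gt0.
  move: (e x) (y' x) (y x) => ex y'x yx; nra.
have -> : e a = 1 by rewrite /e -expRD mulNr subrr expR0.
have -> : e b = expR (- (K * (b - a))) by rewrite /e -expRD; congr expR; ring.
rewrite expRN mulr1 => H.
rewrite -ler_pdivrMr ?expR_gt0//; lra.
Qed.

(** The uniqueness principle in both directions of time, meant for [y] the squared distance of two
    solutions; the past is reduced to the future by reflection. *)
Lemma gronwall_zero y y' K (u0 u : R) : 0 <= K ->
  (forall x : R, is_derive x 1 y (y' x)) -> (forall x, 0 <= y x) ->
  (forall x, `|y' x| <= K * y x) -> y u0 = 0 -> y u = 0.
Proof.
move=> K0 dy y0 yK yu0; apply/eqP; rewrite eq_le y0 andbT.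
have [u0u|/ltW uu0] := leP u0 u.
- have := @gronwall y y' K 0 u0 u u0u K0 (lexx _) dy.
  rewrite yu0 mul0r addr0 mul0r; apply=> x _.
  by rewrite addr0 (le_trans (ler_norm _)).
- have dr (x : R) : is_derive x 1 (fun z => y (0 - z)) (- y' (0 - x)).
    exact: der_reflect.
  have := @gronwall _ _ K 0 (- u0) (- u) _ K0 (lexx _) dr.
  rewrite !sub0r !opprK yu0 mul0r addr0 mul0r lerN2; apply=> // x _.
  by rewrite addr0 sub0r (le_trans (ler_norm _))// normrN.
Qed.

(* Barrier argument: while [d > 0] one has [d' <= K d], so [d] cannot leave 0. *)
Lemma barrier (d d' : R -> R) K a b : a <= b -> 0 <= K ->
  (forall x : R, is_derive x 1 d (d' x)) ->
  (forall x, a <= x <= b -> d' x <= K * `|d x|) -> d a <= 0 -> d b <= 0.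
Proof.
move=> ab K0 dd le_d' da; rewrite leNgt; apply/negP => db.
(* The supremum [s] of [S] is the last point where [d <= 0]. Beyond it [d] is positive and the
   hypothesis is a Gronwall inequality; at [s] itself continuity gives [d s = 0] as soon as
   [s < b]. *)
pose S := [set x | a <= x <= b /\ d x <= 0].
have Sa : S a by split; rewrite ?lexx.
have S0 : S !=set0 by exists a.
have Sub : has_ubound S by exists b => x [/andP[]].
pose s := sup S.
have as_ : a <= s by apply: (ub_le_sup Sub).
have sb : s <= b by apply: ge_sup S0 _ => x [/andP[]].
have after x : s < x -> x <= b -> 0 < d x.
  move=> sx xb; rewrite ltNge; apply/negP => dx0.
  suff: x <= s by rewrite leNgt sx.
  by apply: (ub_le_sup Sub); split; rewrite ?xb ?(le_trans as_ (ltW sx)).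
have cd : continuous d by exact: der_continuousT dd.
have ds : d s <= 0.
  rewrite leNgt; apply/negP => ds0.
  have /nbhs_ballP[e /= e0 He] : \forall x \near s, 0 < d x.
    exact: (cvgr_gt _ (cd s)).
  have [x Sx sx] := sup_adherent e0 (conj S0 Sub).
  have : 0 < d x.
    apply: He; rewrite /ball/= ger0_norm; first by rewrite -/s in sx; lra.
    by rewrite subr_ge0; apply: (ub_le_sup Sub).
  by rewrite ltNge (proj2 Sx).
have := @gronwall d d' K 0 s b sb K0 (lexx _) dd; rewrite mul0r addr0.
move=> H; have : d b <= d s * expR (K * (b - s)).
  apply: H => x /andP[sx xb]; rewrite addr0.
  move: sx; rewrite le_eqVlt => /predU1P[<-|sx].
    have sab : a <= s <= b by rewrite as_.
    have ds' : d s = 0.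
      apply/eqP; rewrite eq_le ds/= leNgt; apply/negP => ds0.
      have /nbhs_ballP[e /= e0 He] : \forall x \near s, d x < 0.
        exact: (cvgr_lt _ (cd s)).
      have sltb : s < b by rewrite lt_neqAle sb andbT; apply/eqP => E; rewrite E in ds0; lra.
      pose z := Num.min (s + e / 2) b.
      have sz : s < z by rewrite lt_min sltb andbT; lra.
      have zs : z <= s + e / 2 by rewrite ge_min lexx.
      have zb : z <= b by rewrite ge_min lexx orbT.
      have dz := after z sz zb.
      have : d z < 0.
        by apply: He; rewrite /ball/= distrC ger0_norm; lra.
      lra.
    by apply: le_trans (le_d' s sab) _; rewrite ds' normr0.
  apply: le_trans (le_d' x _) _; first by rewrite (le_trans as_ (ltW sx)).
  by rewrite ger0_norm// ltW// after.
have := expR_gt0 (K * (b - s)); nra.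
Qed.

End Gronwall.

(** * Global solutions for bounded Lipschitz fields *)

Section Picard.
Context {R : realType}.

Lemma le_pow2 (x y c : R) : 0 <= c ->
  (forall k, x <= y + c * 2 ^- k) -> x <= y.
Proof.
move=> c0 H; apply/ler_addgt0Pr => e e0.
have := archi_boundP (divr_ge0 c0 (ltW e0)); set N := Num.bound _ => kc.
apply: le_trans (H N) _; rewrite lerD2l.
have N2 : (N%:R : R) <= 2 ^+ N by rewrite -natrX ler_nat ltnW// ltn_expl.
rewrite ler_pdivrMr ?exprn_gt0// mulrC -ler_pdivrMr//.
by rewrite (le_trans (ltW kc)).
Qed.

(** The intervals of radius [c * 2^-k] around [a k] are nested; the limit is the supremum of their
    left ends. *)
Lemma geometric_cauchy (a : nat -> R) (c : R) : 0 <= c ->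
  (forall k, `|a k.+1 - a k| <= c * 2 ^- k.+1) ->
  exists l, forall k, `|l - a k| <= c * 2 ^- k.
Proof.
move=> c0 ac.
have p2 k : 2 ^- k = 2 * 2 ^- k.+1 :> R by rewrite exprS invfM mulrA divff ?mul1r.
pose lo k := a k - c * 2 ^- k; pose hi k := a k + c * 2 ^- k.
have lo_mono j k : (j <= k)%N -> lo j <= lo k.
  elim: k => [|k IH]; first by rewrite leqn0 => /eqP ->.
  rewrite leq_eqVlt => /predU1P[->//|/IH H]; apply: le_trans H _.
  have := ac k; rewrite ler_norml /lo => /andP[]; rewrite (p2 k); nra.
have hi_mono j k : (j <= k)%N -> hi k <= hi j.
  elim: k => [|k IH]; first by rewrite leqn0 => /eqP ->.
  rewrite leq_eqVlt => /predU1P[->//|/IH H]; apply: le_trans _ H.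
  have := ac k; rewrite ler_norml /hi => /andP[]; rewrite (p2 k); nra.
have lohi j k : lo j <= hi k.
  have lh i : lo i <= hi i.
    have : 0 <= c * 2 ^- i by rewrite mulr_ge0 ?invr_ge0 ?exprn_ge0.
    by rewrite /lo /hi; lra.
  have [jk|kj] := leqP j k.
    exact: le_trans (lo_mono _ _ jk) (lh k).
  exact: le_trans (lh j) (hi_mono _ _ (ltnW kj)).
have ubd : ubound (range lo) (hi 0%N) by move=> _ [k _ <-].
exists (sup (range lo)) => k; rewrite ler_norml; apply/andP; split.
  have : lo k <= sup (range lo) by apply: ub_le_sup; [exists (hi 0%N)|exists k].
  by rewrite /lo; lra.
have : sup (range lo) <= hi k.
  by apply: ge_sup; [exists (lo 0%N), 0%N|move=> _ [j _ <-]].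
by rewrite /hi; lra.
Qed.

(** Integrating [exp (2 K |x|)] gains a factor [1 / (2 K)]. In the weighted norm
    [sup |d u| exp (- 2 K |u|)], Picard iteration for a [K]-Lipschitz field is therefore a
    contraction of ratio 1/2 on the whole line at once. *)
Lemma der_exp_bound (d d' : R -> R) (c K u : R) : 0 <= c -> 0 < K ->
  (forall x : R, is_derive x 1 d (d' x)) -> d 0 = 0 ->
  (forall x, `|d' x| <= c * K * expR (2 * K * `|x|)) ->
  `|d u| <= c / 2 * expR (2 * K * `|u|).
Proof.
move=> c0 K0; wlog u0 : d d' u / 0 <= u => [H|] dd d0 le_d'.
  have [|/ltW u0] := leP 0 u; first by move=> u0; apply: H dd d0 le_d'.
  have dr (x : R) : is_derive x 1 (fun z => d (0 - z)) (- d' (0 - x)).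
    exact: der_reflect.
  have := H _ _ (- u) _ dr; rewrite !sub0r opprK normrN oppr_ge0 oppr0; apply=> //.
  by move=> x; rewrite normrN sub0r -[`|x|]normrN.
pose g x := c / 2 * expR (2 * K * x).
have dg (x : R) : is_derive x 1 g (c * K * expR (2 * K * x)).
  by apply: der_eq (der_mulc _ (der_expRc (2 * K) x)) _; field.
have bnd x : 0 <= x <= u -> - (c * K * expR (2 * K * x)) <= d' x <= c * K * expR (2 * K * x).
  by move=> /andP[x0 _]; have := le_d' x; rewrite (ger0_norm x0) ler_norml.
have g0 : 0 <= g 0 by rewrite /g mulr_ge0 ?expR_ge0 ?divr_ge0.
rewrite (ger0_norm u0) -/(g u) ler_norml; apply/andP; split.
- have := @der_le _ (fun x => - g x) (fun x => - (c * K * expR (2 * K * x))) d d' 0 u u0.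
  move=> /(_ _ _ _)H; suff : - g u - - g 0 <= d u - d 0 by lra.
  by apply: H => // x /bnd/andP[].
- have := @der_le _ d d' g (fun x => c * K * expR (2 * K * x)) 0 u u0.
  move=> /(_ _ _ _)H; suff : d u - d 0 <= g u - g 0 by lra.
  by apply: H => // x /bnd/andP[].
Qed.

Lemma der_lipschitz (f f' : R -> R) (K x y : R) :
  (forall z : R, is_derive z 1 f (f' z)) -> (forall z, `|f' z| <= K) ->
  `|f x - f y| <= K * `|x - y|.
Proof.
move=> df f'K; wlog yx : x y / y <= x.
  move=> H; have [/H//|/ltW/H] := leP y x.
  by rewrite distrC [`|y - x|]distrC.
rewrite (ger0_norm (_ : 0 <= x - y)) ?subr_ge0// mulrBr ler_norml.
have dK (c z : R) : is_derive z 1 (fun u => c * u : R) c.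
  exact: der_eq (der_mulc c (der_id z)) (mulr1 c).
have f'K' z : - K <= f' z <= K by rewrite -ler_norml.
apply/andP; split.
- have := @der_le _ _ _ f f' y x yx (fun z _ => dK (- K) z) (fun z _ => df z).
  move=> /(_ _)H; suff : - K * x - - K * y <= f x - f y by lra.
  by apply: H => z _; case/andP: (f'K' z).
- have := @der_le _ f f' _ _ y x yx (fun z _ => df z) (fun z _ => dK K z).
  by apply=> z _; case/andP: (f'K' z).
Qed.

Lemma lipschitz_continuous (w : R -> R) (K : R) : 0 < K ->
  (forall x y, `|w x - w y| <= K * `|x - y|) -> continuous w.
Proof.
move=> K0 wK x; apply/cvgrPdist_le => e e0; near=> y.
apply: le_trans (wK _ _) _; rewrite mulrC -ler_pdivlMr//.
by near: y; apply: cvgr_dist_le => //; rewrite divr_gt0.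
Unshelve. all: by end_near. Qed.

(** Iteration of the integral operator [stp] from the constant [w0]. Continuity of [F] is asked for
    along continuous [w], the form in which the integrand occurs. *)
Lemma picard (F : R -> R -> R) (K w0 : R) : 0 < K ->
  (forall u w, `|F u w| <= K) ->
  (forall u w w', `|F u w - F u w'| <= K * `|w - w'|) ->
  (forall w : R -> R, continuous w -> continuous (fun u => F u (w u))) ->
  exists w, w 0 = w0 /\ forall u : R, is_derive u 1 w (F u (w u)).
Proof.
move=> K0 FK FL Fc.
pose stp w u := w0 + oriented_int (fun s => F s (w s)) 0 u.
have stp0 w : stp w 0 = w0.
  by rewrite /stp /oriented_int lexx set_itv1 Rintegral_set1 addr0.
have dstp (w : R -> R) (u : R) : continuous w -> is_derive u 1 (stp w) (F u (w u)).
  move=> cw; have := der_add (der_cst w0 u 1) (der_oriented_int u (Fc w cw)).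
  by move/der_eq; apply; rewrite add0r.
have stpc (w : R -> R) : continuous w -> continuous (stp w).
  by move=> cw; apply: (@der_continuousT _ _ (fun u => F u (w u))) => u; exact: dstp.
have stpL (w : R -> R) x y : continuous w -> `|stp w x - stp w y| <= K * `|x - y|.
  by move=> cw; apply: der_lipschitz => z; [exact: dstp|exact: FK].
pose it k := iter k stp (fun=> w0).
have itc k : continuous (it k).
  by elim: k => [|k IH]; [move=> x; exact: cvg_cst|exact: stpc].
pose e (u : R) : R := expR (2 * K * `|u|).
have e0 u : 0 < e u by exact: expR_gt0.
have close (w w' : R -> R) c : 0 <= c -> continuous w -> continuous w' ->
    (forall u, `|w u - w' u| <= c * e u) ->
    forall u, `|stp w u - stp w' u| <= c / 2 * e u.
  move=> c0 cw cw' ww' u.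
  apply: (@der_exp_bound (fun u => stp w u - stp w' u)
     (fun u => F u (w u) - F u (w' u))) => // [x||x].
  - by apply: der_sub; exact: dstp.
  - by rewrite !stp0 subrr.
  - apply: le_trans (FL _ _ _) _; rewrite -mulrA mulrCA ler_pM2l//; exact: ww'.
have step k u : `|it k.+1 u - it k u| <= 2 ^- k.+1 * e u.
  elim: k u => [|k IH] u.
    rewrite expr1 -[2^-1]mul1r.
    apply: (@der_exp_bound (fun u => it 1%N u - it 0%N u) (fun u => F u w0)) => // [x||x].
    - apply: der_eq (der_sub (dstp _ _ (itc 0%N)) (der_cst w0 x 1)) _.
      by rewrite subr0.
    - by rewrite /it/= stp0 subrr.
    - rewrite mul1r (le_trans (FK _ _))// ler_peMr ?(ltW K0)//.
      by rewrite -[X in X <= _]expR0 ler_expR mulr_ge0// mulr_ge0// ltW.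
  have -> : 2 ^- k.+2 = 2 ^- k.+1 / 2 :> R by rewrite exprSr invfM.
  have p0 : 0 <= 2 ^- k.+1 :> R by rewrite invr_ge0 exprn_ge0.
  exact: (close (it k.+1) (it k) _ p0 (itc _) (itc _) IH).
have /choice[w wP] : forall u, exists l, forall k, `|l - it k u| <= e u * 2 ^- k.
  move=> u; apply: geometric_cauchy => [|k]; first exact: ltW.
  by rewrite mulrC.
(* Since [|F| <= K], every iterate is [K]-Lipschitz, and this passes to the pointwise limit; so the
   limit is continuous and [stp w] can be differentiated. *)
have wL x y : `|w x - w y| <= K * `|x - y|.
  apply: (@le_pow2 _ _ (e x + e y)) => [|k]; first by rewrite addr_ge0// ltW.
  have itL : `|it k x - it k y| <= K * `|x - y|.
    case: k => [|k]; last exact: stpL.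
    by rewrite /it/= subrr normr0 mulr_ge0 ?normr_ge0// ltW.
  have -> : w x - w y = (w x - it k x) + (it k x - it k y) - (w y - it k y) by ring.
  rewrite (le_trans (ler_normB _ _))//.
  rewrite (le_trans (lerD (ler_normD _ _) (lexx _)))//.
  have := wP x k; have := wP y k; lra.
have cw : continuous w := lipschitz_continuous K0 wL.
have fixw : stp w = w.
  apply/funext => u; apply/eqP; rewrite -subr_eq0 -normr_le0.
  apply: (@le_pow2 _ _ (e u)) => [|k]; first exact: ltW.
  rewrite add0r.
  have H1 : `|stp w u - it k.+1 u| <= 2 ^- k / 2 * e u.
    have p0 : 0 <= 2 ^- k :> R by rewrite invr_ge0 exprn_ge0.
    by apply: (close w (it k) _ p0 cw (itc _)) => v; rewrite mulrC; exact: wP.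
  have H2 := wP u k.+1; rewrite exprSr invfM in H2.
  have -> : stp w u - w u = (stp w u - it k.+1 u) - (w u - it k.+1 u) by ring.
  rewrite (le_trans (ler_normB _ _))//; move: H1 H2.
  move: (2 ^- k) => p; lra.
exists w; split; first by rewrite -fixw stp0.
by move=> u; rewrite -{1}fixw; exact: dstp.
Qed.

End Picard.

(** * Sturm-Liouville operators *)

Section SturmLiouville.
Context {R : realType}.
Variables (p p' V : R -> R) (pmin pmax Vmax : R).
Hypothesis dp : forall u : R, is_derive u 1 p (p' u).
Hypothesis cV : continuous V.
Hypothesis pmin0 : 0 < pmin.
Hypothesis pminP : forall u, pmin <= p u.
Hypothesis pmaxP : forall u, p u <= pmax.
Hypothesis VmaxP : forall u, `|V u| <= Vmax.

(** The equation [- (p h')' / p + V h = c h] as a first order system. *)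
Definition sl_sol (c : R) (h h' : R -> R) :=
  forall u : R, is_derive u 1 h (h' u) /\
    is_derive u 1 h' ((V u - c) * h u - p' u / p u * h' u).

(* Vector field of the Pruefer angle [w], where [h = rho sin w] and
   [p h' = rho cos w]. *)
Definition angle_field (c u w : R) :=
  (p u)^-1 + ((c - V u) * p u - (p u)^-1) * sin w ^+ 2.

Definition angle (c : R) (w : R -> R) :=
  forall u : R, is_derive u 1 w (angle_field c u (w u)).

Let p0 u : 0 < p u. Proof. exact: lt_le_trans (pminP u). Qed.
Let pn0 u : p u != 0. Proof. by rewrite gt_eqF. Qed.
Let pmax0 : 0 < pmax. Proof. exact: lt_le_trans (p0 0) (pmaxP 0). Qed.
Let Vmax0 : 0 <= Vmax. Proof. exact: le_trans (normr_ge0 _) (VmaxP 0). Qed.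
Let cp : continuous p. Proof. exact: der_continuousT dp. Qed.

Let K (c : R) : R := 2 * pmin^-1 + (`|c| + Vmax) * pmax + 1.

Let K0 c : 0 < K c.
Proof.
have : 0 <= (`|c| + Vmax) * pmax by rewrite mulr_ge0 ?addr_ge0// ltW.
have : 0 < pmin^-1 by rewrite invr_gt0.
by rewrite /K; lra.
Qed.

Let vp u : 0 < (p u)^-1 <= pmin^-1.
Proof. by rewrite invr_gt0 p0/= lef_pV2 ?posrE ?pminP ?p0. Qed.

Let coefK c u : `|(c - V u) * p u - (p u)^-1| <= K c - 1 - (p u)^-1.
Proof.
rewrite (le_trans (ler_normB _ _))// normrM (gtr0_norm (p0 u)).
have /andP[v0 v1] := vp u; rewrite (gtr0_norm v0).
have H1 : `|c - V u| <= `|c| + Vmax.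
  by rewrite (le_trans (ler_normB _ _))// lerD2l.
have H2 : `|c - V u| * p u <= (`|c| + Vmax) * pmax.
  by rewrite ler_pM// ltW.
by rewrite /K; lra.
Qed.

Let sin2_01 (w : R) : 0 <= sin w ^+ 2 <= 1.
Proof. by rewrite sqr_ge0 -(cos2Dsin2 w) lerDr sqr_ge0. Qed.

Let der_sin2 (x : R) : is_derive x 1 (fun z => sin z ^+ 2 : R) (2 * sin x * cos x).
Proof. by apply: der_eq (der_exp 2 (is_derive_sin x)) _; rewrite expr1. Qed.

Let sin2_lip (x y : R) : `|sin x ^+ 2 - sin y ^+ 2| <= `|x - y|.
Proof.
rewrite -[X in _ <= X]mul1r; apply: (der_lipschitz _ _ der_sin2) => z.
have := cos2Dsin2 z; rewrite ler_norml.
have := sqr_ge0 (sin z + cos z); have := sqr_ge0 (sin z - cos z).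
by move: (sin z) (cos z) => s c; nra.
Qed.

Lemma angle_field_bound c u w : `|angle_field c u w| <= K c.
Proof.
have /andP[v0 v1] := vp u; have /andP[s0 s1] := sin2_01 w.
have := coefK c u; rewrite /angle_field => H.
rewrite (le_trans (ler_normD _ _))// normrM (gtr0_norm v0) (ger0_norm s0).
move: (normr_ge0 ((c - V u) * p u - (p u)^-1)) H.
by move: (`| _ |) => q; nra.
Qed.

Lemma angle_field_lip c u w w' :
  `|angle_field c u w - angle_field c u w'| <= K c * `|w - w'|.
Proof.
have -> : angle_field c u w - angle_field c u w' =
    ((c - V u) * p u - (p u)^-1) * (sin w ^+ 2 - sin w' ^+ 2).
  by rewrite /angle_field; ring.
rewrite normrM ler_pM//.
have /andP[v0 _] := vp u; have := coefK c u; lra.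
Qed.

Lemma angle_field_continuous c (w : R -> R) : continuous w ->
  continuous (fun u => angle_field c u (w u)).
Proof.
move=> cw u; have cvp : {for u, continuous (fun u => (p u)^-1)}.
  by apply: cvgV; [exact: pn0|exact: cp].
have cs : {for u, continuous (fun u => sin (w u))}.
  exact: continuous_comp (cw u) (@continuous_sin _ _).
apply: cvgD => //; apply: cvgM; last by apply: cvgM.
apply: cvgB => //; apply: cvgM; last exact: cp.
by apply: cvgB; [exact: cvg_cst|exact: cV].
Qed.

Lemma angle_exists c w0 : exists w, w 0 = w0 /\ angle c w.
Proof.
apply: (picard _ (K0 c)) => [u w|u w w'|w].
- exact: angle_field_bound.
- exact: angle_field_lip.
- exact: angle_field_continuous.
Qed.

(** The weak inequality is a barrier argument for [w1 - w2]. If the two angles met at [u],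
    uniqueness run backwards from [u] would make them equal at 0. *)
Lemma angle_sub c w1 w2 (u : R) : angle c w1 -> angle c w2 ->
  w1 0 < w2 0 -> 0 <= u -> w1 u < w2 u.
Proof.
move=> a1 a2 w12 u0.
pose d u := w1 u - w2 u.
have dd (x : R) : is_derive x 1 d (angle_field c x (w1 x) - angle_field c x (w2 x)).
  exact: der_sub.
have dle : d u <= 0.
  apply: (barrier u0 (ltW (K0 c)) dd) => [x _|]; last by rewrite /d; lra.
  by rewrite (le_trans (ler_norm _))// angle_field_lip.
rewrite lt_neqAle -subr_le0 dle andbT; apply/eqP => w12u.
suff : d 0 ^+ 2 = 0 by move=> /eqP; rewrite sqrf_eq0 /d => /eqP; lra.
apply: (gronwall_zero (u0 := u) 0 _ (fun x => der_exp 2 (dd x)) (K := 2 * K c)).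
- by rewrite mulr_ge0// ltW.
- by move=> x; rewrite sqr_ge0.
- move=> x; rewrite expr1 !normrM (gtr0_norm (ltr0n _ 2)).
  have := angle_field_lip c x (w1 x) (w2 x); rewrite -/(d x).
  rewrite -(real_normK (num_real (d x))); have := normr_ge0 (d x).
  by move: (`|d x|) (`| _ - _ |) => A B; nra.
- by rewrite /d w12u subrr expr0n.
Qed.

(** At a multiple of pi the field is [1 / p > 0] whatever the energy, so the angle passes such
    values only upwards. This lets it count the zeros of the solution. *)
Lemma angle_cross c w (a s u : R) : angle c w -> sin a = 0 -> s < u ->
  a <= w s -> a < w u.
Proof.
move=> aw sa su aws.
have F0 x : angle_field c x a = (p x)^-1 by rewrite /angle_field sa expr0n mulr0 addr0.
have up x : s <= x -> a <= w x.
  move=> sx; rewrite -subr_le0.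
  have dd (z : R) : is_derive z 1 (fun z => a - w z) (- angle_field c z (w z)).
    by rewrite -sub0r; exact: der_sub.
  apply: (barrier sx (ltW (K0 c)) dd); last by rewrite subr_le0.
  move=> z _; have := angle_field_lip c z a (w z); rewrite F0 ler_norml => /andP[_].
  by have /andP[+ _] := vp z; lra.
rewrite lt_neqAle up ?(ltW su)// andbT; apply/eqP => E.
(* If [w u = a], the angle would increase strictly up to [u] and so be below [a] just before,
   against [up]. *)
have cF : {for u, continuous (fun u => angle_field c u (w u))}.
  exact: angle_field_continuous (der_continuousT aw) _.
have Fu : 0 < angle_field c u (w u) by rewrite -E F0 invr_gt0.
have /nbhs_ballP[e /= e0 He] : \forall x \near u, 0 < angle_field c x (w x).
  exact: (cvgr_gt _ cF).
pose x := Num.max s (u - e / 2).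
have xu : x < u by rewrite gt_max su; lra.
have ex : u - e / 2 <= x by rewrite le_max lexx orbT.
have : w x < w u.
  apply: (der_smono xu (fun z _ => aw z)) => z /andP[xz zu].
  by apply: He; rewrite /ball/= ger0_norm; lra.
by rewrite -E ltNge up// le_max lexx.
Qed.

(** At [pi / 2] the field is [(c - V) p], which is nonpositive for energies below the potential:
    [pi / 2] is a barrier from above. *)
Lemma angle_low c w (u : R) : angle c w -> (forall x, c <= V x) ->
  w 0 <= pi / 2 -> 0 <= u -> w u <= pi / 2.
Proof.
move=> aw cV' w0 u0; rewrite -subr_le0.
have dd (z : R) : is_derive z 1 (fun z => w z - pi / 2) (angle_field c z (w z)).
  by rewrite -[angle_field _ _ _]subr0; exact: der_sub (aw z) (der_cst _ _ _).
apply: (barrier u0 (ltW (K0 c)) dd); last by rewrite subr_le0.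
move=> z _; have := angle_field_lip c z (w z) (pi / 2); rewrite ler_norml => /andP[_].
have : angle_field c z (pi / 2) <= 0.
  rewrite /angle_field sin_pihalf expr1n mulr1 addrC subrK.
  by rewrite mulr_le0_ge0 ?subr_le0// ltW.
lra.
Qed.

(** Gronwall for the squared difference. The fields are split so that the Lipschitz estimate is used
    at the fixed energy [c1] only, the remainder being [(c1 - c2) p sin^2]; in [2 K c1 + 1] the 1
    comes from [2 a b <= a^2 + b^2]. *)
Lemma angle_continuous (W : R -> R -> R) (l w0 : R) : 0 <= l ->
  (forall c, W c 0 = w0) -> (forall c, angle c (W c)) -> continuous (W ^~ l).
Proof.
move=> l0 W0 aW c1; apply/cvgrPdist_lt => e e0.
pose Q := pmax ^+ 2 * l * expR ((2 * K c1 + 1) * l).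
have Q0 : 0 <= Q by rewrite !mulr_ge0 ?expR_ge0// ltW.
have est c2 : (W c1 l - W c2 l) ^+ 2 <= (c1 - c2) ^+ 2 * Q.
  pose d u := W c1 u - W c2 u.
  have dd (x : R) : is_derive x 1 d
      (angle_field c1 x (W c1 x) - angle_field c2 x (W c2 x)).
    exact: der_sub (aW c1 x) (aW c2 x).
  have K20 : 0 <= 2 * K c1 + 1 by have := K0 c1; lra.
  have M0 : 0 <= (c1 - c2) ^+ 2 * pmax ^+ 2 by rewrite mulr_ge0 ?sqr_ge0.
  suff H : d l ^+ 2 <= (d 0 ^+ 2 + (c1 - c2) ^+ 2 * pmax ^+ 2 * (l - 0)) *
      expR ((2 * K c1 + 1) * (l - 0)).
    by apply: le_trans H _; rewrite /d !W0 subrr expr0n/= add0r subr0 /Q !mulrA.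
  apply: (gronwall l0 K20 M0 (fun x => der_exp 2 (dd x))) => x _.
  rewrite expr1.
  set f := _ - angle_field _ _ _.
  have fle : `|f| <= K c1 * `|d x| + `|c1 - c2| * pmax.
    have -> : f = (angle_field c1 x (W c1 x) - angle_field c1 x (W c2 x)) +
        (c1 - c2) * (p x * sin (W c2 x) ^+ 2).
      by rewrite /f /angle_field; ring.
    rewrite (le_trans (ler_normD _ _))// lerD ?angle_field_lip// normrM ler_pM//.
    have /andP[s0 s1] := sin2_01 (W c2 x).
    rewrite ger0_norm; last by rewrite mulr_ge0// ltW.
    by have := p0 x; have := pmaxP x; nra.
  have d2 : d x ^+ 2 = `|d x| ^+ 2 by rewrite real_normK ?num_real.
  have c2' : (c1 - c2) ^+ 2 = `|c1 - c2| ^+ 2 by rewrite real_normK ?num_real.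
  have : d x * f <= `|d x| * (K c1 * `|d x| + `|c1 - c2| * pmax).
    rewrite (le_trans (ler_norm _))// normrM ler_wpM2l//.
  have := sqr_ge0 (`|d x| - `|c1 - c2| * pmax).
  rewrite -mulrA d2 c2'.
  by move: (`|d x|) (`|c1 - c2|) (d x * f) => A B D; nra.
near=> c2.
rewrite -(ltr_pXn2r (n := 2)) ?nnegrE ?(ltW e0)// real_normK ?num_real//.
apply: le_lt_trans (est c2) _.
have H : `|c1 - c2| < e ^+ 2 / (Q + 1).
  near: c2; apply: cvgr_dist_lt; first exact: cvg_id.
  by rewrite divr_gt0 ?exprn_gt0// ltr_wpDl.
have H1 : `|c1 - c2| < 1.
  by near: c2; apply: cvgr_dist_lt => //; exact: cvg_id.
move: H; rewrite ltr_pdivlMr ?ltr_wpDl// => H.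
rewrite -(real_normK (num_real (c1 - c2))).
have c0 := normr_ge0 (c1 - c2).
apply: le_lt_trans (_ : `|c1 - c2| * Q < _); last by nra.
by rewrite ler_wpM2r// expr2 ler_piMl// ltW.
Unshelve. all: by end_near. Qed.


(** Inverse Pruefer transformation: given the angle, the radius solves the linear equation
    [rho' = rho f], so it is the exponential of a primitive of [f] and never vanishes. *)
Lemma sl_of_angle c w : continuous p' -> angle c w ->
  exists h h' rho, sl_sol c h h' /\ forall u,
    [/\ 0 < rho u, h u = rho u * sin (w u) & p u * h' u = rho u * cos (w u)].
Proof.
move=> cp' aw.
have cw : continuous w := der_continuousT aw.
pose f u := sin (w u) * cos (w u) * ((p u)^-1 + (V u - c) * p u).
have cf : continuous f.
  move=> u; have cvp : {for u, continuous (fun u => (p u)^-1)}.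
    by apply: cvgV; [exact: pn0|exact: cp].
  have cs : {for u, continuous (fun u => sin (w u))}.
    exact: continuous_comp (cw u) (@continuous_sin _ _).
  have cc : {for u, continuous (fun u => cos (w u))}.
    exact: continuous_comp (cw u) (@continuous_cos _ _).
  apply: cvgM; first exact: cvgM.
  apply: cvgD => //; apply: cvgM; last exact: cp.
  by apply: cvgB; [exact: cV|exact: cvg_cst].
pose rho u := expR (oriented_int f 0 u).
have drho (u : R) : is_derive u 1 rho (rho u * f u).
  exact: (@der_comp _ _ expR (oriented_int f 0)) (is_derive_expR _) (der_oriented_int u cf).
have ds (u : R) : is_derive u 1 (fun u => sin (w u)) (cos (w u) * angle_field c u (w u)).
  exact: (@der_comp _ _ sin w) (is_derive_sin _) (aw u).
have dc (u : R) : is_derive u 1 (fun u => cos (w u)) (- sin (w u) * angle_field c u (w u)).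
  exact: (@der_comp _ _ cos w) (is_derive_cos _) (aw u).
have dvp (u : R) : is_derive u 1 (fun u => (p u)^-1) (- p u ^- 2 * p' u).
  exact: (@der_comp _ _ (fun z => z^-1) p) (der_inv_at (pn0 u)) (dp u).
pose h u := rho u * sin (w u).
pose h' u := rho u * cos (w u) * (p u)^-1.
exists h, h', rho; split=> u; last first.
  by split=> //; [exact: expR_gt0|rewrite /h' mulrC mulfVK].
have E := cos2Dsin2 (w u); have pu := pn0 u.
split.
- apply: der_eq (der_mul (drho u) (ds u)) _; rewrite /h' /f /angle_field.
  by ring.
- apply: der_eq (der_mul (der_mul (drho u) (dc u)) (dvp u)) _.
  rewrite /h' /h /f /angle_field.
  move: E; move: (sin (w u)) (cos (w u)) (rho u) => s k r E.
  have k2 : k ^+ 2 = 1 - s ^+ 2 by rewrite -E; ring.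
  transitivity (r * s * (k ^+ 2 * ((p u)^-1 + (V u - c) * p u) -
    ((p u)^-1 + ((c - V u) * p u - (p u)^-1) * s ^+ 2)) * (p u)^-1 -
    p' u / p u * (r * k * (p u)^-1)); first by field.
  by rewrite k2; field.
Qed.

(** * Periodic eigenfunctions from boundary values of the Pruefer angle *)

Section Periodic.
Variables (l pd : R).
Hypothesis l0 : 0 < l.
Hypothesis cp' : continuous p'.
Hypothesis pdP : forall u, `|p' u| <= pd.
Hypothesis p_even : forall u, p (- u) = p u.
Hypothesis p'_odd : forall u, p' (- u) = - p' u.
Hypothesis V_even : forall u, V (- u) = V u.
Hypothesis p_per : forall u, p (u + 2 * l) = p u.
Hypothesis p'_per : forall u, p' (u + 2 * l) = p' u.
Hypothesis V_per : forall u, V (u + 2 * l) = V u.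

Lemma sl_unique c h1 h1' h2 h2' u0 : sl_sol c h1 h1' -> sl_sol c h2 h2' ->
  h1 u0 = h2 u0 -> h1' u0 = h2' u0 -> forall u, h1 u = h2 u /\ h1' u = h2' u.
Proof.
move=> s1 s2 e0 e0' u.
pose d u := h1 u - h2 u; pose e u := h1' u - h2' u.
have dd (x : R) : is_derive x 1 d (e x).
  exact: der_sub (proj1 (s1 x)) (proj1 (s2 x)).
have de (x : R) : is_derive x 1 e ((V x - c) * d x - p' x / p x * e x).
  apply: der_eq (der_sub (proj2 (s1 x)) (proj2 (s2 x))) _.
  by rewrite /d /e; ring.
pose b := pd / pmin.
have bP x : `|p' x / p x| <= b.
  have /andP[v0 v1] := vp x.
  by rewrite normrM (gtr0_norm v0) ler_pM// ltW.
have aP x : `|V x - c| <= Vmax + `|c|.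
  by rewrite (le_trans (ler_normB _ _))// lerD2r.
pose y x := d x ^+ 2 + e x ^+ 2.
suff y0 : y u = 0.
  have /eqP : y u = 0 by [].
  rewrite /y paddr_eq0 ?sqr_ge0// !sqrf_eq0 !subr_eq0 => /andP[/eqP-> /eqP->].
  by [].
pose M := 1 + Vmax + `|c| + 2 * b.
have b0 : 0 <= b by rewrite (le_trans (normr_ge0 _) (bP 0)).
have M0 : 0 <= M by rewrite /M !addr_ge0// mulr_ge0.
apply: (gronwall_zero (u0 := u0) u M0 (fun x => der_add (der_exp 2 (dd x)) (der_exp 2 (de x)))).
- by move=> x; rewrite addr_ge0 ?sqr_ge0.
- move=> x; rewrite !expr1.
  have := aP x; have := bP x; move: (V x - c) (p' x / p x) => A B HB HA.
  have HA' : `|A| <= Vmax + `|c| by [].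
  have -> : 2 * d x * e x + 2 * e x * (A * d x - B * e x) =
    2 * (1 + A) * (d x * e x) - 2 * B * e x ^+ 2 by ring.
  rewrite (le_trans (ler_normB _ _))//.
  have H1 : `|2 * (1 + A) * (d x * e x)| <= (1 + Vmax + `|c|) * (d x ^+ 2 + e x ^+ 2).
    rewrite !normrM (gtr0_norm (ltr0n _ 2)).
    have : `|1 + A| <= 1 + (Vmax + `|c|).
      by rewrite (le_trans (ler_normD _ _))// normr1 lerD2l.
    rewrite -(real_normK (num_real (d x))) -(real_normK (num_real (e x))).
    have := normr_ge0 (1 + A); have := sqr_ge0 (`|d x| - `|e x|).
    have := mulr_ge0 (normr_ge0 (d x)) (normr_ge0 (e x)).
    move: (`|1 + A|) (`|d x|) (`|e x|) => Q D E DE0 sq Q0 QM.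
    have : Q * (2 * (D * E)) <= (1 + (Vmax + `|c|)) * (D ^+ 2 + E ^+ 2).
      apply: ler_pM => //; first by rewrite mulr_ge0.
      by rewrite sqrrB in sq; lra.
    by lra.
  have H2 : `|2 * B * e x ^+ 2| <= 2 * b * (d x ^+ 2 + e x ^+ 2).
    rewrite normrM (ger0_norm (sqr_ge0 (e x))) normrM (gtr0_norm (ltr0n _ 2)).
    apply: ler_pM; rewrite ?sqr_ge0 ?mulr_ge0//; first by rewrite ler_pM2l.
    by rewrite lerDr sqr_ge0.
  by rewrite /M; lra.
- by rewrite /d /e e0 e0' !subrr expr0n addr0.
Qed.

Lemma sl_scale c k h h' : sl_sol c h h' ->
  sl_sol c (fun u => k * h u) (fun u => k * h' u).
Proof.
move=> s u; split; first exact: der_mulc (proj1 (s u)).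
by apply: der_eq (der_mulc k (proj2 (s u))) _; ring.
Qed.

Lemma sl_reflect c h h' : sl_sol c h h' ->
  sl_sol c (fun u => h (- u)) (fun u => - h' (- u)).
Proof.
have E (f : R -> R) : (fun u => f (- u)) = (fun u => f (0 - u)).
  by apply/funext => u; rewrite sub0r.
move=> s u; split.
  rewrite E; apply: der_reflect; rewrite sub0r; exact: (proj1 (s (- u))).
have H : is_derive u 1 (fun u => h' (- u))
    (- ((V u - c) * h (- u) + p' u / p u * h' (- u))).
  rewrite E; apply: der_reflect; rewrite sub0r.
  apply: der_eq (proj2 (s (- u))) _.
  by rewrite p'_odd p_even V_even; ring.
by apply: der_eq (der_opp H) _; ring.
Qed.

Lemma sl_shift c h h' : sl_sol c h h' ->
  sl_sol c (fun u => h (u + 2 * l)) (fun u => h' (u + 2 * l)).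
Proof.
move=> s u.
have E (f : R -> R) a : is_derive (u + 2 * l) 1 f a ->
    is_derive u 1 (fun u => f (u + 2 * l)) a.
  move=> fa; rewrite -[a]mulr1; apply: (@der_comp _ _ f (fun u => u + 2 * l)) => //.
  exact: der_eq (der_add (der_id u) (der_cst (2 * l) u 1)) (addr0 _).
split; apply: E; first exact: (proj1 (s _)).
by apply: der_eq (proj2 (s _)) _; rewrite p'_per p_per V_per.
Qed.

Definition sl_eigen c h :=
  (exists h', sl_sol c h h') /\ (forall u, h (u + 2 * l) = h u) /\
  exists u, h u != 0.

(** The derivative vanishes at 0, so the solution agrees with its reflection. It vanishes at [l] as
    well, so the data at [- l] and at [l] coincide and translation by [2 l] preserves the
    solution. *)
Lemma sl_eigen_even c w : angle c w -> w 0 = pi / 2 -> cos (w l) = 0 ->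
  exists h, sl_eigen c h /\ forall u, h (- u) = h u.
Proof.
move=> aw w0 wl; have [h [h' [rho [s H]]]] := sl_of_angle cp' aw.
have h'0 : h' 0 = 0.
  have [_ _] := H 0; rewrite w0 cos_pihalf mulr0 => /eqP.
  by rewrite mulf_eq0 (negbTE (pn0 0)) => /eqP.
have h'l : h' l = 0.
  have [_ _] := H l; rewrite wl mulr0 => /eqP.
  by rewrite mulf_eq0 (negbTE (pn0 l)) => /eqP.
have ev u : h (- u) = h u /\ - h' (- u) = h' u.
  by apply: (sl_unique (u0 := 0) (sl_reflect s) s); rewrite !oppr0// h'0 oppr0.
exists h; split; last by move=> u; case: (ev u).
split; first by exists h'.
split.
  move=> u; suff [] : h (u + 2 * l) = h u /\ h' (u + 2 * l) = h' u by [].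
  apply: (sl_unique (u0 := - l) (sl_shift s) s).
    by rewrite (proj1 (ev l)); congr h; ring.
  have -> : - l + 2 * l = l by ring.
  by have := proj2 (ev l); rewrite h'l => /eqP; rewrite oppr_eq0 => /eqP ->.
exists 0; have [r0 -> _] := H 0.
by rewrite w0 sin_pihalf mulr1 gt_eqF.
Qed.

(** As in the even case with values and derivatives exchanged: [h] vanishes at 0 and at [l], and the
    odd symmetry matches the data at [- l] and [l]. *)
Lemma sl_eigen_odd c w : angle c w -> w 0 = 0 -> sin (w l) = 0 ->
  exists h, sl_eigen c h /\ forall u, h (- u) = - h u.
Proof.
move=> aw w0 wl; have [h [h' [rho [s H]]]] := sl_of_angle cp' aw.
have h0 : h 0 = 0 by have [_ -> _] := H 0; rewrite w0 sin0 mulr0.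
have hl : h l = 0 by have [_ -> _] := H l; rewrite wl mulr0.
have od u : -1 * h (- u) = h u /\ -1 * - h' (- u) = h' u.
  apply: (sl_unique (u0 := 0) (sl_scale (-1) (sl_reflect s)) s);
  by rewrite !oppr0 ?h0 ?mulr0// mulrNN mul1r.
exists h; split; last by move=> u; have [<- _] := od u; rewrite mulN1r opprK.
split; first by exists h'.
split.
  move=> u; suff [] : h (u + 2 * l) = h u /\ h' (u + 2 * l) = h' u by [].
  apply: (sl_unique (u0 := - l) (sl_shift s) s).
    have -> : - l + 2 * l = l by ring.
    by have := proj1 (od l); rewrite hl mulN1r => /eqP; rewrite oppr_eq0 => /eqP ->.
  have -> : - l + 2 * l = l by ring.
  by have := proj2 (od l); rewrite mulrNN mul1r.
(* A zero solution would have [h' 0 = 0], whereas [p 0 * h' 0 = rho 0 > 0]. *)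
apply: contrapT => /forallNP hN.
have hz u : h u = 0 by apply/eqP; move: (hN u) => /negP; rewrite negbK.
have : h' 0 = 0.
  apply: (der_unique (proj1 (s 0))); have -> : h = fun=> 0 by apply/funext.
  exact: der_cst.
have [r0 _] := H 0; rewrite w0 cos0 mulr1 => E h'0.
by move: r0; rewrite -E h'0 mulr0 ltxx.
Qed.

(** The angle at [l] is continuous in the energy, at most [pi / 2] at energy [- Vmax] and above [t]
    at energy 0. The strict inequality keeps the energy found away from 0. *)
Lemma angle_target (W : R -> R -> R) w0 t :
  (forall c, W c 0 = w0) -> (forall c, angle c (W c)) -> w0 <= pi / 2 ->
  pi / 2 <= t -> t < W 0 l -> exists c, c < 0 /\ W c l = t.
Proof.
move=> W0 aW w0p pt tW.
have cW := angle_continuous (ltW l0) W0 aW.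
have low : W (- Vmax) l <= pi / 2.
  apply: angle_low (aW _) _ _ (ltW l0); last by rewrite W0.
  by move=> x; have := VmaxP x; rewrite ler_norml => /andP[].
have VN : - Vmax <= 0 by rewrite oppr_le0.
have [|c /andP[_ c0] Wc] := IVT_cont VN (fun x _ => cW x) (v := t).
  by rewrite (le_trans low pt) ltW.
exists c; split=> //; rewrite lt_neqAle c0 andbT; apply/eqP => E.
by move: tW; rewrite -Wc E ltxx.
Qed.

Lemma sin_ge_pi (w : R) : sin w = 0 -> 0 < w -> pi <= w.
Proof.
move=> sw w0; rewrite leNgt; apply/negP => wp.
by have := @sin_gt0_pi _ w; rewrite w0 wp sw ltxx => /(_ isT).
Qed.

Lemma sin_ge_2pi (w : R) : sin w = 0 -> pi < w -> 2 * pi <= w.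
Proof.
move=> sw wp; have : pi <= w - pi; last by lra.
apply: sin_ge_pi; last by rewrite subr_gt0.
by have := sinDpi (w - pi); rewrite subrK sw => /esym/eqP; rewrite oppr_eq0 => /eqP.
Qed.

(* An odd solution at energy 0 with two positive zeros has angle at least
   [2 pi] at [l]; lowering the energy to [- Vmax] brings the angle below
   [pi / 2], so all boundary values in between are attained at negative
   energies. *)
Lemma sl_negative_eigenvalues h0 h0' u1 u2 :
  sl_sol 0 h0 h0' -> h0 0 = 0 -> (exists u, h0 u != 0) ->
  0 < u1 -> u1 < u2 -> u2 <= l -> h0 u1 = 0 -> h0 u2 = 0 ->
  [/\ exists (c : bool -> R) (h : bool -> R -> R), injective c /\ forall b,
        [/\ c b < 0, sl_eigen (c b) (h b) & forall u, h b (- u) = h b u],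
      exists (c : R) (h : R -> R),
        [/\ c < 0, sl_eigen c h & forall u, h (- u) = - h u] &
      u2 < l -> exists (c : bool -> R) (h : bool -> R -> R), injective c /\ forall b,
        [/\ c b < 0, sl_eigen (c b) (h b) & forall u, h b (- u) = - h b u]].
Proof.
move=> s0 h00 [v hv] u10 u12 u2l h0u1 h0u2.
have pi0 := pi_gt0 R.
(* [D c] and [N c] are the angles at energy [c] starting from 0 and from [pi / 2]; they belong to
   odd and to even solutions. *)
have /choice[D DP] : forall c, exists w, w 0 = 0 /\ angle c w.
  by move=> c; exact: angle_exists.
have /choice[N NP] : forall c, exists w, w 0 = pi / 2 /\ angle c w.
  by move=> c; exact: angle_exists.
have D0 c := proj1 (DP c); have aD c := proj2 (DP c).
have N0 c := proj1 (NP c); have aN c := proj2 (NP c).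
have [h [h' [rho [s H]]]] := sl_of_angle cp' (aD 0).
have h_0 : h 0 = 0 by have [_ -> _] := H 0; rewrite D0 sin0 mulr0.
have h'_0 : h' 0 != 0.
  have [r0 _ E] := H 0; apply/eqP => h'0; move: E r0.
  by rewrite D0 cos0 mulr1 h'0 mulr0 => <-; rewrite ltxx.
(* Solutions vanishing at 0 form a line, so the zeros of [h0] are zeros of [sin (D 0 u)]. *)
have hh0 u : h0 u = h0' 0 / h' 0 * h u.
  have [] // := @sl_unique 0 h0 h0' _ _ 0 s0 (sl_scale (h0' 0 / h' 0) s) _ _ u.
    by rewrite h00 h_0 mulr0.
  by rewrite mulfVK.
have kn0 : h0' 0 / h' 0 != 0.
  by apply: contra_neq hv => E; rewrite hh0 E mul0r.
have sz u : h0 u = 0 -> sin (D 0 u) = 0.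
  rewrite hh0 => /eqP; rewrite mulf_eq0 (negbTE kn0)/= => /eqP.
  have [r0 -> _] := H u; move=> /eqP; rewrite mulf_eq0 (gt_eqF r0).
  by move=> /eqP.
have Du1 : pi <= D 0 u1.
  apply: sin_ge_pi (sz _ h0u1) _.
  by apply: (angle_cross (aD 0) _ u10); rewrite ?sin0 ?D0.
have Du2 : 2 * pi <= D 0 u2.
  apply: sin_ge_2pi (sz _ h0u2) _.
  by apply: (angle_cross (aD 0) _ u12); rewrite ?sinpi.
have sin2pi : sin (2 * pi) = 0 :> R by rewrite mulr_natl sin2pi.
have Dl : 2 * pi <= D 0 l.
  have [<-//|lu2] := eqVneq u2 l.
  apply: ltW; apply: (angle_cross (aD 0) _ (_ : u2 < l)) => //.
  by rewrite lt_neqAle lu2.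
(* The even angle starts ahead of the odd one and, at the same energy, stays strictly ahead; here
   [2 pi] is exceeded even if [u2 = l]. *)
have Nl : 2 * pi < N 0 l.
  apply: le_lt_trans Dl _; apply: (angle_sub (aD 0) (aN 0)) (ltW l0).
  by rewrite D0 N0 divr_gt0.
split.
(* The targets are the zeros [pi / 2] and [3 pi / 2] of the cosine, both below [N 0 l]. *)
- have [c1 [c10 W1]] := angle_target (t := pi / 2) N0 aN (lexx _) (lexx _) ltac:(lra).
  have [c2 [c20 W2]] := angle_target (t := pi / 2 + pi) N0 aN (lexx _) ltac:(lra) ltac:(lra).
  have [h1 [e1 ev1]] := sl_eigen_even (aN c1) (N0 c1) ltac:(by rewrite W1 cos_pihalf).
  have [h2 [e2 ev2]] := sl_eigen_even (aN c2) (N0 c2) ltac:(by rewrite W2 cosDpi cos_pihalf oppr0).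
  have c12 : c1 != c2.
    by apply/eqP => E; move: W2; rewrite -E W1; lra.
  exists (fun b => if b then c1 else c2), (fun b => if b then h1 else h2); split; last by case.
  by case; case => // E; move: c12; rewrite E eqxx.
- have [c [c0 W]] := angle_target (t := pi) D0 aD ltac:(lra) ltac:(lra) ltac:(lra).
  have [h3 [e3 od3]] := sl_eigen_odd (aD c) (D0 c) ltac:(by rewrite W sinpi).
  by exists c, h3.
- move=> u2l'.
  (* A zero before [l] puts [D 0 l] strictly above [2 pi], which then becomes a second target
     besides [pi]. *)
  have Dl' : 2 * pi < D 0 l by exact: (angle_cross (aD 0) sin2pi u2l').
  have [c1 [c10 W1]] := angle_target (t := pi) D0 aD ltac:(lra) ltac:(lra) ltac:(lra).
  have [c2 [c20 W2]] := angle_target (t := 2 * pi) D0 aD ltac:(lra) ltac:(lra) Dl'.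
  have [h1 [e1 ev1]] := sl_eigen_odd (aD c1) (D0 c1) ltac:(by rewrite W1 sinpi).
  have [h2 [e2 ev2]] := sl_eigen_odd (aD c2) (D0 c2) ltac:(by rewrite W2 sin2pi).
  have c12 : c1 != c2.
    by apply/eqP => E; move: W2; rewrite -E W1; lra.
  exists (fun b => if b then c1 else c2), (fun b => if b then h1 else h2); split; last by case.
  by case; case => // E; move: c12; rewrite E eqxx.
Qed.

End Periodic.
End SturmLiouville.

(** * The profile curve *)

Section RotationalCurve.
Context {R : realType}.
Variables (N : nat) (r r' lam : R -> R).
Hypothesis r_gt0 : forall u, 0 < r u.
Hypothesis lam_gt0 : forall u, 0 < lam u.
Hypothesis dr : forall u : R, is_derive u 1 r (r' u).
Hypothesis dr' : forall u : R, is_derive u 1 r' (- r u + N%:R * lam u ^+ 2 * r u).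
Hypothesis dlam : forall u : R, is_derive u 1 lam (- (N.+1%:R * lam u * r' u / r u)).
Hypothesis energy : forall u, r' u ^+ 2 + r u ^+ 2 * lam u ^+ 2 + r u ^+ 2 = 1.

Definition rho u := Num.sqrt (1 - r u ^+ 2).

Lemma r_neq0 u : r u != 0. Proof. by rewrite gt_eqF. Qed.

Lemma one_subr2_gt0 u : 0 < 1 - r u ^+ 2.
Proof.
rewrite -(energy u) addrK ltr_wpDl ?sqr_ge0//.
by rewrite mulr_gt0 ?exprn_gt0.
Qed.

Lemma rho_gt0 u : 0 < rho u. Proof. by rewrite sqrtr_gt0 one_subr2_gt0. Qed.

Lemma rho_neq0 u : rho u != 0. Proof. by rewrite gt_eqF// rho_gt0. Qed.

Lemma sqr_rho u : rho u ^+ 2 = 1 - r u ^+ 2.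
Proof. by rewrite sqr_sqrtr// ltW// one_subr2_gt0. Qed.

Lemma rhoV2 u : (rho u)^-1 ^+ 2 * (1 - r u ^+ 2) = 1.
Proof. by rewrite -sqr_rho exprVn mulVf// expf_neq0// rho_neq0. Qed.

Lemma rhoE u : rho u = (1 - r u ^+ 2) * (rho u)^-1.
Proof. by rewrite -sqr_rho; field; exact: rho_neq0. Qed.

Lemma drho (u : R) : is_derive u 1 rho (- (r u * r' u / rho u)).
Proof.
have H : is_derive u 1 (fun u => 1 - r u ^+ 2) (0 - 2 * r u * r' u).
  exact: der_sub (der_cst 1 u 1) (der_exp 2 (dr u)).
apply: der_eq (@der_comp _ _ Num.sqrt _ u 1 _ _ (der_sqrt_at (one_subr2_gt0 u)) H) _.
by rewrite -/(rho u); field; exact: rho_neq0.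
Qed.

Lemma drhoV (u : R) : is_derive u 1 (fun u => (rho u)^-1) (r u * r' u * (rho u)^-1 ^+ 3).
Proof.
apply: der_eq (@der_comp _ _ (fun z => z^-1) _ u 1 _ _ (der_inv_at (rho_neq0 u)) (drho u)) _.
by field; exact: rho_neq0.
Qed.

(* Frame equations for one of the two last coordinates: [(s, c)] is
   [(cos theta, - sin theta)] or [(sin theta, cos theta)], and [pos], [tgt],
   [nrm] are that coordinate of the immersion, its u-derivative and the unit
   normal. *)
Section Frame.
Variables (s c : R -> R).
Hypothesis ds : forall u : R, is_derive u 1 s (r u * lam u * (rho u)^-1 ^+ 2 * c u).
Hypothesis dc : forall u : R, is_derive u 1 c (- (r u * lam u * (rho u)^-1 ^+ 2 * s u)).

Definition pos u := rho u * s u.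
Definition tgt u := (- (r u * r' u * s u) + r u * lam u * c u) * (rho u)^-1.
Definition nrm u := - ((r u ^+ 2 * lam u * s u + r' u * c u) * (rho u)^-1).

Lemma dpos (u : R) : is_derive u 1 pos (tgt u).
Proof.
apply: der_eq (der_mul (drho u) (ds u)) _.
by rewrite /tgt; field; exact: rho_neq0.
Qed.

Lemma dtgt (u : R) : is_derive u 1 tgt (- pos u + N%:R * lam u * nrm u).
Proof.
apply: der_eq (der_mul (der_add (der_opp (der_mul (der_mul (dr u) (dr' u)) (ds u)))
  (der_mul (der_mul (dr u) (dlam u)) (dc u))) (drhoV u)) _.
rewrite /pos /nrm; have r0 := r_neq0 u.
have := rhoV2 u; have := rhoE u; move: (rho u)^-1 => i -> E1.
have E2 := energy u.
apply/eqP; rewrite -subr_eq0; apply/eqP.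
(* The residual is exhibited as a combination of two relations: [i^2 (1 - r^2) = 1] and the energy
   relation. *)
transitivity (i * s u * (- (i ^+ 2 * (1 - r u ^+ 2) - 1) * (1 - r' u ^+ 2) -
  i ^+ 2 * (r' u ^+ 2 + r u ^+ 2 * lam u ^+ 2 + r u ^+ 2 - 1))).
  by rewrite -natr1; field.
by rewrite E1 E2; ring.
Qed.

Lemma dnrm (u : R) : is_derive u 1 nrm (- (N%:R * lam u * tgt u)).
Proof.
apply: der_eq (der_opp (der_mul (der_add
  (der_mul (der_mul (der_exp 2 (dr u)) (dlam u)) (ds u))
  (der_mul (dr' u) (dc u))) (drhoV u))) _.
rewrite /tgt; have r0 := r_neq0 u.
have := rhoV2 u; move: (rho u)^-1 => i E1.
have E2 := energy u.
apply/eqP; rewrite -subr_eq0; apply/eqP.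
transitivity ((i ^+ 2 * (1 - r u ^+ 2) - 1) * i *
    (s u * r u * r' u * lam u - c u * r u) -
  i ^+ 3 * c u * r u * (r' u ^+ 2 + r u ^+ 2 * lam u ^+ 2 + r u ^+ 2 - 1)).
  by rewrite -natr1 expr1; field.
by rewrite E1 E2; ring.
Qed.

(** The unit vector [y] of the first factor has components [r], [r lam], [r'] along position, normal
    and unit [u]-tangent. Their squares add up to 1 by the energy relation, so [y] lies in the span
    of these three; the relation says that [y] is orthogonal to a coordinate direction of the last
    plane. *)
Lemma frame_relation u : r u * pos u + r u * lam u * nrm u + r' u * tgt u = 0.
Proof.
rewrite /pos /nrm /tgt; have := rhoE u; move: (rho u)^-1 => i ->.
transitivity (- (i * r u * s u *
  (r' u ^+ 2 + r u ^+ 2 * lam u ^+ 2 + r u ^+ 2 - 1))); first by ring.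
by rewrite energy; ring.
Qed.

End Frame.

(** Volume density along the arc length parameter [u]: the part of the Laplacian in [u] is
    [(wgt h')' / wgt]. *)
Definition wgt u := r u ^+ N.
Definition wgt' u := N%:R * r u ^+ N.-1 * r' u.

Lemma dwgt (u : R) : is_derive u 1 wgt (wgt' u).
Proof. exact: der_exp. Qed.

Lemma wgtE u : wgt' u / wgt u = N%:R * r' u / r u.
Proof.
rewrite /wgt /wgt'; case: N => [|k]; first by rewrite !mul0r.
rewrite /= exprS; field; rewrite r_neq0 expf_neq0// r_neq0//.
Qed.

(* Potential of the part of the Jacobi operator acting on functions
   [h u * Y y], for [Y] a spherical harmonic of eigenvalue [ev]. *)
Definition potential (ev : R) u :=
  ev / r u ^+ 2 - N.+1%:R - N.+1%:R * N%:R * lam u ^+ 2.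

Lemma sl_sol_r' : sl_sol wgt wgt' (potential 0) 0 r' (fun u => - r u + N%:R * lam u ^+ 2 * r u).
Proof.
move=> u; split; first exact: dr'.
apply: der_eq (der_add (der_opp (dr u)) (der_mul (der_mulc N%:R (der_exp 2 (dlam u))) (dr u))) _.
by rewrite wgtE /potential expr1 -natr1; field; exact: r_neq0.
Qed.

Section FrameSolutions.
Variables (s c : R -> R).
Hypothesis ds : forall u : R, is_derive u 1 s (r u * lam u * (rho u)^-1 ^+ 2 * c u).
Hypothesis dc : forall u : R, is_derive u 1 c (- (r u * lam u * (rho u)^-1 ^+ 2 * s u)).

(** On a minimal hypersurface the coordinates of the unit normal satisfy [Delta nu = - |A|^2 nu], so
    the Jacobi operator multiplies them by - n. *)
Lemma sl_sol_nrm : sl_sol wgt wgt' (potential 0) (- N.+1%:R) (nrm s c)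
  (fun u => - (N%:R * lam u * tgt s c u)).
Proof.
move=> u; split; first exact: dnrm.
apply: der_eq (der_opp (der_mul (der_mulc N%:R (dlam u)) (dtgt ds dc u))) _.
rewrite wgtE /potential; apply/eqP; rewrite -subr_eq0; apply/eqP.
have H := frame_relation s c u.
transitivity (N%:R * lam u / r u *
  (r u * pos s u + r u * lam u * nrm s c u + r' u * tgt s c u)).
  by rewrite -natr1; field; exact: r_neq0.
by rewrite H mulr0.
Qed.

(* Normal component of an infinitesimal rotation mixing the two factors. *)
Definition rot u := r u * nrm s c u - r u * lam u * pos s u.

(** The parameter [N%:R] of the potential is the eigenvalue of the coordinate functions on S^N. The
    residual of the second equation is a multiple of the energy relation. *)
Lemma sl_sol_rot : sl_sol wgt wgt' (potential N%:R) 0 rot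
  (fun u => r' u * (nrm s c u + N%:R * lam u * pos s u) -
     N.+1%:R * lam u * r u * tgt s c u).
Proof.
move=> u; have r0 := r_neq0 u; split.
  apply: der_eq (der_sub (der_mul (dr u) (dnrm ds dc u))
    (der_mul (der_mul (dr u) (dlam u)) (dpos ds u))) _.
  by rewrite -natr1; field.
apply: der_eq (der_sub
  (der_mul (dr' u) (der_add (dnrm ds dc u)
     (der_mul (der_mulc N%:R (dlam u)) (dpos ds u))))
  (der_mul (der_mul (der_mulc N.+1%:R (dlam u)) (dr u)) (dtgt ds dc u))) _.
rewrite wgtE /potential /rot; apply/eqP; rewrite -subr_eq0; apply/eqP.
transitivity (N%:R / r u * (nrm s c u - lam u * pos s u) *
  (r' u ^+ 2 + r u ^+ 2 * lam u ^+ 2 + r u ^+ 2 - 1)).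
  by rewrite -natr1; field.
by rewrite energy; ring.
Qed.

(** The form used to locate zeros: where [r'] vanishes, the sign is opposite to that of [s]. *)
Lemma rotE u : rot u = - (r u / rho u) * (lam u * s u + r' u * c u).
Proof.
rewrite /rot /nrm /pos; have := rhoE u; move: (rho u)^-1 => i ->; ring.
Qed.

End FrameSolutions.

End RotationalCurve.

(** * Symmetry and monotonicity of the profile function *)

Section ProfileAnalysis.
Context {R : realType}.
Variables (N : nat) (C T : R) (g : R -> R).
Hypothesis N0 : (0 < N)%N.
Hypothesis hg : profile N.+1 C T g.

Let C0 : 0 < C := prof_C0 hg.
Let T0 : 0 < T := prof_T0 hg.
Let g_gt0 u : 0 < g u := prof_gt0 hg u.
Let g_neq0 u : g u != 0. Proof. by rewrite gt_eqF. Qed.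
Let g1 : R -> R := derive1n 1 g.

Let dG j (u : R) : is_derive u 1 (derive1n j g) (derive1n j.+1 g u).
Proof. by apply: DeriveDef; [exact: prof_smooth hg j u|rewrite -derive1E]. Qed.

Let dg (u : R) : is_derive u 1 g (g1 u). Proof. exact: (dG 0). Qed.

Let ode u : g1 u ^+ 2 + (g u ^+ (2 * N))^-1 + g u ^+ 2 = C.
Proof.
rewrite -(prof_ode hg u); congr (_ + _ + _).
have -> : 2 - 2 * N.+1%:Z = - (2 * N)%N%:Z :> int.
  by rewrite PoszM -natr1 ; ring.
by rewrite exprnN.
Qed.

Let dgV k (u : R) : is_derive u 1 (fun z => (g z ^+ k)^-1) (- (k%:R * (g u ^+ k.+1)^-1 * g1 u)).
Proof.
apply: der_eq (@der_comp _ _ (fun z => z^-1) _ u 1 _ _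
  (der_inv_at (expf_neq0 k (g_neq0 u))) (der_exp k (dg u))) _.
case: k => [|k]; first by rewrite !mul0r mulr0 oppr0.
by rewrite /= !exprS; field; rewrite g_neq0 expf_neq0.
Qed.

Let acc (w : R) := - w + N%:R * (w ^+ (2 * N).+1)^-1.

(** Differentiating the first order equation gives only [E * g' = 0]. But [E^2] has derivative 0:
    near a point where [E] does not vanish, [g'] is 0, hence so are [g''] and then [g'''] and [E']
    at the point. So [E] vanishes everywhere or nowhere, and in the second case [g] would be
    constant. *)
Lemma profile_second_order (u : R) : is_derive u 1 g1 (acc (g u)).
Proof.
pose E (u : R) : R := derive1n 2 g u + g u - N%:R * (g u ^+ (2 * N).+1)^-1.
have dE (x : R) : is_derive x 1 E (derive1n 3 g x + g1 x -
    N%:R * - ((2 * N).+1%:R * (g x ^+ (2 * N).+2)^-1 * g1 x)).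
  exact: der_sub (der_add (dG 2 x) (dg x)) (der_mulc _ (dgV _ x)).
have Eg1 x : E x * g1 x = 0.
  have dC : is_derive x 1 (fun z => g1 z ^+ 2 + (g z ^+ (2 * N))^-1 + g z ^+ 2)
     (2 * g1 x * derive1n 2 g x + - ((2 * N)%:R * (g x ^+ (2 * N).+1)^-1 * g1 x)
        + 2 * g x * g1 x).
    exact: der_add (der_add (der_exp 2 (dG 1 x)) (dgV _ x)) (der_exp 2 (dg x)).
  have dC' : is_derive x 1 (fun z => g1 z ^+ 2 + (g z ^+ (2 * N))^-1 + g z ^+ 2) 0.
    have -> : (fun z => g1 z ^+ 2 + (g z ^+ (2 * N))^-1 + g z ^+ 2) = fun=> C.
      by apply/funext.
    exact: der_cst.
  have := der_unique dC dC'; rewrite natrM /E => H.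
  have : 2 * (E x * g1 x) = 0 by rewrite /E -H; ring.
  by move/eqP; rewrite mulf_eq0 pnatr_eq0 => /eqP.
have cE : continuous E := der_continuousT dE.
have E2 (x : R) : is_derive x 1 (fun z => E z ^+ 2) 0.
  apply: der_eq (der_exp 2 (dE x)) _; rewrite expr1.
  have [->|Ex] := eqVneq (E x) 0; first by rewrite mulr0 mul0r.
  have nE : \forall z \near x, E z != 0.
    have Ex' : 0 < `|E x| by rewrite normr_gt0.
    move/cvgrPdist_lt : (cE x) => /(_ _ Ex').
    apply: filterS => z; apply: contraTneq => ->.
    by rewrite subr0 ltxx.
  have n1 : \forall z \near x, 0 = g1 z.
    near=> z; have : E z != 0 by near: z.
    by have /eqP := Eg1 z; rewrite mulf_eq0 => /orP[->//|/eqP ->].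
  have n2 : \forall z \near x, 0 = derive1n 2 g z.
    near=> z; have nz : \forall y \near z, 0 = g1 y by near: z; exact: near_join n1.
    have := near_eq_is_derive nz (der_cst 0 z 1).
    by move=> /(der_unique (dG 1 z)) ->.
  have -> : derive1n 3 g x = 0.
    have := near_eq_is_derive n2 (der_cst 0 x 1).
    by move=> /(der_unique (dG 2 x)).
  have <- : 0 = g1 x by exact: (nbhs_singleton n1).
  by ring.
have E0 x : E x = 0.
  apply/eqP; rewrite -sqrf_eq0; apply/negP => Ex.
  have [a [b]] := prof_nonconst hg; apply/negP; rewrite negbK; apply/eqP.
  have g10 z : g1 z = 0.
    have Ez : E z != 0.
      rewrite -sqrf_eq0 (der_cst_eq (f := fun z => E z ^+ 2) z x E2).
      by apply/negP.
    by have /eqP := Eg1 z; rewrite mulf_eq0 (negbTE Ez) => /eqP.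
  by apply: der_cst_eq => z; rewrite -(g10 z).
apply: der_eq (dG 1 u) _; have := E0 u; rewrite /E /acc => H.
by apply/eqP; rewrite -subr_eq0; apply/eqP; rewrite -H; ring.
Unshelve. all: by end_near. Qed.

(** [acc] is singular at 0, but [g] stays above its minimum [g 0 > 0], where the slope of [acc] lies
    between [- L] and 0. *)
Let acc_lip : exists2 L : R, 0 <= L & forall u v, `|acc (g u) - acc (g v)| <= L * `|g u - g v|.
Proof.
pose m := g 0; have m0 : 0 < m by exact: g_gt0.
pose L := 1 + N%:R * ((2 * N).+1%:R * (m ^+ (2 * N).+2)^-1).
have L0 : 0 <= L.
  by rewrite /L addr_ge0// !mulr_ge0// invr_ge0 exprn_ge0// ltW.
exists L => // u v.
wlog uv : u v / g v <= g u.
  move=> H; have [/H//|/ltW/H] := leP (g v) (g u).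
  by rewrite distrC [`|g v - _|]distrC.
have dacc (w : R) : 0 < w -> is_derive w 1 acc
    (- 1 - N%:R * ((2 * N).+1%:R * (w ^+ (2 * N).+2)^-1)).
  move=> w0; have wn0 : w != 0 by rewrite gt_eqF.
  apply: der_eq (der_add (der_opp (der_id w)) (der_mulc N%:R
    (@der_comp _ _ (fun z => z^-1) _ w 1 _ _
    (der_inv_at (expf_neq0 (2 * N).+1 wn0)) (der_exp (2 * N).+1 (der_id w))))) _.
  by rewrite /= !exprS; field; rewrite wn0 expf_neq0.
have bnd w : g v <= w <= g u -> 0 <= 1 + N%:R * ((2 * N).+1%:R * (w ^+ (2 * N).+2)^-1) <= L.
  move=> /andP[vw _]; have mw : m <= w by exact: le_trans (prof_min hg v) vw.
  have w0 : 0 < w by exact: lt_le_trans mw.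
  rewrite addr_ge0 ?mulr_ge0 ?invr_ge0 ?exprn_ge0 ?(ltW w0)//=.
  rewrite lerD2l ler_wpM2l// ler_wpM2l// lef_pV2 ?posrE ?exprn_gt0//.
  by rewrite lerXn2r// nnegrE ltW.
have pos w : g v <= w <= g u -> 0 < w.
  by move=> /andP[vw _]; exact: lt_le_trans (g_gt0 v) vw.
rewrite (ger0_norm (_ : 0 <= g u - g v)) ?subr_ge0// ler_norml; apply/andP; split.
- have := @der_le _ (fun w => - L * w) (fun=> - L) acc _ _ _ uv
    (fun w _ => der_eq (der_mulc (- L) (der_id w)) (mulr1 _)) (fun w H => dacc w (pos w H)).
  move=> /(_ _)H; suff : - L * g u - - L * g v <= acc (g u) - acc (g v) by lra.
  by apply: H => w /bnd/andP[_]; lra.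
- have H : acc (g u) - acc (g v) <= 0 * g u - 0 * g v.
    apply: (@der_le _ acc _ (fun w => 0 * w) (fun=> 0) _ _ uv
      (fun w H => dacc w (pos w H))
      (fun w _ => der_eq (der_mulc 0 (der_id w)) (mulr1 _))).
    by move=> w /bnd/andP[+ _]; lra.
  have := mulr_ge0 L0 (_ : 0 <= g u - g v); rewrite subr_ge0 => /(_ uv).
  by move: H; rewrite !mul0r subrr; lra.
Qed.

(** [g] and its reflection at a critical point solve the same second order equation with the same
    data at [s]. *)
Lemma profile_reflect s : g1 s = 0 -> forall u, g (2 * s - u) = g u.
Proof.
move=> g1s u; have [L L0 LP] := acc_lip.
pose d u := g u - g (2 * s - u); pose e u := g1 u + g1 (2 * s - u).
have dd (x : R) : is_derive x 1 d (e x).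
  apply: der_eq (der_sub (dg x) (der_reflect (dg (2 * s - x)))) _.
  by rewrite opprK.
have de (x : R) : is_derive x 1 e (acc (g x) - acc (g (2 * s - x))).
  exact: der_add (profile_second_order x) (der_reflect (profile_second_order (2 * s - x))).
have ss : 2 * s - s = s by ring.
suff /eqP : d u ^+ 2 + e u ^+ 2 = 0.
  by rewrite paddr_eq0 ?sqr_ge0// sqrf_eq0 subr_eq0 => /andP[/eqP -> _].
have L1 : 0 <= 1 + L by rewrite addr_ge0.
apply: (gronwall_zero (u0 := s) u L1 (fun x => der_add (der_exp 2 (dd x)) (der_exp 2 (de x)))).
- by move=> x; rewrite addr_ge0 ?sqr_ge0.
- move=> x; rewrite !expr1; have := LP x (2 * s - x); rewrite -/(d x).
  move: (acc _ - acc _) => A HA.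
  have -> : 2 * d x * e x + 2 * e x * A = 2 * (e x * (d x + A)) by ring.
  rewrite !normrM (gtr0_norm (ltr0n _ 2)).
  have H : `|d x + A| <= (1 + L) * `|d x|.
    by rewrite (le_trans (ler_normD _ _))// mulrDl mul1r lerD2l.
  rewrite -(real_normK (num_real (d x))) -(real_normK (num_real (e x))).
  have H2 := ler_wpM2l (normr_ge0 (e x)) H.
  have := mulr_ge0 L1 (sqr_ge0 (`|d x| - `|e x|)).
  move: (`|d x + A|) (`|d x|) (`|e x|) H2 => Q D E H2 H3.
  rewrite sqrrB in H3; lra.
- by rewrite /d /e ss subrr g1s addr0 expr0n addr0.
Qed.

Lemma profile_der0 : g1 0 = 0.
Proof.
have cg : {within `[(-1 : R), 1], continuous g}.
  by apply: continuous_subspaceT; exact: der_continuousT dg.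
have m1 : (-1 : R) < 1 by lra.
have dg' (x : R) : x \in `](-1 : R), 1[ -> derivable g x 1 by move=> _; case: (dg x).
have := @derive1_at_min R g (-1) 1 0 (ltW m1) dg'.
rewrite in_itv/= oppr_lt0 ltr01 => /(_ isT)H.
by apply: (der_unique (dg 0)); apply: H => t _; exact: prof_min hg t.
Qed.

Lemma profile_even u : g (- u) = g u.
Proof. by have := profile_reflect profile_der0 u; rewrite mulr0 sub0r. Qed.

Lemma profile_der_odd u : g1 (- u) = - g1 u.
Proof.
have H : is_derive u 1 (fun z => g (0 - z)) (- g1 (0 - u)) by exact: der_reflect.
have E : (fun z => g (0 - z)) = g by apply/funext => z; rewrite sub0r profile_even.
rewrite E sub0r in H; have := der_unique (dg u) H => ->; exact: esym (opprK _).
Qed.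

Lemma profile_der_per u : g1 (u + T) = g1 u.
Proof.
apply: (@der_unique _ g u); last exact: dg.
have E : (fun z => g (z + T)) = g by apply/funext => z; rewrite (prof_period hg).
have dT : is_derive u 1 (fun z => z + T) 1.
  exact: der_eq (der_add (der_id u) (der_cst T u 1)) (addr0 _).
have := @der_comp _ _ g (fun z => z + T) u 1 _ _ (dg (u + T)) dT.
by rewrite E mulr1.
Qed.

(** The reflections at two critical points 0 and [u] compose to the translation by [2 u], which
    would be a period shorter than [T]. *)
Lemma profile_der_neq0 u : 0 < u -> u < T / 2 -> g1 u != 0.
Proof.
move=> u0 uT; apply/eqP => g1u.
suff : T <= 2 * u by lra.
apply: (prof_least hg); first lra.
move=> v; have := profile_reflect g1u (- v); rewrite opprK profile_even => <-.
by congr g; ring.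
Qed.

(** [g'] keeps its sign on the half period, and a negative sign would take [g] below its minimum at
    0. *)
Lemma profile_der_gt0 u : 0 < u -> u < T / 2 -> 0 < g1 u.
Proof.
move=> u0 uT; rewrite lt_neqAle eq_sym profile_der_neq0//=.
rewrite leNgt; apply/negP => g1u.
have cg1 : continuous g1 by exact: der_continuousT profile_second_order.
have neg x : 0 < x < u -> g1 x < 0.
  move=> /andP[x0 xu]; rewrite ltNge; apply/negP => g1x.
  have cNg1 z : x <= z <= u -> {for z, continuous (fun z => - g1 z)}.
    by move=> _; apply: cvgN; exact: cg1.
  have sg : - g1 x <= 0 <= - g1 u by rewrite oppr_le0 g1x oppr_ge0 ltW.
  have [z /andP[xz zu]] := IVT_cont (ltW xu) cNg1 sg.
  move=> /eqP; rewrite oppr_eq0; apply/negP/profile_der_neq0; lra.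
have : - g 0 < - g u.
  apply: (der_smono u0 (fun z _ => der_opp (dg z))) => z /neg.
  by rewrite oppr_gt0.
by rewrite ltrN2 ltNge (prof_min hg).
Qed.

Let r := prof_r C g.
Let k := Num.sqrt C.
Let k0 : 0 < k. Proof. by rewrite sqrtr_gt0. Qed.
Let k2 : k ^+ 2 = C. Proof. by rewrite sqr_sqrtr// ltW. Qed.
Let lam := prof_lambda N.+1 g.
Let r' u := g1 u / k.

Let lam2 u : lam u ^+ 2 = (g u ^+ (2 * N))^-1 / g u ^+ 2.
Proof. by rewrite exprVn -exprM -invfM -exprD mulnC mulnS addnC. Qed.

Lemma prof_r_gt0 u : 0 < r u. Proof. by rewrite divr_gt0. Qed.

Lemma prof_lambda_gt0 u : 0 < lam u. Proof. by rewrite invr_gt0 exprn_gt0. Qed.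

Lemma dprof_r (u : R) : is_derive u 1 r (r' u).
Proof.
have := der_mulc k^-1 (dg u); rewrite mulrC; apply: der_ext => z.
by rewrite mulrC.
Qed.

Lemma dprof_r' (u : R) : is_derive u 1 r' (- r u + N%:R * lam u ^+ 2 * r u).
Proof.
have := der_mulc k^-1 (profile_second_order u).
have -> : k^-1 * acc (g u) = - r u + N%:R * lam u ^+ 2 * r u.
  rewrite lam2 /acc /r /prof_r -/k exprS.
  by field; rewrite gt_eqF// expf_neq0// g_neq0.
by apply: der_ext => z; rewrite mulrC.
Qed.

Lemma dprof_lambda (u : R) : is_derive u 1 lam (- (N.+1%:R * lam u * r' u / r u)).
Proof.
apply: der_eq (dgV N.+1 u) _; rewrite /lam /r /r' /prof_r /prof_lambda -/k.
by rewrite [g u ^+ N.+2]exprS; field; rewrite gt_eqF// g_neq0 expf_neq0// g_neq0.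
Qed.

Lemma prof_energy u : r' u ^+ 2 + r u ^+ 2 * lam u ^+ 2 + r u ^+ 2 = 1.
Proof.
rewrite lam2 /r' /r /prof_r -/k.
transitivity ((g1 u ^+ 2 + (g u ^+ (2 * N))^-1 + g u ^+ 2) / k ^+ 2).
  by field; rewrite gt_eqF// g_neq0 expf_neq0// g_neq0.
by rewrite ode k2 divff// gt_eqF.
Qed.

End ProfileAnalysis.

Lemma continuous_gt {R : realType} (f : R -> R) (x c : R) : {for x, continuous f} ->
  c < f x -> exists2 e, 0 < e & forall y, `|x - y| < e -> c < f y.
Proof.
move=> cf cfx; have e0 : 0 < f x - c by rewrite subr_gt0.
move/cvgrPdist_lt : cf => /(_ _ e0) /nbhs_ballP[e /= e0' H].
exists e => // y xy; have := H y xy; rewrite /= ltr_norml => /andP[_].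
lra.
Qed.

(** Strict convexity of a power, in three-point form. In the induction step the inequality is
    multiplied by [t], and the right-hand side gains [(t2 - t) (t - t1) (t2^k - t1^k) >= 0]. *)
Lemma convex_power {R : realType} (t1 t t2 : R) (n : nat) : 0 < t1 -> t1 < t -> t < t2 ->
  (t2 - t1) * t ^+ n.+2 < (t2 - t) * t1 ^+ n.+2 + (t - t1) * t2 ^+ n.+2.
Proof.
move=> t10 t1t tt2; elim: n => [|n IH].
  rewrite -subr_gt0.
  have -> : (t2 - t) * t1 ^+ 2 + (t - t1) * t2 ^+ 2 - (t2 - t1) * t ^+ 2 =
     (t - t1) * (t2 - t) * (t2 - t1) by ring.
  by rewrite !mulr_gt0 ?subr_gt0// (lt_trans t1t).
have t0 : 0 < t by exact: lt_trans t1t.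
have t20 : 0 < t2 by exact: lt_trans tt2.
have : t1 ^+ n.+2 <= t2 ^+ n.+2.
  by rewrite lerXn2r// ?nnegrE ?ltW// (lt_trans t1t).
rewrite -subr_ge0 => H; have := mulr_ge0 (mulr_ge0 (ltW (_ : 0 < t2 - t)) (ltW (_ : 0 < t - t1))) H.
rewrite !subr_gt0 => /(_ tt2 t1t) H1.
have := IH; rewrite -(ltr_pM2l t0) => H2.
rewrite !(exprS _ n.+2); nra.
Qed.

(** * Bounds on theta(T) *)

Section RotationNumber.
Context {R : realType}.
Variables (N : nat) (r r' lam th : R -> R) (T a : R).
Hypothesis N0 : (0 < N)%N.
Hypothesis r_gt0 : forall u, 0 < r u.
Hypothesis dr : forall u : R, is_derive u 1 r (r' u).
Hypothesis dr' : forall u : R, is_derive u 1 r' (- r u + N%:R * lam u ^+ 2 * r u).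
Hypothesis dlam : forall u : R, is_derive u 1 lam (- (N.+1%:R * lam u * r' u / r u)).
Hypothesis energy : forall u, r' u ^+ 2 + r u ^+ 2 * lam u ^+ 2 + r u ^+ 2 = 1.
Hypothesis dth : forall u : R, is_derive u 1 th (r u * lam u * (rho r u)^-1 ^+ 2).
Hypothesis th0 : th 0 = 0.
Hypothesis a0 : 0 < a.
Hypothesis lamE : forall u, lam u = a * (r u ^+ N.+1)^-1.
Hypothesis r_even : forall u, r (- u) = r u.
Hypothesis r'_odd : forall u, r' (- u) = - r' u.
Hypothesis r_per : forall u, r (u + T) = r u.
Hypothesis r'_per : forall u, r' (u + T) = r' u.
Hypothesis r_min : forall u, r 0 <= r u.
Hypothesis T0 : 0 < T.
Hypothesis r'_gt0 : forall u, 0 < u -> u < T / 2 -> 0 < r' u.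

Let rn0 u : r u != 0. Proof. by rewrite gt_eqF. Qed.

Lemma lam_pos u : 0 < lam u.
Proof. by rewrite lamE mulr_gt0// invr_gt0 exprn_gt0. Qed.

Let r2_lt1 u : 0 < 1 - r u ^+ 2 := one_subr2_gt0 r_gt0 lam_pos energy u.
Let rho0 u : 0 < rho r u := rho_gt0 r_gt0 lam_pos energy u.
Let rhon0 u : rho r u != 0 := rho_neq0 r_gt0 lam_pos energy u.

Let r'0 : r' 0 = 0. Proof. by have := r'_odd 0; rewrite oppr0; lra. Qed.

Let r'T2 : r' (T / 2) = 0.
Proof.
have := r'_per (- (T / 2)); rewrite r'_odd.
have -> : - (T / 2) + T = T / 2 by field.
lra.
Qed.

Lemma periodic_nat (f : R -> R) : (forall u, f (u + T) = f u) ->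
  forall j u, f (u + j%:R * T) = f u.
Proof.
move=> fT; elim=> [|j IH] u; first by rewrite mul0r addr0.
by rewrite -natr1 mulrDl mul1r addrA fT IH.
Qed.

Let lam_per u : lam (u + T) = lam u. Proof. by rewrite !lamE r_per. Qed.
Let lam_even u : lam (- u) = lam u. Proof. by rewrite !lamE r_even. Qed.
Let rho_per u : rho r (u + T) = rho r u. Proof. by rewrite /rho r_per. Qed.
Let rho_even u : rho r (- u) = rho r u. Proof. by rewrite /rho r_even. Qed.

Lemma th_odd u : th (- u) = - th u.
Proof.
have dd (x : R) : is_derive x 1 (fun z => th z + th (0 - z)) 0.
  apply: der_eq (der_add (dth x) (der_reflect (dth (0 - x)))) _.
  by rewrite !sub0r r_even lam_even rho_even subrr.
have := der_cst_eq u 0 dd; rewrite sub0r subrr th0 addr0.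
by move/eqP; rewrite addrC addr_eq0 => /eqP.
Qed.

Lemma th_shift u : th (u + T) = th u + th T.
Proof.
have dd (x : R) : is_derive x 1 (fun z => th (z + T) - th z) 0.
  have dT : is_derive x 1 (fun z => z + T) 1.
    exact: der_eq (der_add (der_id x) (der_cst T x 1)) (addr0 _).
  apply: der_eq (der_sub (@der_comp _ _ th (fun z => z + T) x 1 _ _ (dth (x + T)) dT) (dth x)) _.
  by rewrite r_per lam_per rho_per mulr1 subrr.
have := der_cst_eq u 0 dd; rewrite add0r th0 subr0; lra.
Qed.

(** Shifting [- j T / 2] by [j] periods lands on [j T / 2], and [th] is odd. *)
Lemma th_half j : th (j%:R * (T / 2)) = j%:R * (th T / 2).
Proof.
have H k : forall u, th (u + k%:R * T) = th u + k%:R * th T.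
  elim: k => [|k IH] u; first by rewrite !mul0r !addr0.
  by rewrite -natr1 !mulrDl !mul1r addrA th_shift IH addrA.
have := H j (- (j%:R * (T / 2))); rewrite th_odd.
have -> : - (j%:R * (T / 2)) + j%:R * T = j%:R * (T / 2) by field.
lra.
Qed.

Lemma th_mono u v : u < v -> th u < th v.
Proof.
move=> uv; apply: (der_smono uv (fun z _ => dth z)) => z _.
apply: mulr_gt0; first by rewrite mulr_gt0 ?lam_pos.
by rewrite exprn_gt0 ?invr_gt0.
Qed.

(** Squared tangent of the distance to the great circle [r = 0]. Along great circles of the orbit
    space it is a sinusoid in [2 theta], which is the comparison behind [ang]. *)
Let q (u : R) : R := r u ^+ 2 / (1 - r u ^+ 2).

Let dq (u : R) : is_derive u 1 q (2 * r u * r' u / (1 - r u ^+ 2) ^+ 2).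
Proof.
have n0 : 1 - r u ^+ 2 != 0 by rewrite gt_eqF.
have d1 : is_derive u 1 (fun z => 1 - r z ^+ 2) (0 - 2 * r u ^+ 1 * r' u).
  exact: der_sub (der_cst 1 u 1) (der_exp 2 (dr u)).
apply: der_eq (der_mul (der_exp 2 (dr u))
  (@der_comp _ _ (fun z => z^-1) _ u 1 _ _ (der_inv_at n0) d1)) _.
by rewrite /= !expr1; field.
Qed.

Let q1 := q 0.
Let q2 := q (T / 2).

Let q_mono u v : 0 <= u -> u < v -> v <= T / 2 -> q u < q v.
Proof.
move=> u0 uv vT; apply: (der_smono uv (fun z _ => dq z)) => z /andP[uz zv].
rewrite divr_gt0 ?exprn_gt0// !mulr_gt0// r'_gt0//.
  exact: le_lt_trans u0 uz.
exact: lt_le_trans zv vT.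
Qed.

Let T20 : 0 < T / 2. Proof. by rewrite divr_gt0. Qed.

Let D := (q2 - q1) / 2.
Let D0 : 0 < D. Proof. by rewrite divr_gt0// subr_gt0 q_mono. Qed.
(** [q] rescaled affinely, from 1 at 0 to -1 at [T / 2]. *)
Let w (u : R) : R := ((q1 + q2) / 2 - q u) / D.

Let D2 : 2 * D = q2 - q1. Proof. by rewrite /D; field. Qed.
Let wD u : w u * D = (q1 + q2) / 2 - q u.
Proof. by rewrite /w divfK// gt_eqF. Qed.

Let w_bound u : 0 < u -> u < T / 2 -> -1 < w u < 1.
Proof.
move=> u0 uT; have H1 := q_mono (lexx 0) u0 (ltW uT).
have H2 := q_mono (ltW u0) uT (lexx _); rewrite -/q1 -/q2 in H1 H2.
have := wD u; have := D2; have := D0; move=> D0' D2' wD'.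
by apply/andP; split; rewrite -(ltr_pM2r D0') wD'; lra.
Qed.

(* In the variable [q], [4 theta'^2 (q - q1)(q2 - q)] dominates [q'^2]; after
   clearing denominators this is the strict convexity of [t ^ n], [t = r^2],
   between the two zeros of [r']. *)
Let key u : 0 < u -> u < T / 2 ->
  (2 * r u * r' u / (1 - r u ^+ 2) ^+ 2) ^+ 2 <
  4 * (r u * lam u * (rho r u)^-1 ^+ 2) ^+ 2 * ((q u - q1) * (q2 - q u)).
Proof.
move=> u0 uT.
have -> : (rho r u)^-1 ^+ 2 = (1 - r u ^+ 2)^-1.
  by rewrite exprVn (sqr_rho r_gt0 lam_pos energy).
have H1 := q_mono (lexx 0) u0 (ltW uT).
have H2 := q_mono (ltW u0) uT (lexx _).
rewrite /q1 /q2 in H1 H2 *; rewrite /q in H1 H2 *.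
set t := r u ^+ 2; set t1 := r 0 ^+ 2; set t2 := r (T / 2) ^+ 2.
have t0 : 0 < t by rewrite exprn_gt0.
have t10 : 0 < t1 by rewrite exprn_gt0.
have [s s1 s2] : [/\ 0 < 1 - t, 0 < 1 - t1 & 0 < 1 - t2] by split; exact: r2_lt1.
have sn0 : 1 - t != 0 by rewrite gt_eqF.
have s1n0 : 1 - t1 != 0 by rewrite gt_eqF.
have s2n0 : 1 - t2 != 0 by rewrite gt_eqF.
have t1t : t1 < t.
  move: H1; rewrite -/t -/t1 ltr_pdivlMr// mulrAC ltr_pdivrMr//; lra.
have tt2 : t < t2.
  move: H2; rewrite -/t -/t2 ltr_pdivlMr// mulrAC ltr_pdivrMr//; lra.
(* With [t = r^2] one has [lam^-2 = K t^n]. At [t1] and [t2], where [r'] vanishes, the energy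
   relation reads [K t^n (1 - t) = t]. *)
pose K := a ^- 2.
have K0 : 0 < K by rewrite invr_gt0 exprn_gt0.
have lamK v : lam v ^+ 2 * (K * (r v ^+ 2) ^+ N.+1) = 1.
  rewrite lamE /K exprMn exprVn -!exprM mulnC.
  by field; rewrite gt_eqF// expf_neq0.
have edge v : r' v = 0 -> K * (r v ^+ 2) ^+ N.+1 * (1 - r v ^+ 2) = r v ^+ 2.
  move=> r'v; have := energy v; rewrite r'v expr0n add0r => E.
  have -> : 1 - r v ^+ 2 = r v ^+ 2 * lam v ^+ 2 by rewrite -E addrK.
  rewrite mulrCA -[K * _ * _]mulrC lamK.
  by rewrite mulr1.
have E1 := edge 0 r'0; have E2 := edge _ r'T2; rewrite -/t1 -/t2 in E1 E2.
have L := lamK u; rewrite -/t in L.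
have r'2 : r' u ^+ 2 = 1 - t - t * lam u ^+ 2 by rewrite -(energy u) /t; ring.
have L0 : 0 < lam u ^+ 2 by rewrite exprn_gt0// lam_pos.
have conv := convex_power N.-1 t10 t1t tt2; rewrite (prednK N0) in conv.
have t12 : 0 < t2 - t1 by rewrite subr_gt0 (lt_trans t1t).
pose G := (t - t1) * (t2 - t) / ((1 - t1) * (1 - t2)).
(* The chord of [K t^n] between [t1] and [t2] lies above the graph, and the end values [t / (1 - t)]
   make [(1 - t)] times the chord equal to [t + G]. The exponent n is at least 2, so the inequality
   is strict. *)
have main : K * t ^+ N.+1 * (1 - t) - t < G.
  have e1 : K * t1 ^+ N.+1 = t1 / (1 - t1) by rewrite -{2}E1 mulfK.
  have e2 : K * t2 ^+ N.+1 = t2 / (1 - t2) by rewrite -{2}E2 mulfK.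
  rewrite -(ltr_pM2r t12) mulrBl ltrBlDr.
  have -> : G * (t2 - t1) + t * (t2 - t1) =
      (1 - t) * (K * ((t2 - t) * t1 ^+ N.+1 + (t - t1) * t2 ^+ N.+1)).
    have -> : K * ((t2 - t) * t1 ^+ N.+1 + (t - t1) * t2 ^+ N.+1) =
      (t2 - t) * (K * t1 ^+ N.+1) + (t - t1) * (K * t2 ^+ N.+1) by ring.
    by rewrite e1 e2 /G; field; rewrite s1n0 s2n0.
  rewrite [X in X < _](_ : _ = (1 - t) * (K * ((t2 - t1) * t ^+ N.+1))); last by ring.
  by rewrite !ltr_pM2l.
have := main; rewrite -(ltr_pM2l L0).
have -> : lam u ^+ 2 * (K * t ^+ N.+1 * (1 - t) - t) =
    lam u ^+ 2 * (K * t ^+ N.+1) * (1 - t) - t * lam u ^+ 2 by ring.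
rewrite L mul1r => main'.
have c0 : 0 < 4 * t / (1 - t) ^+ 4 by rewrite divr_gt0 ?exprn_gt0// mulr_gt0.
have -> : (2 * r u * r' u / (1 - t) ^+ 2) ^+ 2 = 4 * t / (1 - t) ^+ 4 * r' u ^+ 2.
  by rewrite /t in sn0 *; field.
have -> : 4 * (r u * lam u * (1 - t)^-1) ^+ 2 *
    ((t / (1 - t) - t1 / (1 - t1)) * (t2 / (1 - t2) - t / (1 - t))) =
    4 * t / (1 - t) ^+ 4 * (lam u ^+ 2 * G).
  have -> : (r u * lam u * (1 - t)^-1) ^+ 2 = t * lam u ^+ 2 / (1 - t) ^+ 2.
    by rewrite /t in sn0 *; field.
  by rewrite /G; field; rewrite sn0 s1n0 s2n0.
by rewrite ltr_pM2l// r'2.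
Qed.


Lemma cos_gt_acos (e x : R) : 0 <= e <= pi -> -1 <= x <= 1 -> cos e < x -> acos x < e.
Proof.
move=> e01 x01 ex; have xI : x \in `[(-1), 1] by rewrite in_itv.
have aI : acos x \in `[0, pi] by rewrite in_itv/= acos_ge0// acos_lepi.
by rewrite -ltr_cos ?acosK ?in_itv.
Qed.

Lemma cos_lt_acos (e x : R) : 0 <= e <= pi -> -1 <= x <= 1 -> x < cos e -> e < acos x.
Proof.
move=> e01 x01 ex; have xI : x \in `[(-1), 1] by rewrite in_itv.
have aI : acos x \in `[0, pi] by rewrite in_itv/= acos_ge0// acos_lepi.
by rewrite -ltr_cos ?acosK ?in_itv.
Qed.

Let dw (u : R) : is_derive u 1 w (- (2 * r u * r' u / (1 - r u ^+ 2) ^+ 2) / D).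
Proof.
apply: (@der_ext _ _ (fun z => D^-1 * ((q1 + q2) / 2 - q z))) => [z|].
  by rewrite mulrC.
apply: der_eq (der_mulc D^-1 (der_sub (der_cst ((q1 + q2) / 2) u 1) (dq u))) _.
by rewrite sub0r mulrC.
Qed.

(** Excess of [2 theta] over the phase of [q]. By [key] its derivative is positive, and [acos (w u)]
    runs from 0 to pi over the half period. *)
Let ang u := 2 * th u - acos (w u).

Let ang_mono u v : 0 < u -> u < v -> v < T / 2 -> ang u < ang v.
Proof.
move=> u0 uv vT.
pose wp x := - (2 * r x * r' x / (1 - r x ^+ 2) ^+ 2) / D.
have dang (x : R) : u <= x <= v -> is_derive x 1 ang
    (2 * (r x * lam x * (rho r x)^-1 ^+ 2) - - (Num.sqrt (1 - w x ^+ 2))^-1 * wp x).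
  move=> /andP[ux xv]; have wx := w_bound (lt_le_trans u0 ux) (le_lt_trans xv vT).
  exact: der_sub (der_mulc 2 (dth x))
    (@der_comp _ _ (@acos R) w x 1 _ _ (is_derive1_acos wx) (dw x)).
apply: (der_smono uv dang) => x /andP[ux xv].
have x0 : 0 < x by exact: lt_trans ux.
have xT : x < T / 2 by exact: lt_trans vT.
have /andP[wx1 wx2] := w_bound x0 xT.
pose S := Num.sqrt (1 - w x ^+ 2).
have S2 : S ^+ 2 = 1 - w x ^+ 2 by rewrite sqr_sqrtr//; nra.
have S0 : 0 < S by rewrite sqrtr_gt0; nra.
have DS : (D * S) ^+ 2 = (q x - q1) * (q2 - q x).
  rewrite exprMn S2 mulrBr mulr1 -exprMn [D * _]mulrC wD.
  by rewrite /D; field.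
have K := key x0 xT; rewrite -DS in K.
rewrite -/S /wp.
set y := 2 * r x * r' x / (1 - r x ^+ 2) ^+ 2 in K *.
set z := r x * lam x * (rho r x)^-1 ^+ 2 in K *.
have z0 : 0 < z.
  by apply: mulr_gt0; [rewrite mulr_gt0 ?lam_pos|rewrite exprn_gt0 ?invr_gt0].
have y0 : 0 <= y by rewrite /y ltW// divr_gt0 ?exprn_gt0// !mulr_gt0// r'_gt0.
have DS0 : 0 < D * S := mulr_gt0 D0 S0.
have zDS0 : 0 <= 2 * z * (D * S) := ltW (mulr_gt0 (mulr_gt0 (ltr0n _ 2) z0) DS0).
have : y < 2 * z * (D * S).
  have E : (2 * z * (D * S)) ^+ 2 = 4 * z ^+ 2 * (D * S) ^+ 2 by ring.
  by rewrite -E ltr_pXn2r ?nnegrE in K.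
rewrite -ltr_pdivrMr// => H; rewrite subr_gt0.
apply: le_lt_trans H; rewrite le_eqVlt; apply/orP; left; apply/eqP.
by field; rewrite !gt_eqF.
Qed.

Let cw : continuous w := der_continuousT dw.

Let w_0 : w 0 = 1.
Proof. by apply: (mulIf (_ : D != 0)); rewrite ?gt_eqF// wD -/q1 /D; field. Qed.

Let w_T : w (T / 2) = -1.
Proof. by apply: (mulIf (_ : D != 0)); rewrite ?gt_eqF// wD -/q2 /D; field. Qed.

Lemma th_gt0 u : 0 < u -> 0 < th u.
Proof. by move=> u0; rewrite -th0; exact: th_mono. Qed.

(** [acos] has no derivative at [w 0 = 1], so 0 is approached from the right: there [acos (w v)] is
    below any given [e] while [th v > 0], and [ang] increases afterwards. *)
Let ang_ge0 u : 0 < u -> u < T / 2 -> 0 <= ang u.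
Proof.
move=> u0 uT; rewrite -oppr_le0; apply/ler_addgt0Pr => e e0; rewrite add0r.
pose d := Num.min e (pi / 2).
have pi0 := pi_gt0 R.
have d0 : 0 < d by rewrite lt_min e0 divr_gt0.
have de : d <= e by rewrite ge_min lexx.
have dpi : d < pi.
  have : d <= pi / 2 by rewrite ge_min lexx orbT.
  by lra.
have cd : cos d < 1.
  by rewrite -cos0 ltr_cos ?in_itv/= ?lexx ?(ltW d0) ?(ltW pi0) ?(ltW dpi).
have [|k k0 Hk] := @continuous_gt _ w 0 (cos d) (@cw 0); first by rewrite w_0.
pose v := Num.min (k / 2) (u / 2).
have v0 : 0 < v by rewrite lt_min !divr_gt0.
have vk : v <= k / 2 by rewrite ge_min lexx.
have vu : v <= u / 2 by rewrite ge_min lexx orbT.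
have vu' : v < u by lra.
have vT : v < T / 2 by lra.
have /andP[/ltW w1 /ltW w2] := w_bound v0 vT.
have : acos (w v) < d.
  apply: cos_gt_acos; rewrite ?w1 ?(ltW d0) ?(ltW dpi)//.
  by apply: Hk; rewrite sub0r normrN gtr0_norm//; lra.
have := ang_mono v0 vu' uT; have := th_gt0 v0.
rewrite /ang; lra.
Qed.

(** The margin [e = ang (T / 4) > 0] survives the limit at [T / 2], where [acos (w v)] comes closer
    to pi than [e]; this makes the bound strict. *)
Lemma pi_lt_rotation : pi < th T.
Proof.
have -> : th T = 2 * th (T / 2) by have := th_half 1; rewrite !mul1r; lra.
have pi0 := pi_gt0 R.
have [a1 a2 a3] : [/\ 0 < T / 8, T / 8 < T / 4 & T / 4 < T / 2].
  by move: T0; split; lra.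
pose e := ang (T / 4).
have e0 : 0 < e.
  apply: le_lt_trans (ang_mono a1 a2 a3); apply: ang_ge0 => //; lra.
pose d := Num.min e (pi / 2).
have d0 : 0 < d by rewrite lt_min e0 divr_gt0.
have de : d <= e by rewrite ge_min lexx.
have dpi : d <= pi / 2 by rewrite ge_min lexx orbT.
have cd : - 1 < cos (pi - d).
  rewrite -cospi ltr_cos ?in_itv/= ?lexx ?(ltW pi0) ?andbT//; lra.
have cNw : {for T / 2, continuous (fun z => - w z)} by apply: cvgN; exact: cw.
have [|k k0 Hk] := @continuous_gt _ _ _ (- cos (pi - d)) cNw.
  by rewrite w_T ltrN2.
pose v := Num.max (T / 2 - k / 2) (3 * T / 8).
have kv : T / 2 - k / 2 <= v by rewrite le_max lexx.
have Tv : 3 * T / 8 <= v by rewrite le_max lexx orbT.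
have vT : v < T / 2 by rewrite gt_max; apply/andP; split; move: T0; lra.
have v0 : 0 < v by move: T0; lra.
have /andP[/ltW w1 /ltW w2] := w_bound v0 vT.
have : pi - d < acos (w v).
  apply: cos_lt_acos; rewrite ?w1//; first by apply/andP; split; lra.
  by rewrite -ltrN2; apply: Hk; rewrite gtr0_norm; lra.
have := ang_mono (_ : 0 < T / 4) (_ : T / 4 < v) vT.
move=> /(_ _ _)H; have : e < ang v by apply: H; lra.
have := th_mono vT; rewrite /ang; lra.
Qed.

Let dsin (u : R) : is_derive u 1 (fun z => sin (th z))
  (r u * lam u * (rho r u)^-1 ^+ 2 * cos (th u)).
Proof. by rewrite mulrC; exact: (@der_comp _ _ sin th) (is_derive_sin _) (dth u). Qed.

Let dcos (u : R) : is_derive u 1 (fun z => cos (th z))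
  (- (r u * lam u * (rho r u)^-1 ^+ 2 * sin (th u))).
Proof.
rewrite mulrC -mulNr.
exact: (@der_comp _ _ cos th) (is_derive_cos _) (dth u).
Qed.

(** The sign is chosen so that [h], which vanishes at 0 like [r'], is positive just after 0. *)
Let h u := - nrm r r' lam (fun z => sin (th z)) (fun z => cos (th z)) u.
Let h' u := N%:R * lam u * tgt r r' lam (fun z => sin (th z)) (fun z => cos (th z)) u.

Let dh (u : R) : is_derive u 1 h (h' u).
Proof.
apply: der_eq (der_opp (dnrm r_gt0 lam_pos dr dr' dlam energy dsin dcos u)) _.
by rewrite /h' opprK.
Qed.

Let dh' (u : R) : is_derive u 1 h' ((potential N r lam 0 u + N.+1%:R) * h u -
  wgt' N r r' u / wgt N r u * h' u).
Proof.
have := proj2 (sl_sol_nrm r_gt0 lam_pos dr dr' dlam energy dsin dcos u).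
rewrite opprK => /der_opp H; apply: der_ext (der_eq H _) => [z|].
  by rewrite /h' opprK.
by rewrite /h /h'; ring.
Qed.

(* Sturm comparison on [0, T / 2] of [r'] with a coordinate [h] of the unit normal, which
   solves the same equation at the lower energy [- n]. *)
Lemma rotation_lt_2pi : th T < 2 * pi.
Proof.
have -> : th T = 2 * th (T / 2) by have := th_half 1; rewrite !mul1r; lra.
have pi0 := pi_gt0 R.
rewrite ltr_pM2l// ltNge; apply/negP => piT.
have cth : continuous th := der_continuousT dth.
(* If theta reaches pi by [T / 2], it takes the value [pi / 2] at some [u0] and pi at some [us]. On
   the interval up to [u0] sine and cosine are nonnegative, which makes [h] positive there. *)
have [u0 /andP[u00 u0T] thu0] : exists2 u, 0 <= u <= T / 2 & th u = pi / 2.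
  by apply: IVT_cont => [|x _|]; [exact: ltW|exact: cth|rewrite th0; apply/andP; split; lra].
have [us /andP[us0 usT] thus] : exists2 u, 0 <= u <= T / 2 & th u = pi.
  by apply: IVT_cont => [|x _|]; [exact: ltW|exact: cth|rewrite th0; apply/andP; split; lra].
have u0p : 0 < u0 by rewrite lt_neqAle u00 andbT; apply/eqP => E; rewrite -E th0 in thu0; lra.
have u0us : u0 < us.
  rewrite ltNge; apply/negP; rewrite le_eqVlt => /predU1P[E|/th_mono]; last lra.
  by rewrite E thu0 in thus; lra.
pose r'' u := - r u + N%:R * lam u ^+ 2 * r u.
(* Weighted Wronskian of [h] and [r']. As their energies differ by n, its derivative is
   [- n wgt h r'], negative while [h] and [r'] are positive. *)
pose W u := wgt N r u * (h u * r'' u - h' u * r' u).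
have p0 u : 0 < wgt N r u by rewrite exprn_gt0.
have dr'' (u : R) := proj2 (sl_sol_r' r_gt0 dr dr' dlam u).
have dW (u : R) : is_derive u 1 W (- (N.+1%:R * wgt N r u * h u * r' u)).
  apply: der_eq (der_mul (dwgt N dr u) (der_sub (der_mul (dh u) (dr'' u))
    (der_mul (dh' u) (dr' u)))) _.
  have pn : wgt N r u != 0 by rewrite gt_eqF.
  by rewrite /r''; field.
have hE u : h u = (r u ^+ 2 * lam u * sin (th u) + r' u * cos (th u)) / rho r u.
  by rewrite /h /nrm opprK.
have h_pos u : 0 < u -> u <= u0 -> 0 < h u.
  move=> up uu0; rewrite hE divr_gt0//.
  have thu : th u <= pi / 2.
    by move: uu0; rewrite le_eqVlt => /predU1P[->|/th_mono]; lra.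
  have s0 : 0 < sin (th u).
    by apply: sin_gt0_pi; rewrite th_gt0//=; lra.
  have r'u : 0 <= r' u by apply/ltW/r'_gt0 => //; lra.
  have c0 : 0 <= cos (th u).
    by apply: cos_ge0_pihalf; rewrite thu andbT; have := th_gt0 up; lra.
  by rewrite ltr_wpDr ?mulr_ge0// !mulr_gt0 ?exprn_gt0 ?lam_pos.
have W0 : W 0 = 0.
  rewrite /W hE r'0 th0 sin0; ring.
have Wu0 : W u0 < 0.
  have := @der_smono _ (fun u => - W u) _ 0 u0 u0p (fun u _ => der_opp (dW u)).
  rewrite W0 oppr0 oppr_gt0; apply=> u /andP[up uu0].
  rewrite opprK !mulr_gt0// ?h_pos ?(ltW uu0)// r'_gt0//; lra.
(* [h W / r'] is nonincreasing where [r' > 0], so [h] keeps its sign *)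
have h_pos' u : u0 <= u -> u < T / 2 -> 0 < h u.
  move=> u0u uT.
  pose y z := h z / r' z * W z.
  have dy (z : R) : u0 <= z <= u -> is_derive z 1 y
     (- (W z ^+ 2 / (wgt N r z * r' z ^+ 2)) - N.+1%:R * wgt N r z * h z ^+ 2).
    move=> /andP[u0z zu]; have r'z : r' z != 0 by rewrite gt_eqF// r'_gt0//; lra.
    have pn : wgt N r z != 0 by rewrite gt_eqF.
    apply: der_eq (der_mul (der_mul (dh z) (@der_comp _ _ (fun z => z^-1) r' z 1 _ _
      (der_inv_at r'z) (dr' z))) (dW z)) _.
    rewrite /W /r''; field; rewrite r'z pn//.
  have hn0 z : u0 <= z -> z <= u -> h z != 0.
    move=> u0z zu; apply/eqP => hz.
    have : - y u0 <= - y z.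
      have dy' (x : R) : u0 <= x <= z -> is_derive x 1 (fun x => - y x)
          (- (- (W x ^+ 2 / (wgt N r x * r' x ^+ 2)) - N.+1%:R * wgt N r x * h x ^+ 2)).
        by move=> /andP[u0x xz]; apply/der_opp/dy; rewrite u0x (le_trans xz).
      apply: (der_mono u0z dy') => x _.
      rewrite opprB opprK; apply: addr_ge0.
        exact: mulr_ge0 (mulr_ge0 (ler0n _ _) (ltW (p0 x))) (sqr_ge0 _).
      exact: divr_ge0 (sqr_ge0 _) (mulr_ge0 (ltW (p0 x)) (sqr_ge0 _)).
    have -> : y z = 0 by rewrite /y hz !mul0r.
    rewrite oppr0 lerNl oppr0 leNgt => /negP; apply.
    by rewrite pmulr_rlt0// divr_gt0 ?h_pos// r'_gt0//; lra.
  rewrite ltNge; apply/negP => hu.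
  have cNh z : u0 <= z <= u -> {for z, continuous (fun z => - h z)}.
    by move=> _; apply: cvgN; exact: (der_continuousT dh).
  have hu0 := ltW (h_pos u0 u0p (lexx u0)).
  have sg : - h u0 <= 0 <= - h u by apply/andP; split; lra.
  have [z /andP[u0z zu] /eqP] := IVT_cont u0u cNh sg.
  by rewrite oppr_eq0 (negbTE (hn0 z u0z zu)).
(* Where theta is pi, [h] has the sign of [- r']. Before [T / 2] this contradicts [h_pos']; at
   [T / 2] both [h] and [r'] vanish, and the decreasing [W] would have to return from a negative
   value to 0. *)
have hus : h us = - r' us / rho r us.
  by rewrite hE thus sinpi cospi mulr0 add0r mulrN1.
move: usT; rewrite le_eqVlt => /predU1P[E|usT]; last first.
  have := h_pos' us (ltW u0us) usT; rewrite hus.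
  have : 0 < r' us / rho r us by rewrite divr_gt0// r'_gt0//; lra.
  by rewrite mulNr; lra.
have WT : W (T / 2) = 0 by rewrite /W -E hus E r'T2; ring.
have : - W u0 < - W (T / 2).
  have u0T' : u0 < T / 2 by rewrite -E.
  apply: (@der_smono _ (fun u => - W u) _ u0 (T / 2) u0T' (fun u _ => der_opp (dW u))).
  move=> u /andP[u0u uT]; rewrite opprK !mulr_gt0// ?h_pos' ?(ltW u0u)// r'_gt0//; lra.
by rewrite WT; lra.
Qed.

Lemma lam_le u : lam u <= (r 0)^-1.
Proof.
have r00 := r_gt0 0; have lu := lam_pos u.
have H : (r u * lam u) ^+ 2 <= 1.
  rewrite exprMn -(energy u) -addrA addrCA lerDl addr_ge0 ?sqr_ge0//.
have H1 : r u * lam u <= 1.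
  by rewrite -(ler_pXn2r (n := 2)) ?nnegrE ?expr1n// ltW// mulr_gt0.
rewrite -(ler_pM2l r00) divff ?gt_eqF//; apply: le_trans H1.
by rewrite ler_wpM2r ?r_min// ltW.
Qed.

Lemma r_lt1 u : r u < 1.
Proof.
have := r2_lt1 u; rewrite subr_gt0 => H.
by rewrite -(ltr_pXn2r (n := 2)) ?nnegrE ?expr1n// ltW.
Qed.

Lemma r'_le1 u : `|r' u| <= 1.
Proof.
rewrite -(ler_pXn2r (n := 2)) ?nnegrE// real_normK ?num_real// expr1n -(energy u).
by rewrite -addrA lerDl addr_ge0 ?sqr_ge0// mulr_ge0 ?sqr_ge0.
Qed.

Lemma curve_eigenvalues (ev l : R) h0 h0' u1 u2 : 0 <= ev -> 0 < l ->
  (forall u, r (u + 2 * l) = r u) -> (forall u, r' (u + 2 * l) = r' u) ->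
  sl_sol (wgt N r) (wgt' N r r') (potential N r lam ev) 0 h0 h0' ->
  h0 0 = 0 -> (exists u, h0 u != 0) ->
  0 < u1 -> u1 < u2 -> u2 <= l -> h0 u1 = 0 -> h0 u2 = 0 ->
  let eig := sl_eigen (wgt N r) (wgt' N r r') (potential N r lam ev) l in
  [/\ exists (c : bool -> R) (h : bool -> R -> R), injective c /\ forall b,
        [/\ c b < 0, eig (c b) (h b) & forall u, h b (- u) = h b u],
      exists (c : R) (h : R -> R),
        [/\ c < 0, eig c h & forall u, h (- u) = - h u] &
      u2 < l -> exists (c : bool -> R) (h : bool -> R -> R), injective c /\ forall b,
        [/\ c b < 0, eig (c b) (h b) & forall u, h b (- u) = - h b u]].
Proof.
move=> ev0 l0 rl r'l s h00 hn0 u10 u12 u2l hu1 hu2.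
have cr : continuous r := der_continuousT dr.
have cr' : continuous r' := der_continuousT dr'.
have clam : continuous lam := der_continuousT dlam.
have lam_l u : lam (u + 2 * l) = lam u by rewrite !lamE rl.
have r00 := r_gt0 0.
have cX (f : R -> R) j : continuous f -> continuous (fun u => f u ^+ j).
  move=> cf; elim: j => [|j IH] u; first exact: cvg_cst.
  have -> : (fun u => f u ^+ j.+1) = (fun u => f u * f u ^+ j).
    by apply/funext => z; rewrite exprS.
  by apply: cvgM; [exact: cf|exact: IH].
have cV : continuous (potential N r lam ev).
  move=> u; have crV : {for u, continuous (fun u => (r u ^+ 2)^-1)}.
    by apply: cvgV; [rewrite expf_neq0|exact: cX cr u].
  apply: cvgB; first (apply: cvgB; last exact: cvg_cst).
    by apply: cvgM; [exact: cvg_cst|exact: crV].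
  by apply: cvgM; [exact: cvg_cst|exact: cX clam u].
have cp' : continuous (wgt' N r r').
  move=> u; apply: cvgM; last exact: cr'.
  by apply: cvgM; [exact: cvg_cst|exact: cX cr u].
(* All bounds come from the energy relation and the minimum of [r] at 0: [r 0 <= r u < 1],
   [lam u <= 1 / r 0] and [|r' u| <= 1]. *)
apply: (@sl_negative_eigenvalues _ (wgt N r) (wgt' N r r') (potential N r lam ev)
  (r 0 ^+ N) 1 (ev / r 0 ^+ 2 + N.+1%:R + N.+1%:R * N%:R * ((r 0)^-1 ^+ 2))
  _ cV _ _ _ _ l N%:R l0 cp' _ _ _ _ _ _ _ h0 h0' u1 u2 s h00 hn0 u10 u12 u2l hu1 hu2).
- exact: dwgt.
- by rewrite exprn_gt0.
- by move=> u; rewrite /wgt lerXn2r ?nnegrE ?r_min// ltW.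
- by move=> u; rewrite /wgt exprn_ile1// ltW// r_lt1.
- move=> u; rewrite /potential.
  have H1 : `|ev / r u ^+ 2| <= ev / r 0 ^+ 2.
    rewrite ger0_norm; last by rewrite divr_ge0// sqr_ge0.
    rewrite ler_wpM2l//.
    by rewrite lef_pV2 ?posrE ?exprn_gt0// lerXn2r ?nnegrE ?r_min// ltW.
  have H2 : `|N.+1%:R * N%:R * lam u ^+ 2| <= N.+1%:R * N%:R * ((r 0)^-1 ^+ 2).
    rewrite ger0_norm; last by rewrite mulr_ge0 ?sqr_ge0// mulr_ge0.
    rewrite ler_wpM2l ?mulr_ge0//.
    by rewrite lerXn2r ?nnegrE ?lam_le ?invr_ge0 ?ltW// lam_pos.
  rewrite (le_trans (ler_normB _ _))// lerD//.
  by rewrite (le_trans (ler_normB _ _))// lerD// normr_nat.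
- move=> u; rewrite /wgt' !normrM normr_nat -mulrA ler_piMr//.
  rewrite -[1]mulr1 ler_pM// ?r'_le1//.
  by rewrite ger0_norm ?exprn_ge0 ?exprn_ile1 ?ltW// r_lt1.
- by move=> u; rewrite /wgt r_even.
- by move=> u; rewrite /wgt' r_even r'_odd mulrN.
- by move=> u; rewrite /potential r_even lam_even.
- by move=> u; rewrite /wgt rl.
- by move=> u; rewrite /wgt' rl r'l.
- by move=> u; rewrite /potential rl lam_l.
Qed.

(** * Zeros along a closed profile curve *)

Section Closed.
Variables (k m : nat).
Hypothesis k0 : (0 < k)%N.
Hypothesis m0 : (0 < m)%N.
Hypothesis thT : th T = 2 * k%:R * pi / m%:R.

Let l := m%:R * (T / 2).

Let mn0 : (m%:R : R) != 0. Proof. by rewrite pnatr_eq0 -lt0n. Qed.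

(** Multiplied by [m], the bounds on [th T] read [m < 2 k] and [k < m], which no [m <= 2]
    satisfies. *)
Lemma closed_ge3 : (2 < m)%N.
Proof.
have pi0 := pi_gt0 R; have mp : 0 < (m%:R : R) by rewrite ltr0n.
have E : th T * m%:R = (2 * k)%N%:R * pi by rewrite thT natrM; field.
have H1 : (m < 2 * k)%N.
  rewrite -(ltr_nat R) -(ltr_pM2r pi0) -E mulrC ltr_pM2r//.
  exact: pi_lt_rotation.
have H2 : (k < m)%N.
  rewrite -(ltr_nat R) -(ltr_pM2r (_ : 0 < 2 * pi)) ?mulr_gt0//.
  have -> : k%:R * (2 * pi) = th T * m%:R by rewrite E natrM; ring.
  by rewrite mulrC ltr_pM2l// rotation_lt_2pi.
by case: m H1 H2 => [|[|[|]]]//; case: k k0 => [|[|]].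
Qed.

Let l0 : 0 < l. Proof. by rewrite mulr_gt0// ltr0n. Qed.

Let per (f : R -> R) : (forall u, f (u + T) = f u) -> forall u, f (u + 2 * l) = f u.
Proof.
move=> fT u; have -> : 2 * l = m%:R * T by rewrite /l; field.
exact: periodic_nat.
Qed.

Let T2l : T < l.
Proof.
rewrite /l -ltr_pdivrMr//.
have -> : T / (T / 2) = 2 by field; rewrite gt_eqF.
by rewrite ltr_nat closed_ge3.
Qed.

(** [r'] vanishes at 0, [T / 2] and [T]. Since [m > 2], the zero [T] lies strictly before [l], which
    yields the second odd eigenfunction. *)
Lemma eigenvalues_mode0 :
  let eig := sl_eigen (wgt N r) (wgt' N r r') (potential N r lam 0) l in
  (exists (c : bool -> R) (h : bool -> R -> R), injective c /\ forall b,
     [/\ c b < 0, eig (c b) (h b) & forall u, h b (- u) = h b u]) /\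
  (exists (c : bool -> R) (h : bool -> R -> R), injective c /\ forall b,
     [/\ c b < 0, eig (c b) (h b) & forall u, h b (- u) = - h b u]).
Proof.
have T2T : T / 2 < T by move: T0; lra.
have r'TT : r' T = 0 by rewrite -[T]add0r r'_per r'0.
have rn : exists u, r' u != 0.
  by exists (T / 4); rewrite gt_eqF// r'_gt0//; move: T0; lra.
have [A _ /(_ T2l) B] := curve_eigenvalues (lexx 0) l0 (per r_per) (per r'_per)
  (sl_sol_r' r_gt0 dr dr' dlam) r'0 rn T20 T2T (ltW T2l) r'T2 r'TT.
by split.
Qed.

(** [R0] vanishes at 0 and at [l], where [r'] is 0 and theta is [k pi]. A zero in between comes from
    a sign change: at [T / 2] and [T] again [r' = 0], while theta lies in [(pi / 2, pi)] and in
    [(pi, 2 pi)]. *)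
Lemma eigenvalues_mode1 :
  let eig := sl_eigen (wgt N r) (wgt' N r r') (potential N r lam N%:R) l in
  (exists (c : bool -> R) (h : bool -> R -> R), injective c /\ forall b,
     [/\ c b < 0, eig (c b) (h b) & forall u, h b (- u) = h b u]) /\
  (exists (c : R) (h : R -> R),
     [/\ c < 0, eig c h & forall u, h (- u) = - h u]).
Proof.
pose R0 := rot r r' lam (fun z => sin (th z)) (fun z => cos (th z)).
have R0E := rotE r_gt0 lam_pos energy (fun z => sin (th z)) (fun z => cos (th z)).
have pi0 := pi_gt0 R.
have h00 : R0 0 = 0 by rewrite /R0 R0E r'0 th0 sin0; ring.
have hl : R0 l = 0.
  have r'l : r' l = 0.
    have := per r'_per (- l); rewrite r'_odd.
    have -> : - l + 2 * l = l by ring.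
    lra.
  rewrite /R0 R0E r'l /l th_half thT.
  have -> : m%:R * (2 * k%:R * pi / m%:R / 2) = 0 + pi *+ k :> R.
    by rewrite add0r -mulr_natl; field.
  by rewrite (alternatingn (@sinDpi R)) sin0; ring.
have hE u : - R0 u = r u / rho r u * (lam u * sin (th u) + r' u * cos (th u)).
  by rewrite /R0 R0E mulNr opprK.
have rr u : 0 < r u / rho r u by rewrite divr_gt0.
have thT2 : th (T / 2) = th T / 2 by have := th_half 1; rewrite !mul1r.
have hT2 : 0 < - R0 (T / 2).
  rewrite hE r'T2 mul0r addr0 mulr_gt0// mulr_gt0 ?lam_pos//.
  rewrite thT2 sin_gt0_pi//; have := pi_lt_rotation; have := rotation_lt_2pi.
  by move=> H1 H2; apply/andP; split; lra.
have hT : 0 < R0 T.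
  have r'TT : r' T = 0 by rewrite -[T]add0r r'_per r'0.
  rewrite -[R0 T]opprK hE r'TT mul0r addr0 oppr_gt0 pmulr_rlt0//.
  rewrite pmulr_rlt0 ?lam_pos//.
  have := sinDpi (th T - pi); rewrite subrK => ->; rewrite oppr_lt0 sin_gt0_pi//.
  have := pi_lt_rotation; have := rotation_lt_2pi.
  by move=> H1 H2; apply/andP; split; lra.
have sol := sl_sol_rot r_gt0 lam_pos dr dr' dlam energy dsin dcos.
have cR0 x : T / 2 <= x <= T -> {for x, continuous R0}.
  by move=> _; exact: (der_continuous (proj1 (sol x))).
have sg : R0 (T / 2) <= 0 <= R0 T by apply/andP; split; [move: hT2|move: hT]; lra.
have T2T : T / 2 <= T by move: T0; lra.
have [u1 /andP[u1T u1T'] hu1] := IVT_cont T2T cR0 sg.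
have u10 : 0 < u1 by exact: lt_le_trans u1T.
have u1l : u1 < l by exact: le_lt_trans T2l.
have hn0 : exists u, R0 u != 0 by exists T; rewrite gt_eqF.
by have [A B _] := curve_eigenvalues (ler0n _ N) l0 (per r_per) (per r'_per)
  sol h00 hn0 u10 u1l (lexx l) hu1 hl.
Qed.

End Closed.

End RotationNumber.

(** * Euclidean space and stereographic charts *)

Section DotProduct.
Context {R : realType} {d : nat}.
Implicit Types (u v w : 'rV[R]_d) (c : R).

Lemma dotC v w : dot v w = dot w v.
Proof. by apply: eq_bigr => i _; rewrite mulrC. Qed.

Lemma dotDl u v w : dot (u + v) w = dot u w + dot v w.
Proof. by rewrite /dot -big_split/=; apply: eq_bigr => i _; rewrite mxE mulrDl. Qed.

Lemma dotDr u v w : dot u (v + w) = dot u v + dot u w.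
Proof. by rewrite dotC dotDl !(dotC u). Qed.

Lemma dotZl c v w : dot (c *: v) w = c * dot v w.
Proof. by rewrite /dot mulr_sumr; apply: eq_bigr => i _; rewrite mxE mulrA. Qed.

Lemma dotZr c v w : dot v (c *: w) = c * dot v w.
Proof. by rewrite dotC dotZl dotC. Qed.

Lemma dotNl v w : dot (- v) w = - dot v w.
Proof. by rewrite -scaleN1r dotZl mulN1r. Qed.

Lemma dotNr v w : dot v (- w) = - dot v w.
Proof. by rewrite dotC dotNl dotC. Qed.

Lemma dot_comb (a b a' b' : R) u v v' :
  dot (a *: u + b *: v) (a' *: u + b' *: v') =
  a * a' * dot u u + a * b' * dot u v' + b * a' * dot u v + b * b' * dot v v'.
Proof. by rewrite !(dotDl, dotDr, dotZl, dotZr) [dot v u]dotC; ring. Qed.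

Lemma dot_scale_comb (c a b : R) u v :
  dot (c *: u) (a *: u + b *: v) = c * a * dot u u + c * b * dot u v.
Proof. by rewrite !(dotDr, dotZl, dotZr); ring. Qed.

Lemma dot_delta v i : dot v (delta_mx 0 i) = v 0 i.
Proof.
rewrite /dot (bigD1 i)//= big1 ?addr0 => [|j ji]; first by rewrite mxE !eqxx mulr1.
by rewrite mxE (negbTE ji) andbF mulr0.
Qed.

Lemma dot0l v : dot 0 v = 0.
Proof. by rewrite -(scale0r v) dotZl mul0r. Qed.

Lemma dot0r v : dot v 0 = 0.
Proof. by rewrite dotC dot0l. Qed.

Lemma dot_mul v w : dot v w = (v *m w^T) 0 0.
Proof. by rewrite mxE; apply: eq_bigr => i _; rewrite mxE. Qed.

Lemma dot_ge0 v : 0 <= dot v v.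
Proof. by apply: sumr_ge0 => i _; rewrite -expr2 sqr_ge0. Qed.

End DotProduct.

(** * Partial derivatives in coordinates *)

Section PartialDerivatives.
Context {R : realType} {n : nat}.
Implicit Types (x v : 'rV[R]_n) (i j : 'I_n).

Lemma delta_rowE i j : (delta_mx 0 i : 'rV[R]_n) 0 j = (i == j)%:R.
Proof. by rewrite mxE eqxx eq_sym. Qed.

Lemma der_coord x i j : is_derive x (delta_mx 0 i) (fun z : 'rV[R]_n => z 0 j) ((i == j)%:R : R).
Proof.
apply/der_line; rewrite (_ : (fun t : R => _) = fun t : R => t * (i == j)%:R + x 0 j).
  have H := der_add (der_mul (der_id (0 : R)) (der_cst (i == j)%:R _ _)) (der_cst (x 0 j) _ _).
  by apply: der_eq H _; rewrite mul1r mulr0 !addr0.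
by apply/funext => t; rewrite mxE [X in X + _]mxE delta_rowE.
Qed.

Lemma der_coord_comp (f : R -> R) (x : 'rV[R]_n) i j a : is_derive (x 0 j) 1 f a ->
  is_derive x (delta_mx 0 i) (fun z => f (z 0 j)) ((i == j)%:R * a).
Proof.
by move=> fa; rewrite mulrC; exact: (@der_comp _ _ f (fun z : 'rV[R]_n => z 0 j) x _ _ _ fa (der_coord x i j)).
Qed.

Lemma der_vec m (X : 'rV[R]_n -> 'rV[R]_m) (dX : 'rV[R]_m) x v :
  (forall j : 'I_m, is_derive x v (fun z => X z 0 j) (dX 0 j)) -> is_derive x v X dX.
Proof.
move=> H; have dble : derivable X x v.
  by apply/derivable_mxP => i j; rewrite (ord1 i); case: (H j).
apply: DeriveDef => //; rewrite (derive_mx dble); apply/rowP => j.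
by rewrite mxE; case: (H j).
Qed.

Lemma der_vec_coord m (X : 'rV[R]_n -> 'rV[R]_m) (dX : 'rV[R]_m) x v (j : 'I_m) :
  is_derive x v X dX -> is_derive x v (fun z => X z 0 j) (dX 0 j).
Proof.
move=> [dble <-]; rewrite (derive_mx dble) mxE; apply/derivableP.
by move/derivable_mxP : dble.
Qed.

Lemma pderivE (V : normedModType R) i (f : 'rV[R]_n -> V) x a :
  is_derive x (delta_mx 0 i) f a -> pderiv i f x = a.
Proof. by case. Qed.

(** Existence of a derivative without a formula. It serves for the unit normal, built from
    determinants, whose derivative is identified only afterwards. *)
Definition dble x v (f : 'rV[R]_n -> R) := exists a, is_derive x v f a.

Lemma dble_bigsum (I : Type) (s : seq I) (F : I -> 'rV[R]_n -> R) x v :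
  (forall i : I, dble x v (F i)) -> dble x v (fun z => \sum_(i <- s) F i z).
Proof.
move=> H; elim: s => [|i s [b IH]].
  by exists 0; apply: der_ext (der_cst 0 x v) => z; rewrite big_nil.
have [a Ha] := H i; exists (a + b); apply: der_ext (der_add Ha IH) => z.
by rewrite big_cons.
Qed.

Lemma dble_bigprod (I : Type) (s : seq I) (F : I -> 'rV[R]_n -> R) x v :
  (forall i : I, dble x v (F i)) -> dble x v (fun z => \prod_(i <- s) F i z).
Proof.
move=> H; elim: s => [|i s [b IH]].
  by exists 0; apply: der_ext (der_cst 1 x v) => z; rewrite big_nil.
have [a Ha] := H i; eexists; apply: der_ext (der_mul Ha IH) => z.
by rewrite big_cons.
Qed.

Lemma dble_det m (A : 'rV[R]_n -> 'M[R]_m) x v :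
  (forall i j : 'I_m, dble x v (fun z => A z i j)) -> dble x v (fun z => \det (A z)).
Proof.
move=> H; apply: dble_bigsum => s.
have [a Ha] : dble x v (fun z => \prod_(i < m) A z i (perm.fun_of_perm s i)).
  by apply: dble_bigprod => i; exact: H.
by eexists; exact: der_mulc Ha.
Qed.

End PartialDerivatives.

Section Embedding.
Context {R : realType} {n : nat}.

Definition emb (v : 'rV[R]_n) (a b : R) : 'rV[R]_n.+2 :=
  castmx (erefl, addn2 n) (row_mx v (\row_(j < 2) (if j == 0 then a else b))).

Let split_l (i : 'I_n) : fintype.split (lshift 2 i) = inl i := unsplitK (inl i).
Let split_r (k : 'I_2) : fintype.split (rshift n k) = inr k := unsplitK (inr k).

Lemma embE v a b (j : 'I_n.+2) : emb v a b 0 j =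
  match fintype.split (cast_ord (esym (addn2 n)) j) with
  | inl i => v 0 i
  | inr k => if k == 0 then a else b
  end.
Proof.
rewrite /emb castmxE mxE cast_ord_id; case: fintype.split => // k.
by rewrite mxE.
Qed.

Lemma dot_emb v a b v' a' b' :
  dot (emb v a b) (emb v' a' b') = dot v v' + a * a' + b * b'.
Proof.
rewrite /dot.
rewrite (reindex (cast_ord (addn2 n))) /=; last first.
  by exists (cast_ord (esym (addn2 n))) => i _; rewrite ?cast_ordK ?cast_ordKV.
rewrite big_split_ord /= -addrA; congr (_ + _).
  by apply: eq_bigr => i _; rewrite !embE cast_ordK split_l.
by rewrite !big_ord_recl big_ord0 addr0 !embE !cast_ordK !split_r.
Qed.

Lemma emb_scale c v a b : c *: emb v a b = emb (c *: v) (c * a) (c * b).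
Proof.
apply/rowP => j; rewrite mxE !embE; case: fintype.split => [i|k]; first by rewrite mxE.
by case: ifP.
Qed.

Lemma der_emb d (x v : 'rV[R]_d) (Y : 'rV[R]_d -> 'rV[R]_n) (a b : 'rV[R]_d -> R)
    (dY : 'rV[R]_n) (da db : R) :
  (forall j, is_derive x v (fun z => Y z 0 j) (dY 0 j)) -> is_derive x v a da ->
  is_derive x v b db ->
  is_derive x v (fun z => emb (Y z) (a z) (b z)) (emb dY da db).
Proof.
move=> HY Ha Hb; apply: der_vec => j.
rewrite embE; rewrite (_ : (fun z => _) = fun z =>
    match fintype.split (cast_ord (esym (addn2 n)) j) with
    | inl i => Y z 0 i | inr k => if k == 0 then a z else b z end); last first.
  by apply/funext => z; rewrite embE.
by case: fintype.split => // k; case: ifP.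
Qed.

End Embedding.

Section Stereographic.
Context {R : realType} {n : nat}.
Variable ch : 'I_n * bool.
Implicit Types (x : 'rV[R]_n) (i j : 'I_n).

Let z x := equator ch x.
Let q x := dot (z x) (z x).
Let P : 'rV[R]_n := pole ch.

(** Conformal factor of the inverse stereographic projection. *)
Definition conf x : R := 2 / (q x + 1).

Lemma equatorE x j : equator ch x 0 j = x 0 j * (j != ch.1)%:R.
Proof.
rewrite /equator !mxE eqxx andTb; case: eqP => [->|_]; rewrite ?mulr1 ?mulr0 ?subr0//.
by rewrite subrr.
Qed.

Let q0 x : 0 < q x + 1. Proof. by rewrite ltr_wpDl// dot_ge0. Qed.

Lemma conf_gt0 x : 0 < conf x. Proof. by rewrite divr_gt0. Qed.

Lemma conf_neq0 x : conf x != 0. Proof. by rewrite gt_eqF// conf_gt0. Qed.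

Lemma conf_eq x : conf x * (q x + 1) = 2.
Proof. by rewrite divfK// gt_eqF. Qed.

Lemma stereo_vecE x : stereo_vec ch x = conf x *: z x + (1 - conf x) *: P.
Proof.
rewrite /stereo_vec -/(z x) -/(q x) -/P scalerDr !scalerA /conf.
congr (_ *: _ + _ *: _); first by rewrite mulrC.
by field; rewrite gt_eqF.
Qed.

Lemma stereo_vec_coord x j :
  stereo_vec ch x 0 j = conf x * z x 0 j + (1 - conf x) * P 0 j.
Proof. by rewrite stereo_vecE mxE [X in X + _]mxE [X in _ + X]mxE. Qed.

Lemma dot_equator_pole x : dot (z x) P = 0.
Proof. by rewrite /P /pole dotZr dot_delta equatorE eqxx mulr0 mulr0. Qed.

Lemma dot_pole : dot P P = 1.
Proof.
rewrite /P /pole dotZl dotZr dot_delta mxE !eqxx mulr1 -expr2 sqrr_sign//.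
Qed.

Lemma der_equator x i j : is_derive x (delta_mx 0 i) (fun x => z x 0 j : R)
  ((i == j)%:R * (i != ch.1)%:R).
Proof.
apply: (@der_ext _ _ (fun x : 'rV[R]_n => x 0 j * (j != ch.1)%:R)) => [x'|].
  by rewrite /z equatorE.
apply: der_eq (der_mul (der_coord x i j) (der_cst _ _ _)) _.
by rewrite mulr0 addr0; case: (eqVneq i j) => [->//|_]; rewrite !mul0r.
Qed.

Lemma der_sqnorm x i : is_derive x (delta_mx 0 i) q (2 * z x 0 i).
Proof.
apply: der_eq (der_sum (fun j => der_mul (der_equator x i j) (der_equator x i j))) _.
rewrite (bigD1 i)//= big1 ?addr0 => [|j ji]; last first.
  by rewrite eq_sym (negbTE ji) !mul0r mulr0 addr0.
rewrite eqxx /z equatorE; case: (_ != _) => /=; ring.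
Qed.

Lemma der_conf x i : is_derive x (delta_mx 0 i) conf (- (conf x ^+ 2 * z x 0 i)).
Proof.
have n0 : q x + 1 != 0 by rewrite gt_eqF.
apply: der_eq (der_mulc 2 (@der_comp _ _ (fun t => t^-1) (fun x => q x + 1) x _ _ _
  (der_inv_at n0) (der_add (der_sqnorm x i) (der_cst 1 _ _)))) _.
by rewrite /conf; field.
Qed.

Definition dstereo i x : 'rV[R]_n :=
  (conf x * (i != ch.1)%:R) *: delta_mx 0 i + (conf x ^+ 2 * z x 0 i) *: (P - z x).

Lemma dstereoE i j x : dstereo i x 0 j =
  conf x * ((i == j)%:R * (i != ch.1)%:R) + conf x ^+ 2 * z x 0 i * (P 0 j - z x 0 j).
Proof. by rewrite !mxE eqxx/= [j == i]eq_sym; ring. Qed.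

Lemma dstereo_axis x : dstereo ch.1 x = 0.
Proof. by rewrite /dstereo eqxx mulr0 scale0r add0r /z equatorE eqxx !mulr0 scale0r. Qed.

Lemma der_stereo x i j : is_derive x (delta_mx 0 i) (fun x => stereo_vec ch x 0 j)
  (dstereo i x 0 j).
Proof.
apply: (@der_ext _ _ (fun x => conf x * z x 0 j + (1 - conf x) * P 0 j)) => [x'|].
  by rewrite stereo_vecE !mxE.
apply: der_eq (der_add (der_mul (der_conf x i) (der_equator x i j))
  (der_mul (der_sub (der_cst 1 _ _) (der_conf x i)) (der_cst (P 0 j) _ _))) _.
by rewrite dstereoE; ring.
Qed.

Lemma dot_stereo x : dot (stereo_vec ch x) (stereo_vec ch x) = 1.
Proof. exact/eqP/stereo_subproof. Qed.

Let dot_delta_z i x : dot (z x) (delta_mx 0 i) = z x 0 i. Proof. exact: dot_delta. Qed.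

Let dot_delta_pole i : i != ch.1 -> dot P (delta_mx 0 i) = 0.
Proof. by move=> ii; rewrite dot_delta /P /pole !mxE (negbTE ii) andbF mulr0. Qed.

Let dot_combo (e f Z Q : 'rV[R]_n) (a b c d : R) :
  dot Z Q = 0 -> dot Q Q = 1 -> dot Q e = 0 -> dot Q f = 0 ->
  dot (a *: e + b *: (Q - Z)) (c *: f + d *: (Q - Z)) =
  a * c * dot e f - a * d * dot Z e - b * c * dot Z f + b * d * (1 + dot Z Z).
Proof.
move=> ZQ QQ Qe Qf; rewrite !(dotDl, dotDr, dotZl, dotZr, dotNl, dotNr).
by rewrite [dot e Q]dotC [dot e Z]dotC [dot Q Z]dotC ZQ QQ Qe Qf; ring.
Qed.

Let dot_combo' (e Z Q : 'rV[R]_n) (a b c d : R) :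
  dot Z Q = 0 -> dot Q Q = 1 -> dot Q e = 0 ->
  dot (c *: Z + d *: Q) (a *: e + b *: (Q - Z)) =
  c * a * dot Z e - c * b * dot Z Z + d * b.
Proof.
move=> ZQ QQ Qe; rewrite !(dotDl, dotDr, dotZl, dotZr, dotNl, dotNr).
by rewrite [dot Q Z]dotC ZQ QQ Qe; ring.
Qed.

Lemma dot_dstereo x i j : dot (dstereo i x) (dstereo j x) =
  conf x ^+ 2 * ((i == j)%:R * (i != ch.1)%:R).
Proof.
have /orP[/eqP->|ii] := orbN (i == ch.1).
  by rewrite dstereo_axis dot0l eqxx !mulr0.
have /orP[/eqP->|jj] := orbN (j == ch.1).
  by rewrite dstereo_axis dot0r (negbTE ii) mul0r mulr0.
rewrite /dstereo ii jj !mulr1.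
rewrite dot_combo ?dot_equator_pole ?dot_pole ?dot_delta_pole// !dot_delta_z.
rewrite [dot (delta_mx 0 i) _]dot_delta delta_rowE -/(q x).
have -> : q x = 2 / conf x - 1 by rewrite -(conf_eq x); field; exact: conf_neq0.
by field; exact: conf_neq0.
Qed.

Lemma dot_stereo_dstereo x i : dot (stereo_vec ch x) (dstereo i x) = 0.
Proof.
have /orP[/eqP->|ii] := orbN (i == ch.1).
  by rewrite dstereo_axis dot0r.
rewrite stereo_vecE /dstereo ii mulr1.
rewrite dot_combo' ?dot_equator_pole ?dot_pole ?dot_delta_pole// !dot_delta_z -/(q x).
have -> : q x = 2 / conf x - 1 by rewrite -(conf_eq x); field; exact: conf_neq0.
by field; exact: conf_neq0.
Qed.

Let pow_conf x : (1 < n)%N -> exists2 k, n.-1 = k.+1 & conf x ^+ n = conf x ^+ k.+2.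
Proof.
move=> n1; exists n.-2; first by rewrite -[n.-2]/(n.-1.-1) prednK// -ltnS prednK// ltnW.
by congr (_ ^+ _); rewrite -[n.-2]/(n.-1.-1) !prednK// ?(ltnW n1)// -ltnS prednK// ltnW.
Qed.

(* The coordinate functions are eigenfunctions of the Laplacian of the round
   metric [conf ^ 2 * dz^2], with eigenvalue [n - 1]. *)
Definition d2stereo i j x : R :=
  - (n.-1%:R - 1) * conf x ^+ n.-1 * z x 0 i * (i == j)%:R
  - n.-1%:R * conf x ^+ n * z x 0 i ^+ 2 * (P 0 j - z x 0 j)
  + conf x ^+ n.-1 * (P 0 j - z x 0 j) - conf x ^+ n.-1 * z x 0 i * (i == j)%:R.

(** [conf ^ n.-1] is the volume density and [conf ^ -2] the inverse metric of the round S^(n-1) in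
    the chart: these are the terms of its Laplacian in divergence form. *)
Lemma der_dstereo x i j : (1 < n)%N -> i != ch.1 -> is_derive x (delta_mx 0 i)
  (fun x => conf x ^+ n.-1 / conf x ^+ 2 * dstereo i x 0 j) (d2stereo i j x).
Proof.
move=> n1 ii.
apply: (@der_ext _ _ (fun x => conf x ^+ n.-1 * ((conf x)^-1 * (i == j)%:R +
    z x 0 i * (P 0 j - z x 0 j)))) => [x'|].
  by rewrite dstereoE ii mulr1; field; exact: conf_neq0.
have dcV : is_derive x (delta_mx 0 i) (fun x => (conf x)^-1) (z x 0 i).
  apply: der_eq (@der_comp _ _ (fun t => t^-1) conf x _ _ _ (der_inv_at (conf_neq0 x))
    (der_conf x i)) _.
  by field; exact: conf_neq0.
apply: der_eq (der_mul (der_exp n.-1 (der_conf x i)) (der_add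
  (der_mul dcV (der_cst (i == j)%:R _ _)) (der_mul (der_equator x i i)
    (der_sub (der_cst (P 0 j) _ _) (der_equator x i j))))) _.
rewrite /d2stereo ii eqxx; have [k -> ->] := pow_conf x n1.
by rewrite /= !exprS; field; exact: conf_neq0.
Qed.

Lemma sum_d2stereo x j : (1 < n)%N -> \sum_(i | i != ch.1) d2stereo i j x =
  - n.-1%:R * conf x ^+ n.-1 * stereo_vec ch x 0 j.
Proof.
move=> n1; pose A := P 0 j - z x 0 j.
rewrite (eq_bigr (fun i => - (n.-1%:R * conf x ^+ n.-1) * (z x 0 i * (i == j)%:R) +
   (- (n.-1%:R * conf x ^+ n * A) * z x 0 i ^+ 2 + conf x ^+ n.-1 * A))); last first.
  by move=> i _; rewrite /d2stereo -/A; ring.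
rewrite !big_split/= -!mulr_sumr.
have -> : \sum_(i | i != ch.1) z x 0 i * (i == j)%:R = z x 0 j.
  have [jj|jj] := eqVneq j ch.1.
    rewrite jj big1 => [|i /negbTE ->]; last by rewrite mulr0.
    by rewrite /z equatorE eqxx mulr0.
  rewrite (bigD1 j)//= eqxx mulr1 big1 ?addr0// => i /andP[_ /negbTE ->].
  by rewrite mulr0.
have -> : \sum_(i | i != ch.1) z x 0 i ^+ 2 = q x.
  rewrite /q /dot [in RHS](bigD1 ch.1)//= {1}/z equatorE eqxx mulr0 mul0r add0r.
  by apply: eq_bigr => i _; rewrite expr2.
rewrite sumr_const cardC1 card_ord stereo_vec_coord.
have -> : q x = 2 / conf x - 1 by rewrite -(conf_eq x); field; exact: conf_neq0.
rewrite -(mulr_natl A) /A; have [k -> ->] := pow_conf x n1.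
by rewrite /= !exprS; field; exact: conf_neq0.
Qed.

End Stereographic.

(** * The Jacobi operator *)

Section Immersion.
Context {R : realType}.
Variables (N : nat) (r r' lam th : R -> R).
Hypothesis N0 : (0 < N)%N.
Hypothesis r_gt0 : forall u, 0 < r u.
Hypothesis lam_gt0 : forall u, 0 < lam u.
Hypothesis dr : forall u : R, is_derive u 1 r (r' u).
Hypothesis dr' : forall u : R, is_derive u 1 r' (- r u + N%:R * lam u ^+ 2 * r u).
Hypothesis dlam : forall u : R, is_derive u 1 lam (- (N.+1%:R * lam u * r' u / r u)).
Hypothesis energy : forall u, r' u ^+ 2 + r u ^+ 2 * lam u ^+ 2 + r u ^+ 2 = 1.
Hypothesis dth : forall u : R, is_derive u 1 th (r u * lam u * (rho r u)^-1 ^+ 2).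

Let n := N.+1.
Variable ch : 'I_n * bool.
Implicit Types (x : 'rV[R]_n) (i j : 'I_n).

Let ax : 'I_n := ch.1.
Let co u := cos (th u).
Let si u := sin (th u).
Let msi u := - sin (th u).
Let y x : 'rV[R]_n := stereo_vec ch x.
Let dy i x : 'rV[R]_n := dstereo ch i x.

Definition immersion x : 'rV[R]_n.+2 :=
  emb (r (x 0 ax) *: y x) (rho r (x 0 ax) * co (x 0 ax)) (rho r (x 0 ax) * si (x 0 ax)).

Let dco (u : R) : is_derive u 1 co (r u * lam u * (rho r u)^-1 ^+ 2 * msi u).
Proof. by rewrite mulrC; exact: (@der_comp _ _ cos th) (is_derive_cos _) (dth u). Qed.

Let dmsi (u : R) : is_derive u 1 msi (- (r u * lam u * (rho r u)^-1 ^+ 2 * co u)).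
Proof.
apply: der_opp; rewrite mulrC.
exact: (@der_comp _ _ sin th) (is_derive_sin _) (dth u).
Qed.

Let dsi (u : R) : is_derive u 1 si (r u * lam u * (rho r u)^-1 ^+ 2 * co u).
Proof. by rewrite mulrC; exact: (@der_comp _ _ sin th) (is_derive_sin _) (dth u). Qed.

Let dco' (u : R) : is_derive u 1 co (- (r u * lam u * (rho r u)^-1 ^+ 2 * si u)).
Proof. by apply: der_eq (dco u) _; rewrite /msi mulrN. Qed.

Let tg1 := tgt r r' lam co msi.
Let tg2 := tgt r r' lam si co.
Let nr1 := nrm r r' lam co msi.
Let nr2 := nrm r r' lam si co.

Definition tangent i x : 'rV[R]_n.+2 :=
  emb (((i == ax)%:R * r' (x 0 ax)) *: y x + r (x 0 ax) *: dy i x)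
    ((i == ax)%:R * tg1 (x 0 ax)) ((i == ax)%:R * tg2 (x 0 ax)).

Definition normal x : 'rV[R]_n.+2 :=
  emb ((r (x 0 ax) * lam (x 0 ax)) *: y x) (nr1 (x 0 ax)) (nr2 (x 0 ax)).

Lemma der_immersion i x : is_derive x (delta_mx 0 i) immersion (tangent i x).
Proof.
apply: der_emb => [j||].
- apply: (@der_ext _ _ (fun x => r (x 0 ax) * y x 0 j)) => [x'|]; first by rewrite [RHS]mxE.
  apply: der_eq (der_mul (der_coord_comp i (dr (x 0 ax))) (der_stereo ch x i j)) _.
  by rewrite [RHS]mxE [X in _ = X + _]mxE [X in _ = _ + X]mxE.
- exact: (der_coord_comp i (dpos r_gt0 lam_gt0 dr energy dco (x 0 ax))).
- exact: (der_coord_comp i (dpos r_gt0 lam_gt0 dr energy dsi (x 0 ax))).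
Qed.

(** Factors by which the differential of [normal] stretches the coordinate directions: the principal
    curvatures up to the choice of the sign of the normal. *)
Definition kappa i x : R := if i == ax then - (N%:R * lam (x 0 ax)) else lam (x 0 ax).

Lemma der_normal i x : is_derive x (delta_mx 0 i) normal (kappa i x *: tangent i x).
Proof.
rewrite /tangent emb_scale; apply: der_emb => [j||].
- apply: (@der_ext _ _ (fun x => r (x 0 ax) * lam (x 0 ax) * y x 0 j)) => [x'|].
    by rewrite [RHS]mxE.
  have drl : is_derive (x 0 ax) 1 (fun u => r u * lam u) (- (N%:R * lam (x 0 ax) * r' (x 0 ax))).
    apply: der_eq (der_mul (dr _) (dlam _)) _.
    by rewrite -natr1; field; rewrite gt_eqF.
  apply: der_eq (der_mul (der_coord_comp i drl) (der_stereo ch x i j)) _.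
  rewrite [RHS]mxE [X in _ = _ * X]mxE [X in _ = _ * (X + _)]mxE [X in _ = _ * (_ + X)]mxE.
  rewrite -/(dy i x) -/(y x) /kappa; case: eqVneq => [->|_] /=; last by rewrite mulr0n; ring.
  have -> : dy ax x 0 j = 0 by rewrite /dy dstereo_axis mxE.
  by ring.
- apply: der_eq (der_coord_comp i (dnrm r_gt0 lam_gt0 dr dr' dlam energy dco dmsi (x 0 ax))) _.
  by rewrite /kappa -/tg1; case: eqVneq => _; rewrite ?mul0r ?mulr0// !mul1r mulNr.
- apply: der_eq (der_coord_comp i (dnrm r_gt0 lam_gt0 dr dr' dlam energy dsi dco' (x 0 ax))) _.
  by rewrite /kappa -/tg2; case: eqVneq => _; rewrite ?mul0r ?mulr0// !mul1r mulNr.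
Qed.

Let cs2 u : co u ^+ 2 + si u ^+ 2 = 1 := cos2Dsin2 (th u).

Lemma tgt_sq u : tg1 u ^+ 2 + tg2 u ^+ 2 = 1 - r' u ^+ 2.
Proof.
rewrite /tg1 /tg2 /tgt /msi -/(si u).
have := rhoV2 r_gt0 lam_gt0 energy u; move: (rho r u)^-1 => i E1.
have E2 := energy u; have E3 := cs2 u.
transitivity (i ^+ 2 * (r u ^+ 2 * r' u ^+ 2 + r u ^+ 2 * lam u ^+ 2) *
  (co u ^+ 2 + si u ^+ 2)); first by ring.
rewrite E3 mulr1.
have -> : r u ^+ 2 * lam u ^+ 2 = 1 - r' u ^+ 2 - r u ^+ 2 by rewrite -E2; ring.
transitivity (i ^+ 2 * (1 - r u ^+ 2) * (1 - r' u ^+ 2)); first by ring.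
by rewrite E1 mul1r.
Qed.

Lemma nrm_sq u : nr1 u ^+ 2 + nr2 u ^+ 2 = 1 - (r u * lam u) ^+ 2.
Proof.
rewrite /nr1 /nr2 /nrm /msi -/(si u).
have := rhoV2 r_gt0 lam_gt0 energy u; move: (rho r u)^-1 => i E1.
have E2 := energy u; have E3 := cs2 u.
transitivity (i ^+ 2 * (r u ^+ 2 * (r u ^+ 2 * lam u ^+ 2) + r' u ^+ 2) *
  (co u ^+ 2 + si u ^+ 2)); first by ring.
rewrite E3 mulr1.
have -> : r' u ^+ 2 = 1 - r u ^+ 2 * lam u ^+ 2 - r u ^+ 2 by rewrite -E2; ring.
transitivity (i ^+ 2 * (1 - r u ^+ 2) * (1 - r u ^+ 2 * lam u ^+ 2)); first by ring.
by rewrite E1 mul1r; ring.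
Qed.

Lemma pos_nrm u : rho r u * co u * nr1 u + rho r u * si u * nr2 u = - (r u ^+ 2 * lam u).
Proof.
rewrite /nr1 /nr2 /nrm /msi -/(si u).
have rn := rho_neq0 r_gt0 lam_gt0 energy u.
transitivity (- (r u ^+ 2 * lam u) * (co u ^+ 2 + si u ^+ 2)); first by field.
by rewrite cs2 mulr1.
Qed.

Lemma pos_tgt u : rho r u * co u * tg1 u + rho r u * si u * tg2 u = - (r u * r' u).
Proof.
rewrite /tg1 /tg2 /tgt /msi -/(si u).
have rn := rho_neq0 r_gt0 lam_gt0 energy u.
transitivity (- (r u * r' u) * (co u ^+ 2 + si u ^+ 2)); first by field.
by rewrite cs2 mulr1.
Qed.

Lemma tgt_nrm u : tg1 u * nr1 u + tg2 u * nr2 u = - (r u * lam u * r' u).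
Proof.
rewrite /tg1 /tg2 /nr1 /nr2 /tgt /nrm /msi -/(si u).
have := rhoV2 r_gt0 lam_gt0 energy u; move: (rho r u)^-1 => i E1.
transitivity (- (r u * lam u * r' u) * (i ^+ 2 * (1 - r u ^+ 2)) * (co u ^+ 2 + si u ^+ 2)).
  by ring.
by rewrite E1 cs2 !mulr1.
Qed.

Definition metric_coef i x : R :=
  if i == ax then 1 else (r (x 0 ax) * conf ch x) ^+ 2.

Lemma dot_tangent i j x : dot (tangent i x) (tangent j x) = (i == j)%:R * metric_coef i x.
Proof.
rewrite /tangent dot_emb dot_comb !dot_stereo_dstereo dot_stereo dot_dstereo.
have E := tgt_sq (x 0 ax); rewrite /metric_coef.
case: (eqVneq i j) => [<-|ij]; last first.
  have [ia|ia] := eqVneq i ax; last by rewrite /= ?mulr0n; ring.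
  have [ja|ja] := eqVneq j ax; last by rewrite /= ?mulr0n; ring.
  by rewrite ia ja eqxx in ij.
rewrite -/ax; case: eqVneq => _; last by rewrite /= ?mulr0n; ring.
rewrite /= ?mulr0n ?mulr1n.
transitivity (r' (x 0 ax) ^+ 2 + (tg1 (x 0 ax) ^+ 2 + tg2 (x 0 ax) ^+ 2)); first by ring.
by rewrite E; ring.
Qed.

Lemma dot_normal x : dot (normal x) (normal x) = 1.
Proof.
rewrite /normal dot_emb dotZl dotZr dot_stereo.
transitivity ((r (x 0 ax) * lam (x 0 ax)) ^+ 2 + (nr1 (x 0 ax) ^+ 2 + nr2 (x 0 ax) ^+ 2)).
  by ring.
by rewrite nrm_sq; ring.
Qed.

Lemma dot_normal_immersion x : dot (normal x) (immersion x) = 0.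
Proof.
rewrite /normal /immersion dot_emb dotZl dotZr dot_stereo.
transitivity (r (x 0 ax) ^+ 2 * lam (x 0 ax) + (rho r (x 0 ax) * co (x 0 ax) * nr1 (x 0 ax) +
  rho r (x 0 ax) * si (x 0 ax) * nr2 (x 0 ax))); first by ring.
by rewrite pos_nrm subrr.
Qed.

Lemma dot_normal_tangent i x : dot (normal x) (tangent i x) = 0.
Proof.
rewrite /normal /tangent dot_emb dot_scale_comb dot_stereo dot_stereo_dstereo.
case: eqVneq => _; last by rewrite /= ?mulr0n; ring.
rewrite /= ?mulr1n.
transitivity (r (x 0 ax) * lam (x 0 ax) * r' (x 0 ax) +
  (tg1 (x 0 ax) * nr1 (x 0 ax) + tg2 (x 0 ax) * nr2 (x 0 ax))); first by ring.
by rewrite tgt_nrm subrr.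
Qed.

Lemma dot_immersion x : dot (immersion x) (immersion x) = 1.
Proof.
rewrite /immersion dot_emb dotZl dotZr dot_stereo.
have E := sqr_rho r_gt0 lam_gt0 energy (x 0 ax).
transitivity (r (x 0 ax) ^+ 2 + rho r (x 0 ax) ^+ 2 * (co (x 0 ax) ^+ 2 + si (x 0 ax) ^+ 2)).
  by ring.
by rewrite cs2 E; ring.
Qed.

Lemma dot_immersion_tangent i x : dot (immersion x) (tangent i x) = 0.
Proof.
rewrite /immersion /tangent dot_emb dot_scale_comb dot_stereo dot_stereo_dstereo.
case: eqVneq => _; last by rewrite /= ?mulr0n; ring.
rewrite /= ?mulr1n.
transitivity (r (x 0 ax) * r' (x 0 ax) + (rho r (x 0 ax) * co (x 0 ax) * tg1 (x 0 ax) +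
  rho r (x 0 ax) * si (x 0 ax) * tg2 (x 0 ax))); first by ring.
by rewrite pos_tgt subrr.
Qed.

Lemma tangentsE x : tangents immersion x = \matrix_i tangent i x.
Proof. by apply/matrixP => i j; rewrite !mxE (pderivE (der_immersion i x)). Qed.

Lemma row_tangents i x : row i (tangents immersion x) = tangent i x.
Proof. by rewrite tangentsE rowK. Qed.

Definition metric_row x : 'rV[R]_n := \row_i metric_coef i x.

Lemma metricE x : metric immersion x = diag_mx (metric_row x).
Proof.
apply/matrixP => i j; rewrite [LHS]mxE !row_tangents dot_tangent.
by rewrite !mxE; case: (i == j); rewrite ?mulr1n ?mul1r// !mulr0n mul0r.
Qed.

Lemma metric_coef_gt0 i x : 0 < metric_coef i x.
Proof.
by rewrite /metric_coef; case: ifP => // _; rewrite exprn_gt0// mulr_gt0// conf_gt0.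
Qed.

Lemma metric_coef_neq0 i x : metric_coef i x != 0.
Proof. by rewrite gt_eqF// metric_coef_gt0. Qed.

Lemma det_metric x : \det (metric immersion x) = ((r (x 0 ax) * conf ch x) ^+ N) ^+ 2.
Proof.
rewrite metricE det_diag (bigD1 ax)//= mxE {1}/metric_coef eqxx mul1r.
rewrite (eq_bigr (fun=> (r (x 0 ax) * conf ch x) ^+ 2)) => [|i ii]; last first.
  by rewrite mxE /metric_coef (negbTE ii).
by rewrite prodr_const cardC1 card_ord -!exprM mulnC.
Qed.

Lemma sqrt_det_metric x : Num.sqrt (\det (metric immersion x)) = (r (x 0 ax) * conf ch x) ^+ N.
Proof.
by rewrite det_metric sqrtr_sqr ger0_norm// exprn_ge0// mulr_ge0 ?ltW ?conf_gt0.
Qed.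

Lemma invmx_metric x : invmx (metric immersion x) = diag_mx (\row_i (metric_coef i x)^-1).
Proof.
have E : metric immersion x *m diag_mx (\row_i (metric_coef i x)^-1) = 1%:M.
  apply/matrixP => i j; rewrite metricE mul_diag_mx !mxE.
  case: eqVneq => [->|_]; last by rewrite mulr0n mulr0.
  by rewrite !mulr1n divff// metric_coef_neq0.
have [U _] := mulmx1_unit E.
by rewrite -[RHS](mulKmx U) E mulmx1.
Qed.

Let M x : 'M[R]_(n.+1, n.+2) := col_mx (immersion x) (tangents immersion x).
Let B x : 'M[R]_n.+2 := col_mx (normal x) (M x).

(** Laplace expansion along the first row, whose cofactors do not involve that row. *)
Lemma dot_cross w x : dot w (cross immersion x) = \det (col_mx w (M x) : 'M[R]_n.+2).
Proof.
have E (v : 'rV[R]_n.+2) : \det (col_mx v (M x) : 'M[R]_n.+2) =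
    \sum_k v 0 k * ((-1) ^+ (0 + k) * \det (col' k (M x))).
  rewrite (expand_det_row _ 0); apply: eq_bigr => k _; congr (_ * _).
    rewrite (_ : (0 : 'I_n.+2) = lshift n.+1 (0 : 'I_1)); last exact: val_inj.
    exact: (@col_mxEu _ 1 n.+1 n.+2 v (M x) 0 k).
  rewrite /cofactor; congr (_ * \det _); apply/matrixP => a b.
  rewrite [LHS]mxE [LHS]mxE [RHS]mxE (_ : lift 0 a = rshift 1 a); last exact: val_inj.
  exact: (@col_mxEd _ 1 n.+1 n.+2 v (M x) a (lift k b)).
rewrite E /dot; apply: eq_bigr => k _; congr (_ * _).
rewrite [LHS]mxE -/(M x) E (bigD1 k)//= mxE !eqxx mul1r big1 ?addr0// => j jk.
by rewrite mxE (negbTE jk) andbF mul0r.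
Qed.


Lemma mul_tangents_tr x : tangents immersion x *m (tangents immersion x)^T = metric immersion x.
Proof.
apply/matrixP => i j; rewrite mxE [RHS]mxE; apply: eq_bigr => k _.
by rewrite [in RHS]mxE [X in _ = _ * X]mxE [X in _ * X = _]mxE.
Qed.

Lemma metric_unit x : metric immersion x \in unitmx.
Proof.
rewrite unitmxE unitfE det_metric sqrf_eq0 expf_neq0// mulf_neq0 ?conf_neq0//.
by rewrite gt_eqF.
Qed.

Let row_dot (k : nat) (v : 'rV[R]_n.+2) (A : 'M[R]_(k, n.+2)) :
  (forall j : 'I_k, dot v (row j A) = 0) -> v *m A^T = 0.
Proof.
move=> H; apply/rowP => j; rewrite mxE [RHS]mxE -[RHS](H j).
by apply: eq_bigr => l _; rewrite [X in _ * X = _]mxE [X in _ = _ * X]mxE.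
Qed.

Let M_unit x : M x *m (M x)^T \in unitmx.
Proof.
have H : immersion x *m (tangents immersion x)^T = 0.
  by apply: row_dot => j; rewrite row_tangents dot_immersion_tangent.
have H1 : immersion x *m (immersion x)^T = 1%:M.
  by apply/matrixP => i j; rewrite !ord1 -dot_mul dot_immersion mxE.
suff : col_mx (immersion x) (tangents immersion x) *m
    (col_mx (immersion x) (tangents immersion x))^T \in unitmx by [].
rewrite tr_col_mx mul_col_row H H1 mul_tangents_tr unitmxE det_lblock det1 mul1r.
by rewrite -unitmxE metric_unit.
Qed.

Let normal_M x : normal x *m (M x)^T = 0.
Proof.
suff : normal x *m (col_mx (immersion x) (tangents immersion x))^T = 0 by [].
rewrite tr_col_mx mul_mx_row.
have -> : normal x *m (immersion x)^T = 0.
  by apply/matrixP => i j; rewrite !ord1 -dot_mul dot_normal_immersion mxE.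
have -> : normal x *m (tangents immersion x)^T = 0.
  by apply: row_dot => j; rewrite row_tangents dot_normal_tangent.
by rewrite row_mx0.
Qed.

Let normal_normal x : normal x *m (normal x)^T = 1%:M.
Proof. by apply/matrixP => i j; rewrite !ord1 -dot_mul dot_normal mxE. Qed.

(** The normal is a unit vector orthogonal to position and tangents, so the Gram matrix of the frame
    splits into 1 and the invertible Gram matrix of [M]. *)
Let B_unit x : B x \in unitmx.
Proof.
have H := normal_M x; have H1 := normal_normal x.
have : (col_mx (normal x) (M x)) *m (col_mx (normal x) (M x))^T \in unitmx.
  rewrite tr_col_mx mul_col_row H H1 unitmxE det_lblock det1 mul1r -unitmxE.
  exact: M_unit.
rewrite unitmx_mul => /andP[U _]; exact: U.
Qed.

Let delta x := \det (B x).

Let delta_neq0 x : delta x != 0.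
Proof. by rewrite -unitfE -unitmxE B_unit. Qed.

(** Against position and tangents the cross product gives a determinant with two equal rows, against
    the normal it gives [delta]; an invertible frame determines a vector from these products. *)
Lemma cross_immersion x : cross immersion x = delta x *: normal x.
Proof.
have cM : cross immersion x *m (M x)^T = 0.
  apply: row_dot => j; rewrite dotC dot_cross.
  apply: (@determinant_alternate _ _ _ (lshift n.+1 (0 : 'I_1)) (rshift 1 j)) => // b.
  rewrite (@col_mxEu _ 1 n.+1 n.+2 (row j (M x)) (M x) 0 b).
  by rewrite (@col_mxEd _ 1 n.+1 n.+2 (row j (M x)) (M x) j b) mxE.
have cN : cross immersion x *m (normal x)^T = (delta x)%:M.
  by apply/matrixP => i j; rewrite !ord1 -dot_mul dotC dot_cross mxE.
apply/eqP; rewrite -subr_eq0; apply/eqP; set v := _ - _.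
have vB : v *m (col_mx (normal x) (M x))^T = 0.
  rewrite tr_col_mx mul_mx_row /v !mulmxBl -!scalemxAl cM cN normal_M normal_normal.
  by rewrite scaler0 subrr scalemx1 subrr row_mx0.
have UB : (col_mx (normal x) (M x))^T \in unitmx by rewrite unitmx_tr; exact: B_unit.
by rewrite -(mulmxK UB v) vB mul0mx.
Qed.

(** Sign of [delta], that is, the orientation of the chart relative to [normal]. *)
Let eps x : R := (Num.sqrt (delta x ^+ 2))^-1 * delta x.

Let eps2 x : eps x ^+ 2 = 1.
Proof.
rewrite /eps sqrtr_sqr exprMn exprVn real_normK ?num_real// mulVf//.
by rewrite expf_neq0.
Qed.

Lemma unit_normalE x : unit_normal immersion x = eps x *: normal x.
Proof.
rewrite /unit_normal cross_immersion dotZl dotZr dot_normal mulr1 -expr2.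
by rewrite scalerA.
Qed.

Let dble_mul x v (f g : 'rV[R]_n -> R) : dble x v f -> dble x v g ->
  dble x v (fun z => f z * g z).
Proof. by move=> [a Ha] [b Hb]; eexists; exact: der_mul Ha Hb. Qed.

Lemma dble_tangent i x (v : 'I_n) (j : 'I_n.+2) : dble x (delta_mx 0 v) (fun z => tangent i z 0 j).
Proof.
have dye k : dble x (delta_mx 0 v) (fun z => dy i z 0 k).
  eexists; apply: (@der_ext _ _ (fun z => conf ch z * ((i == k)%:R * (i != ax)%:R) +
    conf ch z ^+ 2 * equator ch z 0 i * (pole ch 0 k - equator ch z 0 k))) => [z|].
    by rewrite /dy dstereoE.
  exact: der_add (der_mul (der_conf ch x v) (der_cst _ _ _))
    (der_mul (der_mul (der_exp 2 (der_conf ch x v)) (der_equator ch x v i))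
      (der_sub (der_cst _ _ _) (der_equator ch x v k))).
have [e eP] : exists e : 'I_n -> R, forall k,
    is_derive x (delta_mx 0 v) (fun z => dy i z 0 k) (e k).
  by have /choice[e eP] := dye; exists e.
have dt1 := der_coord_comp v (dtgt r_gt0 lam_gt0 dr dr' dlam energy dco dmsi (x 0 ax)).
have dt2 := der_coord_comp v (dtgt r_gt0 lam_gt0 dr dr' dlam energy dsi dco' (x 0 ax)).
have dY k := der_add (der_mul (der_mulc (i == ax)%:R (der_coord_comp v (dr' (x 0 ax))))
  (der_stereo ch x v k)) (der_mul (der_coord_comp v (dr (x 0 ax))) (eP k)).
have [D HD] : exists D : 'I_n -> R, forall k, is_derive x (delta_mx 0 v)
    (fun z => (i == ax)%:R * r' (z 0 ax) * y z 0 k + r (z 0 ax) * dy i z 0 k) (D k).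
  by eexists => k; exact: dY k.
eexists; apply: der_vec_coord; apply: (@der_emb _ _ _ _ _ _ _ _ (\row_k D k) _ _ _
  (der_mulc (i == ax)%:R dt1) (der_mulc (i == ax)%:R dt2)) => k.
have -> : (\row_k D k) 0 k = D k by rewrite mxE.
apply: der_ext (HD k) => z.
by rewrite [RHS]mxE [X in _ = X + _]mxE [X in _ = _ + X]mxE.
Qed.

Lemma dble_cross i x (j : 'I_n.+2) : dble x (delta_mx 0 i) (fun z => cross immersion z 0 j).
Proof.
have [a Ha] : dble x (delta_mx 0 i) (fun z => \det (col_mx (delta_mx 0 j : 'rV_n.+2) (M z) : 'M[R]_n.+2)).
  apply: dble_det => p q; rewrite -[p]/(p : 'I_(1 + n.+1)).
  have [k pk|k pk] := @fintype.splitP 1 n.+1 p.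
    exists 0; apply: (@der_ext _ _ (fun=> (delta_mx 0 j : 'rV[R]_n.+2) 0 q)) (der_cst _ _ _) => z.
    have -> : p = lshift n.+1 k by exact: val_inj.
    by rewrite (@col_mxEu _ 1 n.+1 n.+2 _ (M z) k q) ord1.
  have pE : p = rshift 1 k by exact: val_inj.
  have [l kl|l kl] := @fintype.splitP 1 n k.
    exists (tangent i x 0 q).
    apply: (@der_ext _ _ (fun z => immersion z 0 q)) (der_vec_coord q (der_immersion i x)) => z.
    rewrite pE (@col_mxEd _ 1 n.+1 n.+2 _ (M z) k q).
    have -> : k = lshift n l by exact: val_inj.
    by rewrite (@col_mxEu _ 1 n n.+2 _ _ l q) ord1.
  have [a Ha] := dble_tangent l x i q; exists a.
  apply: (@der_ext _ _ (fun z => tangent l z 0 q)) Ha => z.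
  rewrite pE (@col_mxEd _ 1 n.+1 n.+2 _ (M z) k q).
  have -> : k = rshift 1 l by exact: val_inj.
  by rewrite (@col_mxEd _ 1 n n.+2 _ _ l q) tangentsE mxE.
by exists a; apply: der_ext Ha => z; rewrite mxE.
Qed.

Lemma dble_unit_normal i x (j : 'I_n.+2) : dble x (delta_mx 0 i) (fun z => unit_normal immersion z 0 j).
Proof.
have [a Ha] : dble x (delta_mx 0 i) (fun z => dot (cross immersion z) (cross immersion z)).
  by apply: dble_bigsum => k; apply: dble_mul; exact: dble_cross.
have c0 : 0 < dot (cross immersion x) (cross immersion x).
  rewrite cross_immersion dotZl dotZr dot_normal mulr1 -expr2.
  by rewrite lt_neqAle sqr_ge0 andbT eq_sym sqrf_eq0.
have Hs := @der_comp _ _ Num.sqrt _ x _ _ _ (der_sqrt_at c0) Ha.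
have s0 : Num.sqrt (dot (cross immersion x) (cross immersion x)) != 0.
  by rewrite gt_eqF// sqrtr_gt0.
have Hv := @der_comp _ _ (fun t => t^-1) _ x _ _ _ (der_inv_at s0) Hs.
have [b Hb] := dble_cross i x j.
eexists; apply: (@der_ext _ _ (fun z => (Num.sqrt (dot (cross immersion z)
  (cross immersion z)))^-1 * cross immersion z 0 j)) (der_mul Hv Hb) => z.
by rewrite [RHS]mxE.
Qed.

(* [eps] is differentiable with [eps ^ 2 = 1], hence has derivative 0. *)
Lemma der_unit_normal i x : is_derive x (delta_mx 0 i) (unit_normal immersion)
  ((eps x * kappa i x) *: tangent i x).
Proof.
have [e He] : dble x (delta_mx 0 i) eps.
  have [a Ha] : dble x (delta_mx 0 i) (fun z => dot (unit_normal immersion z) (normal z)).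
    apply: dble_bigsum => k; apply: dble_mul; first exact: dble_unit_normal.
    by eexists; exact: der_vec_coord (der_normal i x).
  exists a; apply: der_ext Ha => z.
  by rewrite unit_normalE dotZl dot_normal mulr1.
have e0 : e = 0.
  have H1 := der_exp 2 He.
  have H2 : is_derive x (delta_mx 0 i) (fun z => eps z ^+ 2) 0.
    have -> : (fun z => eps z ^+ 2) = fun=> 1 by apply/funext.
    exact: der_cst.
  move: H1 H2 => [_ E1] [_ E2]; rewrite E1 expr1 in E2.
  have n0 : 2 * eps x != 0.
    rewrite mulf_neq0 ?pnatr_eq0//.
    by apply/eqP => E; have := eps2 x; rewrite E expr0n => /esym/eqP; rewrite oner_eq0.
  by apply/eqP; move/eqP: E2; rewrite mulf_eq0 (negbTE n0).
apply: der_vec => j.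
apply: (@der_ext _ _ (fun z => eps z * normal z 0 j)) => [z|].
  by rewrite unit_normalE [RHS]mxE.
apply: der_eq (der_mul He (der_vec_coord j (der_normal i x))) _.
by rewrite e0 mul0r add0r [X in _ * X = _]mxE [RHS]mxE mulrA.
Qed.

Definition signed_kappa x : 'rV[R]_n := \row_i (- (eps x * kappa i x)).

Lemma shape_opE x : shape_op immersion x = diag_mx (signed_kappa x).
Proof.
rewrite /shape_op; pose D : 'rV[R]_n := \row_i (eps x * kappa i x).
have -> : tangents (unit_normal immersion) x = diag_mx D *m tangents immersion x.
  apply/matrixP => i j; rewrite mul_diag_mx [LHS]mxE (pderivE (der_unit_normal i x)).
  by rewrite tangentsE !mxE.
rewrite -(mulmxA (diag_mx _) (tangents _ _)) mul_tangents_tr mulmxK ?metric_unit//.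
by apply/matrixP => i j; rewrite !mxE mulNrn.
Qed.

Lemma shape_sqnormE x : shape_sqnorm immersion x = N.+1%:R * N%:R * lam (x 0 ax) ^+ 2.
Proof.
rewrite /shape_sqnorm shape_opE tr_diag_mx.
rewrite [X in X *m invmx _](_ : _ = diag_mx (signed_kappa x) *m metric immersion x); last first.
  by rewrite metricE diag_mxC.
rewrite mulmxK ?metric_unit// mulmx_diag mxtrace_diag.
rewrite (bigD1 ax)//= (eq_bigr (fun=> lam (x 0 ax) ^+ 2)) => [|i ii]; last first.
  by rewrite !mxE /kappa (negbTE ii) -[RHS]mul1r -(eps2 x); ring.
rewrite sumr_const cardC1 card_ord !mxE /kappa eqxx -[_ *+ _]mulr_natl.
transitivity (eps x ^+ 2 * (N%:R * lam (x 0 ax)) ^+ 2 + N%:R * lam (x 0 ax) ^+ 2).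
  by ring.
by rewrite eps2 -natr1; ring.
Qed.


(** The metric is diagonal and its density is [r^N conf^N], so the variables separate. The direction
    [ax] gives [(r^N h')' / r^N]; the others give [r^-2] times the Laplacian of the round sphere on
    [Y], which [S] and [ev] encode. *)
Lemma laplacian_immersion (h h' : R -> R) (h2 ev : R) (Y : 'rV[R]_n -> R)
    (dY : 'I_n -> 'rV[R]_n -> R) (S : 'I_n -> R) x :
  (forall u : R, is_derive u 1 h (h' u)) -> is_derive (x 0 ax) 1 h' h2 ->
  (forall i z, is_derive z (delta_mx 0 i) Y (dY i z)) -> (forall z, dY ax z = 0) ->
  (forall i, i != ax -> is_derive x (delta_mx 0 i)
    (fun z => conf ch z ^+ N / conf ch z ^+ 2 * dY i z) (S i)) ->
  \sum_(i | i != ax) S i = - ev * conf ch x ^+ N * Y x ->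
  laplacian immersion (fun z => h (z 0 ax) * Y z) x =
  (h2 + N%:R * r' (x 0 ax) / r (x 0 ax) * h' (x 0 ax) -
   ev / r (x 0 ax) ^+ 2 * h (x 0 ax)) * Y x.
Proof.
move=> dh dh' dYP dYax dS sumS.
have df j z : pderiv j (fun z => h (z 0 ax) * Y z) z =
    (j == ax)%:R * h' (z 0 ax) * Y z + h (z 0 ax) * dY j z.
  exact: pderivE (der_mul (der_coord_comp j (dh (z 0 ax))) (dYP j z)).
have FE i : (fun z => Num.sqrt (\det (metric immersion z)) *
    \sum_(j < n) invmx (metric immersion z) i j * pderiv j (fun z => h (z 0 ax) * Y z) z) =
    fun z => (r (z 0 ax) * conf ch z) ^+ N * ((metric_coef i z)^-1 *
      ((i == ax)%:R * h' (z 0 ax) * Y z + h (z 0 ax) * dY i z)).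
  apply/funext => z; rewrite sqrt_det_metric invmx_metric; congr (_ * _).
  rewrite (bigD1 i)//= big1 ?addr0 => [|j ji].
    by rewrite !mxE eqxx mulr1n df.
  by rewrite mxE eq_sym (negbTE ji) mulr0n mul0r.
have rn z : r z != 0 by rewrite gt_eqF.
have rcN (z : 'rV[R]_n) : (r (z 0 ax) * conf ch z) ^+ N = r (z 0 ax) ^+ N * conf ch z ^+ N.
  exact: exprMn.
pose F i (z : 'rV[R]_n) := (r (z 0 ax) * conf ch z) ^+ N * ((metric_coef i z)^-1 *
      ((i == ax)%:R * h' (z 0 ax) * Y z + h (z 0 ax) * dY i z)).
transitivity ((Num.sqrt (\det (metric immersion x)))^-1 * \sum_(i < n) pderiv i (F i) x).
  rewrite /laplacian; congr (_ * _); apply: eq_bigr => i _; congr (pderiv i _ x).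
  exact: FE.
rewrite sqrt_det_metric (bigD1 ax (erefl true)).
have -> : pderiv ax (F ax) x =
    (r (x 0 ax) * conf ch x) ^+ N * (h2 + N%:R * r' (x 0 ax) / r (x 0 ax) * h' (x 0 ax)) * Y x.
  apply: pderivE; rewrite /F.
  apply: (@der_ext _ _ (fun z : 'rV[R]_n => r (z 0 ax) ^+ N * h' (z 0 ax) * (conf ch z ^+ N * Y z))) => [z|].
    have -> : metric_coef ax z = 1 by rewrite /metric_coef eqxx.
    by rewrite eqxx dYax rcN invr1 /= ?mulr1n; ring.
  have dc0 : is_derive x (delta_mx 0 ax) (conf ch) 0.
    by apply: der_eq (der_conf ch x ax) _; rewrite equatorE eqxx !mulr0 oppr0.
  apply: der_eq (der_mul (der_coord_comp ax (der_mul (der_exp N (dr _)) dh'))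
    (der_mul (der_exp N dc0) (dYP ax x))) _.
  rewrite dYax eqxx rcN mul1r.
  have -> : r (x 0 ax) ^+ N.-1 = r (x 0 ax) ^+ N / r (x 0 ax).
    by rewrite -{2}(prednK N0) exprS mulrC mulKf.
  by field.
rewrite (eq_bigr (fun i => r (x 0 ax) ^+ N / r (x 0 ax) ^+ 2 * h (x 0 ax) * S i)) => [|i ii]; last first.
  apply: pderivE; rewrite /F.
  apply: (@der_ext _ _ (fun z : 'rV[R]_n => (r (z 0 ax) ^+ N / r (z 0 ax) ^+ 2 * h (z 0 ax)) *
     (conf ch z ^+ N / conf ch z ^+ 2 * dY i z))) => [z|].
    rewrite /metric_coef (negbTE ii) mulr0n !mul0r add0r rcN; field.
    by rewrite rn conf_neq0.
  have drN : is_derive (x 0 ax) 1 (fun u => (r u ^+ 2)^-1) (- (r (x 0 ax) ^+ 2) ^- 2 *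
      (2 * r (x 0 ax) ^+ 1 * r' (x 0 ax))).
    exact: (@der_comp _ _ (fun t => t^-1) (fun u => r u ^+ 2) (x 0 ax) 1 _ _
      (der_inv_at (expf_neq0 2 (rn (x 0 ax)))) (der_exp 2 (dr (x 0 ax)))).
  have H := der_mul (der_coord_comp i (der_mul (der_mul (der_exp N (dr (x 0 ax))) drN) (dh (x 0 ax)))) (dS i ii).
  by apply: der_eq H _; rewrite (negbTE ii) mulr0n !mul0r add0r.
rewrite /= -mulr_sumr sumS rcN; field.
by rewrite rn !expf_neq0 ?conf_neq0.
Qed.


Section Modes.
Variables (c : R) (h h' : R -> R).

Lemma jacobi_mode0 x : sl_sol (wgt N r) (wgt' N r r') (potential N r lam 0) c h h' ->
  - laplacian immersion (fun z => h (z 0 ax)) x - n%:R * h (x 0 ax) -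
    shape_sqnorm immersion x * h (x 0 ax) = c * h (x 0 ax).
Proof.
move=> s; have E : (fun z : 'rV[R]_n => h (z 0 ax)) = (fun z => h (z 0 ax) * cst 1 z).
  by apply/funext => z; rewrite mulr1.
have d0 i z : is_derive z (delta_mx 0 i) (cst 1 : 'rV[R]_n -> R) 0 by exact: der_cst.
have dS i : i != ax -> is_derive x (delta_mx 0 i)
    (fun z => conf ch z ^+ N / conf ch z ^+ 2 * (fun _ _ => 0 : R) i z) 0.
  move=> _; have -> : (fun z : 'rV[R]_n => conf ch z ^+ N / conf ch z ^+ 2 * 0) = fun=> 0.
    by apply/funext => z; rewrite mulr0.
  exact: der_cst.
have S0 : \sum_(i | i != ax) (0 : R) = - 0 * conf ch x ^+ N * cst 1 x.
  by rewrite big1// oppr0 !mul0r.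
rewrite E (laplacian_immersion (fun u => proj1 (s u)) (proj2 (s (x 0 ax))) d0 (fun=> erefl) dS S0).
rewrite shape_sqnormE (wgtE _ _ r_gt0) /potential /cst /n; ring.
Qed.

Lemma jacobi_mode1 j x : sl_sol (wgt N r) (wgt' N r r') (potential N r lam N%:R) c h h' ->
  let f (z : 'rV[R]_n) := h (z 0 ax) * stereo_vec ch z 0 j in
  - laplacian immersion f x - n%:R * f x - shape_sqnorm immersion x * f x = c * f x.
Proof.
move=> s f; rewrite /f.
rewrite (laplacian_immersion (fun u => proj1 (s u)) (proj2 (s (x 0 ax)))
  (fun i z => der_stereo ch z i j) _
  (fun i ii => der_dstereo x j (N0 : (1 < n)%N) ii)
  (sum_d2stereo ch x j (N0 : (1 < n)%N))); last first.
  by move=> z; rewrite dstereo_axis mxE.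
rewrite shape_sqnormE (wgtE _ _ r_gt0) /potential /n; ring.
Qed.

End Modes.

End Immersion.

(** * Smoothness of the eigenfunctions *)

Section SmoothClass.
Context {R : realType} {n : nat}.
Variable D : (R -> R) -> Prop.

(* An algebra of functions generated by the [f (x_j)], [f] in [D]; when the
   derivative of every generator lies in the algebra again, the algebra is
   stable under partial derivatives and so consists of smooth functions. *)
Inductive smooth_class : ('rV[R]_n -> R) -> Prop :=
| SCcst c : smooth_class (fun=> c)
| SCcoord j : smooth_class (fun x => x 0 j)
| SCgen f j : D f -> smooth_class (fun x => f (x 0 j))
| SCadd f g : smooth_class f -> smooth_class g -> smooth_class (fun x => f x + g x)
| SCmul f g : smooth_class f -> smooth_class g -> smooth_class (fun x => f x * g x)
| SCinv f : smooth_class f -> (forall x, f x != 0) -> smooth_class (fun x => (f x)^-1).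

Lemma smooth_class_opp f : smooth_class f -> smooth_class (fun x => - f x).
Proof.
move=> Hf; have -> : (fun x => - f x) = (fun x => -1 * f x).
  by apply/funext => x; rewrite mulN1r.
exact: SCmul (SCcst (-1)) Hf.
Qed.

Lemma smooth_class_exp f k : smooth_class f -> smooth_class (fun x => f x ^+ k).
Proof.
move=> Hf; elim: k => [|k IH]; first exact: SCcst.
have -> : (fun x => f x ^+ k.+1) = (fun x => f x * f x ^+ k).
  by apply/funext => x; rewrite exprS.
exact: SCmul.
Qed.

Lemma smooth_class_sum k (F : 'I_k -> 'rV[R]_n -> R) :
  (forall i, smooth_class (F i)) -> smooth_class (fun x => \sum_(i < k) F i x).
Proof.
elim: k F => [|k IH] F HF.
  have -> : (fun x => \sum_(i < 0) F i x) = fun=> 0.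
    by apply/funext => x; rewrite big_ord0.
  exact: SCcst.
have -> : (fun x => \sum_(i < k.+1) F i x) =
    (fun x => F ord0 x + \sum_(i < k) F (lift ord0 i) x).
  by apply/funext => x; rewrite big_ord_recl.
by apply: SCadd => //; exact: IH.
Qed.

Hypothesis D_der : forall f, D f -> exists f' : R -> R,
  (forall u : R, is_derive u 1 f (f' u)) /\ forall j, smooth_class (fun x => f' (x 0 j)).

Lemma smooth_class_continuous f : smooth_class f -> continuous f.
Proof.
elim=> {f} [c|j|f j Df|f g _ cf _ cg|f g _ cf _ cg|f _ cf f0] x.
- exact: cst_continuous.
- exact: coord_continuous.
- apply: (continuous_comp (f := fun x : 'rV[R]_n => x 0 j)); first exact: coord_continuous.
  by have [f' [df _]] := D_der Df; exact: der_continuous (df _).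
- exact: (cvgD (cf x) (cg x)).
- exact: (cvgM (cf x) (cg x)).
- exact: (cvgV (f0 x) (cf x)).
Qed.

Lemma smooth_class_der f i : smooth_class f -> exists f', smooth_class f' /\
  forall x, is_derive x (delta_mx 0 i) f (f' x).
Proof.
elim=> {f} [c|j|f j Df|f g Sf [f' [Sf' df]] Sg [g' [Sg' dg]]|
    f g Sf [f' [Sf' df]] Sg [g' [Sg' dg]]|f Sf [f' [Sf' df]] f0].
- by exists (fun=> 0); split; [exact: SCcst|move=> x; exact: der_cst].
- by exists (fun=> (i == j)%:R); split; [exact: SCcst|move=> x; exact: der_coord].
- have [f' [df Sf']] := D_der Df.
  exists (fun x => (i == j)%:R * f' (x 0 j)); split; first exact: SCmul (SCcst _) (Sf' j).
  by move=> x; exact: der_coord_comp.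
- exists (fun x => f' x + g' x); split; first exact: SCadd.
  by move=> x; exact: der_add.
- exists (fun x => f' x * g x + f x * g' x); split; first exact: SCadd (SCmul Sf' Sg) (SCmul Sf Sg').
  by move=> x; exact: der_mul.
- exists (fun x => - (f x)^-1 ^+ 2 * f' x); split.
    apply: SCmul Sf'; apply: smooth_class_opp; apply: smooth_class_exp; exact: SCinv.
  move=> x; rewrite exprVn.
  exact: (@der_comp _ _ (fun t => t^-1) f x _ _ _ (der_inv_at (f0 x)) (df x)).
Qed.

Lemma smooth_class_smooth f : smooth_class f -> is_smooth f.
Proof.
move=> + k; elim: k f => [|k IH] f Sf; first exact: smooth_class_continuous.
move=> i; have [f' [Sf' df]] := smooth_class_der i Sf; split.
  by move=> x; case: (df x).
have -> : pderiv i f = f' by apply: funext => x; exact: (pderivE (df x)).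
exact: IH.
Qed.

Lemma smooth_class_stereo (ch : 'I_n * bool) j : smooth_class (fun x => stereo_vec ch x 0 j).
Proof.
have Seq k : smooth_class (fun x => equator ch x 0 k).
  have -> : (fun x : 'rV[R]_n => equator ch x 0 k) = (fun x => x 0 k * (k != ch.1)%:R).
    by apply/funext => x; rewrite equatorE.
  exact: SCmul (SCcoord _) (SCcst _).
have Sconf : smooth_class (conf ch).
  apply: SCmul (SCcst 2) _; apply: SCinv.
    apply: SCadd (SCcst 1); apply: smooth_class_sum => k; exact: SCmul.
  by move=> x; rewrite gt_eqF// ltr_wpDl// dot_ge0.
have -> : (fun x : 'rV[R]_n => stereo_vec ch x 0 j) =
    (fun x => conf ch x * equator ch x 0 j + (1 + - conf ch x) * pole ch 0 j).
  by apply/funext => x; rewrite stereo_vec_coord.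
apply: SCadd; first exact: SCmul.
by apply: SCmul (SCcst _); apply: SCadd (SCcst _) _; exact: smooth_class_opp.
Qed.

End SmoothClass.

Section CurveSmooth.
Context {R : realType}.
Variables (N : nat) (r r' lam h h' : R -> R) (c ev : R).
Hypothesis r_gt0 : forall u, 0 < r u.
Hypothesis dr : forall u : R, is_derive u 1 r (r' u).
Hypothesis dr' : forall u : R, is_derive u 1 r' (- r u + N%:R * lam u ^+ 2 * r u).
Hypothesis dlam : forall u : R, is_derive u 1 lam (- (N.+1%:R * lam u * r' u / r u)).
Hypothesis sol : sl_sol (wgt N r) (wgt' N r r') (potential N r lam ev) c h h'.

Let D (f : R -> R) := [\/ f = r, f = r', f = lam | f = h \/ f = h'].

(** The differential equations express the derivative of each generator as a polynomial in the
    generators and [1 / r], so the algebra closes up. *)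
Lemma curve_class_der (n : nat) f : D f -> exists f' : R -> R,
  (forall u : R, is_derive u 1 f (f' u)) /\
  forall j, smooth_class D (fun x : 'rV[R]_n => f' (x 0 j)).
Proof.
have Sr j : smooth_class D (fun x : 'rV[R]_n => r (x 0 j)) by apply: SCgen; constructor 1.
have Sr' j : smooth_class D (fun x : 'rV[R]_n => r' (x 0 j)) by apply: SCgen; constructor 2.
have Sl j : smooth_class D (fun x : 'rV[R]_n => lam (x 0 j)) by apply: SCgen; constructor 3.
have Sh j : smooth_class D (fun x : 'rV[R]_n => h (x 0 j)).
  by apply: SCgen; constructor 4; left.
have Sh' j : smooth_class D (fun x : 'rV[R]_n => h' (x 0 j)).
  by apply: SCgen; constructor 4; right.
have SrV j : smooth_class D (fun x : 'rV[R]_n => (r (x 0 j))^-1).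
  by apply: SCinv (Sr j) _ => x; rewrite gt_eqF.
case=> [->|->|->|[->|->]].
- by exists r'.
- exists (fun u => - r u + N%:R * lam u ^+ 2 * r u); split=> // j.
  apply: SCadd; first exact: smooth_class_opp.
  by apply: SCmul => //; apply: SCmul (SCcst _ _) _; exact: smooth_class_exp.
- exists (fun u => - (N.+1%:R * lam u * r' u / r u)); split=> // j.
  apply: smooth_class_opp; apply: SCmul => //; apply: SCmul => //.
  exact: SCmul (SCcst _ _) _.
- by exists h'; split=> // u; exact: (proj1 (sol u)).
- exists (fun u => (potential N r lam ev u - c) * h u - N%:R * r' u / r u * h' u); split.
    by move=> u; rewrite -(wgtE _ _ r_gt0); exact: (proj2 (sol u)).
  move=> j; apply: SCadd; last first.
    apply: smooth_class_opp; apply: SCmul => //; apply: SCmul => //.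
    exact: SCmul (SCcst _ _) _.
  apply: SCmul => //; apply: SCadd (SCcst _ _); rewrite /potential.
  apply: SCadd; last first.
    apply: smooth_class_opp; apply: SCmul; first exact: SCcst.
    exact: smooth_class_exp.
  apply: SCadd (SCcst _ _); apply: SCmul (SCcst _ _) _.
  have -> : (fun x : 'rV[R]_n => (r (x 0 j) ^+ 2)^-1) = fun x => (r (x 0 j))^-1 ^+ 2.
    by apply/funext => x; rewrite exprVn.
  exact: smooth_class_exp.
Qed.

Lemma smooth_mode0 (n : nat) (ch : 'I_n * bool) :
  is_smooth (fun x : 'rV[R]_n => h (x 0 ch.1)).
Proof.
apply: (smooth_class_smooth (D := D)); first exact: curve_class_der.
by apply: SCgen; constructor 4; left.
Qed.

Lemma smooth_mode1 (n : nat) (ch : 'I_n * bool) j :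
  is_smooth (fun x : 'rV[R]_n => h (x 0 ch.1) * stereo_vec ch x 0 j).
Proof.
apply: (smooth_class_smooth (D := D)); first exact: curve_class_der.
apply: SCmul; last exact: smooth_class_stereo.
by apply: SCgen; constructor 4; left.
Qed.

End CurveSmooth.

(** * The index *)

Section IndexLowerBound.
Context {R : realType}.

Lemma dimension_ge (M : Type) (E : set (M -> R)) (I : finType) (f : I -> M -> R) :
  (forall i, E (f i)) ->
  (forall a : I -> R, (forall q, \sum_i a i * f i q = 0) -> forall i, a i = 0) ->
  (#|I|%:R%:E <= dimension E)%E.
Proof.
move=> Ef indep; apply: ereal_sup_ubound; exists #|I| => //=.
exists (fun j => f (enum_val j)); split=> // b H j.
have := indep (fun i => b (enum_rank i)) _ (enum_val j); rewrite enum_valK; apply.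
move=> q; rewrite -[RHS](H q) (reindex (@enum_val _ (mem I))) /=; last first.
  by exists enum_rank => i _; rewrite ?enum_valK ?enum_rankK.
by apply: eq_bigr => i _; rewrite enum_valK.
Qed.

(** Several [c i] may coincide: the indices are grouped by the value of [c], each fibre bounds one
    dimension from below, and the sizes of the fibres add up to [#|I|]. *)
Lemma stability_index_ge (n : nat) (C L : R) (g : R -> R) (I : finType)
    (c : I -> R) (f : I -> sphere R n * R -> R) :
  (forall i, c i < 0) -> (forall i, eigenspace_J C L g (c i) (f i)) ->
  (forall a : I -> R, (forall q, \sum_i a i * f i q = 0) -> forall i, a i = 0) ->
  (#|I|%:R%:E <= stability_index n C L g)%E.
Proof.
move=> c0 Ef indep; pose s := undup (map c (enum I)).
have sI i : c i \in s by rewrite mem_undup map_f// mem_enum.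
apply: esum_ge; exists [set` s].
  split; first exact: finite_seq.
  by move=> t /=; rewrite mem_undup => /mapP[i _ ->]; exact: c0.
rewrite -fsbig_seq ?undup_uniq//.
apply: (@le_trans _ _ (\sum_(t <- s) (#|[pred i | c i == t]|%:R%:E : \bar R))%E).
  rewrite sumEFin lee_fin -natr_sum ler_nat.
  rewrite (eq_bigr (fun t => \sum_(i : I | c i == t) 1)%N) => [|t _]; last by rewrite sum1_card.
  rewrite (exchange_big_dep predT)//= -sum1_card leq_sum// => i _.
  by rewrite sum1_count -has_count; apply/hasP; exists (c i).
apply: lee_sum => t _.
pose S := {i : I | c i == t}.
have -> : #|[pred i | c i == t]| = #|{: S}| by rewrite card_sig.
apply: (dimension_ge (f := fun i : S => f (val i))).
  by move=> [i /= /eqP <-]; exact: Ef.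
move=> a H i.
(* Coefficients on one fibre are extended by 0, so that independence of the whole family applies. *)
pose a' j := if insub j is Some i then a i else 0.
have := indep a' _ (val i); rewrite /a' valK; apply=> q.
rewrite -[RHS](H q) (bigID (fun j => c j == t))/= [X in _ + X]big1 ?addr0; last first.
  by move=> j jt; rewrite insubN ?mul0r.
rewrite (reindex_omap val (insub : I -> option S)) /=; last first.
  by move=> j jt; rewrite insubT.
apply: eq_big => [[j jt]|j _]; first by rewrite /= jt insubT/= eqxx.
by rewrite valK.
Qed.

End IndexLowerBound.

(** * Linear independence of eigenfunctions *)

Section Independence.
Context {R : realType}.

(** Differentiating the relation twice and using the equations yields a second relation with
    coefficients multiplied by the energies; as these differ, either term can be eliminated. *)
Lemma sl_eigen_indep (p p' V : R -> R) (l : R) (c : bool -> R) (h : bool -> R -> R) :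
  injective c -> (forall b, sl_eigen p p' V l (c b) (h b)) ->
  forall a : bool -> R, (forall u, \sum_b a b * h b u = 0) -> forall b, a b = 0.
Proof.
move=> cinj eig a H.
have H' u : a true * h true u + a false * h false u = 0 by rewrite -[RHS](H u) big_bool.
have [[h1' s1] [_ [u1 n1]]] := eig true; have [[h2' s2] [_ [u2 n2]]] := eig false.
have c12 : c true - c false != 0.
  by rewrite subr_eq0; apply/eqP => /cinj.
have d1 (u : R) : a true * h1' u + a false * h2' u = 0.
  apply: (der_unique (der_add (der_mulc (a true) (proj1 (s1 u)))
    (der_mulc (a false) (proj1 (s2 u))))).
  rewrite (_ : (fun z => _) = fun=> 0); first exact: der_cst.
  by apply/funext => z; exact: H'.
have d2 (u : R) := der_add (der_mulc (a true) (proj2 (s1 u))) (der_mulc (a false) (proj2 (s2 u))).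
have E u : a true * (c true * h true u) + a false * (c false * h false u) = 0.
  have d0 : is_derive u 1 (fun z => a true * h1' z + a false * h2' z) 0.
    rewrite (_ : (fun z => _) = fun=> 0); first exact: der_cst.
    by apply/funext => z; exact: d1.
  have := der_unique (d2 u) d0; have := H' u; have := d1 u.
  move: (h true u) (h false u) (h1' u) (h2' u) (p' u / p u) => x y x' y' q e1 e2 e3.
  transitivity (V u * (a true * x + a false * y) - q * (a true * x' + a false * y') -
    (a true * ((V u - c true) * x - q * x') + a false * ((V u - c false) * y - q * y'))).
    by ring.
  by rewrite e1 e2 e3; ring.
have z1 : a true = 0.
  have : (c true - c false) * (a true * h true u1) = 0.
    transitivity (a true * (c true * h true u1) + a false * (c false * h false u1) -
      c false * (a true * h true u1 + a false * h false u1)); first by ring.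
    by rewrite E H' mulr0 subr0.
  by move/eqP; rewrite !mulf_eq0 (negbTE c12) (negbTE n1) orbF => /eqP.
have z2 : a false = 0.
  have : (c true - c false) * (a false * h false u2) = 0.
    transitivity (c true * (a true * h true u2 + a false * h false u2) -
      (a true * (c true * h true u2) + a false * (c false * h false u2))); first by ring.
    by rewrite E H' mulr0 subr0.
  by move/eqP; rewrite !mulf_eq0 (negbTE c12) (negbTE n2) orbF => /eqP.
by case.
Qed.

Lemma even_odd_indep (e o : R -> R) : (forall u, e (- u) = e u) ->
  (forall u, o (- u) = - o u) -> (forall u, e u + o u = 0) ->
  forall u, e u = 0 /\ o u = 0.
Proof.
move=> ev od H u; have := H u; have := H (- u); rewrite ev od => H1 H2.
by split; lra.
Qed.

End Independence.

Theorem corollary3p2 (R : realType) (n : nat) (hn : (2 <= n)%N)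
    (C T : R) (g : R -> R) (hg : profile n C T g)
    (k m : nat) (hk : (0 < k)%N) (hm : (0 < m)%N) (hkm : coprime k m)
    (hT : theta n C g T = 2 * k%:R * pi / m%:R)
    (hiso : ~ isoparametric n C g) :
  (((2 * n + 5)%N%:R : R)%:E < stability_index n C (m%:R * T) g)%E.
Proof.
case: n hn hg hT hiso => // N N0 hg hT _.
pose r := prof_r C g; pose lam := prof_lambda N.+1 g; pose th := theta N.+1 C g.
pose r' u := derive1n 1 g u / Num.sqrt C.
have s0 : 0 < Num.sqrt C by rewrite sqrtr_gt0 (prof_C0 hg).
have r0 := prof_r_gt0 hg; have l0 := prof_lambda_gt0 hg.
have dr := dprof_r hg; have dr' := dprof_r' hg; have dlam := dprof_lambda hg.
have E := prof_energy hg.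
rewrite -/r -/lam in r0 l0 dr dr' dlam E.
have dth (u : R) : is_derive u 1 th (r u * lam u * (rho r u)^-1 ^+ 2).
  have crl : continuous (fun s => r s * lam s / (1 - r s ^+ 2)).
    pose Q s := r s * lam s / (1 - r s ^+ 2).
    move=> s; have n0 : 1 - r s ^+ 2 != 0 by rewrite gt_eqF// (one_subr2_gt0 r0 l0 E).
    exact: (der_continuous (der_mul (der_mul (dr s) (dlam s))
      (@der_comp _ _ (fun t => t^-1) (fun s => 1 - r s ^+ 2) s 1 _ _ (der_inv_at n0)
        (der_sub (der_cst 1 s 1) (der_exp 2 (dr s)))))).
  apply: der_eq (der_oriented_int u crl) _.
  by rewrite exprVn (sqr_rho r0 l0 E).
have th0 : th 0 = 0 by rewrite /th /theta /oriented_int lexx set_itv1 Rintegral_set1.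
have lamE u : lam u = (Num.sqrt C ^+ N.+1)^-1 * (r u ^+ N.+1)^-1.
  rewrite /lam /r /prof_lambda /prof_r -invfM -exprMn mulrC divfK// gt_eqF//.
have a0 : 0 < (Num.sqrt C ^+ N.+1)^-1 by rewrite invr_gt0 exprn_gt0.
have r_even u : r (- u) = r u by rewrite /r /prof_r (profile_even hg).
have r'_odd u : r' (- u) = - r' u by rewrite /r' (profile_der_odd hg) mulNr.
have r_per u : r (u + T) = r u by rewrite /r /prof_r (prof_period hg).
have r'_per u : r' (u + T) = r' u by rewrite /r' (profile_der_per hg).
have r_min u : r 0 <= r u by rewrite /r /prof_r ler_pM2r ?invr_gt0// (prof_min hg).
have T0 := prof_T0 hg.
have r'_gt0 u : 0 < u -> u < T / 2 -> 0 < r' u.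
  by move=> u0 uT; rewrite /r' divr_gt0// (profile_der_gt0 hg).
have [[c0e [h0e [c0ei P0e]]] [c0o [h0o [c0oi P0o]]]] := eigenvalues_mode0 N0
  r0 dr dr' dlam E dth th0 a0 lamE r_even r'_odd r_per r'_per r_min T0 r'_gt0 hk hm hT.
have [[c1e [h1e [c1ei P1e]]] [c1o [h1o P1o]]] := eigenvalues_mode1 N0
  r0 dr dr' dlam E dth th0 a0 lamE r_even r'_odd r_per r'_per r_min T0 r'_gt0 hk hm hT.
have lE : 2 * (m%:R * (T / 2)) = m%:R * T by field.
(* Degree 0 carries two even and two odd energies; degree 1 carries two even and one odd for each of
   the n coordinates. *)
pose I := ((bool + bool) + 'I_N.+1 * (bool + 'I_1))%type.
pose c (i : I) := match i with
  | inl (inl b) => c0e b | inl (inr b) => c0o b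
  | inr (_, inl b) => c1e b | inr (_, inr _) => c1o end.
pose f (i : I) (q : sphere R N.+1 * R) := match i with
  | inl (inl b) => h0e b q.2 | inl (inr b) => h0o b q.2
  | inr (j, inl b) => h1e b q.2 * sval q.1 0 j | inr (j, inr _) => h1o q.2 * sval q.1 0 j end.
have E0 ce h : sl_eigen (wgt N r) (wgt' N r r') (potential N r lam 0) (m%:R * (T / 2)) ce h ->
    eigenspace_J C (m%:R * T) g ce (fun q : sphere R N.+1 * R => h q.2).
  move=> [[h' s] [per _]]; split; [split|].
  - by move=> y u /=; rewrite -lE.
  - by move=> ch; exact: smooth_mode0 r0 dr dr' dlam s N.+1 ch.
  - by move=> ch x; have := jacobi_mode0 N0 r0 l0 dr dr' dlam E dth ch x s.
have E1 ce h j : sl_eigen (wgt N r) (wgt' N r r') (potential N r lam N%:R) (m%:R * (T / 2)) ce h ->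
    eigenspace_J C (m%:R * T) g ce (fun q : sphere R N.+1 * R => h q.2 * sval q.1 0 j).
  move=> [[h' s] [per _]]; split; [split|].
  - by move=> y u /=; rewrite -lE per.
  - by move=> ch; exact: smooth_mode1 r0 dr dr' dlam s N.+1 ch j.
  - by move=> ch x; have := jacobi_mode1 N0 r0 l0 dr dr' dlam E dth ch j x s.
have card : (2 * N.+1 + 5 < #|{: I}|)%N.
  by rewrite card_sum card_prod !card_sum !card_bool !card_ord; lia.
apply: lt_le_trans (stability_index_ge (c := c) (f := f) _ _ _); first by rewrite lte_fin ltr_nat.
- move=> [[b|b]|[j [b|b]]] /=; [by case: (P0e b)|by case: (P0o b)|by case: (P1e b)|by case: P1o].
- move=> [[b|b]|[j [b|b]]] /=.
  + by case: (P0e b) => _ + _; exact: E0.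
  + by case: (P0o b) => _ + _; exact: E0.
  + by case: (P1e b) => _ + _; exact: E1.
  + by case: P1o => _ + _; exact: E1.
move=> a Ha.
(* [A] is the part of the relation free of [y], and [B j] the coefficient of the coordinate
   [y_j]. *)
pose A u := \sum_b a (inl (inl b)) * h0e b u + \sum_b a (inl (inr b)) * h0o b u.
pose B j u := \sum_b a (inr (j, inl b)) * h1e b u + a (inr (j, inr ord0)) * h1o u.
have sumE (q : sphere R N.+1 * R) : A q.2 + \sum_j B j q.2 * sval q.1 0 j = 0.
  rewrite -[RHS](Ha q) big_sumType big_sumType /= -/(A q.2); congr (_ + _).
  rewrite (eq_bigr (fun p => a (inr (p.1, p.2)) * f (inr (p.1, p.2)) q)) => [|[j o]//].
  rewrite -(pair_bigA _ (fun j o => a (inr (j, o)) * f (inr (j, o)) q))/=.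
  apply: eq_bigr => j _; rewrite big_sumType/= big_ord1 /B mulrDl mulr_suml.
  by congr (_ + _); [apply: eq_bigr => b _|]; rewrite mulrA.
have pt (s : bool) j : dot ((-1) ^+ s *: delta_mx 0 j : 'rV[R]_N.+1)
    ((-1) ^+ s *: delta_mx 0 j) == 1.
  by rewrite dotZl dotZr dot_delta mxE !eqxx mulr1 -expr2 sqrr_sign.
(* At the two points [+ e_j] and [- e_j] of the sphere only the [j]-th coordinate survives, with
   either sign; hence [A] and [B j] vanish separately. *)
have AB (s : bool) j u : A u + (-1) ^+ s * B j u = 0.
  pose y : sphere R N.+1 :=
    exist (fun y : 'rV[R]_N.+1 => dot y y == 1) _ (pt s j).
  have := sumE (y, u); rewrite /= (bigD1 j)//= big1 => [|i ij].
    by rewrite addr0 !mxE !eqxx mulr1 mulrC.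
  by rewrite !mxE (negbTE ij) andbF !mulr0.
have A0 u : A u = 0 by have := AB true ord0 u; have := AB false ord0 u; rewrite expr0 expr1; lra.
have B0 j u : B j u = 0 by have := AB false j u; rewrite A0 expr0; lra.
(* Parity separates even from odd functions, whose energies may coincide; within one parity the
   energies are distinct. *)
have [Ae Ao] : (forall u, \sum_b a (inl (inl b)) * h0e b u = 0) /\
    (forall u, \sum_b a (inl (inr b)) * h0o b u = 0).
  have ev u : \sum_b a (inl (inl b)) * h0e b (- u) = \sum_b a (inl (inl b)) * h0e b u.
    by apply: eq_bigr => b _; have [_ _ ->] := P0e b.
  have od u : \sum_b a (inl (inr b)) * h0o b (- u) = - \sum_b a (inl (inr b)) * h0o b u.
    by rewrite -sumrN; apply: eq_bigr => b _; have [_ _ ->] := P0o b; rewrite mulrN.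
  by split=> u; have [] := even_odd_indep ev od A0 u.
have Bp j : (forall u, \sum_b a (inr (j, inl b)) * h1e b u = 0) /\
    (forall u, a (inr (j, inr ord0)) * h1o u = 0).
  have ev u : \sum_b a (inr (j, inl b)) * h1e b (- u) = \sum_b a (inr (j, inl b)) * h1e b u.
    by apply: eq_bigr => b _; have [_ _ ->] := P1e b.
  have od u : a (inr (j, inr ord0)) * h1o (- u) = - (a (inr (j, inr ord0)) * h1o u).
    by have [_ _ ->] := P1o; rewrite mulrN.
  by split=> u; have [] := even_odd_indep ev od (B0 j) u.
move=> [[b|b]|[j [b|b]]].
- apply: (sl_eigen_indep c0ei _ (a := fun b => a (inl (inl b))) Ae) => b'.
  by have [_ e _] := P0e b'; exact: e.
- apply: (sl_eigen_indep c0oi _ (a := fun b => a (inl (inr b))) Ao) => b'.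
  by have [_ e _] := P0o b'; exact: e.
- apply: (sl_eigen_indep c1ei _ (a := fun b => a (inr (j, inl b))) (Bp j).1) => b'.
  by have [_ e _] := P1e b'; exact: e.
- have [_ [_ [_ [u hu]]] _] := P1o; have := (Bp j).2 u; rewrite (ord1 b).
  by move/eqP; rewrite mulf_eq0 (negbTE hu) orbF => /eqP.
Qed.
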